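(* Let $M$ be a complex manifold of dimension $m$ endowed with a real analytic Kähler metric $g_M$ with Kähler form $\omega_M$. Assume that around every point of $M$ there are local holomorphic coordinates on a neighbourhood $U$ and a real analytic Kähler potential $\psi:U\to\mathbb{R}$ with $\omega_M=\frac{\sqrt{-1}}{2}\partial\bar\partial\psi$ on $U$, such that the polarization of $e^{\psi}$ is a holomorphic Nash function. Let $n\ge1$ be an integer, let $D\subset\mathbb{C}$ be a connected open subset, and let $F:D\to\mathbb{C}^n$ and $L:D\to M$ be holomorphic mappings such that $$F^*\omega_{\mathbb{C}^n}=L^*\omega_M\quad\text{on } D,$$ where $\omega_{\mathbb{C}^n}=\frac{\sqrt{-1}}{2}\partial\bar\partial\sum_{i=1}^n|z_i|^2$ is the Kähler form of the flat metric $g_{\mathbb{C}^n}$. Then $F$ is a constant map. Moreover, $(M,g_M)$ and $(\mathbb{C}^n,g_{\mathbb{C}^n})$ are not relatives.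
   Context: Nash function: a holomorphic function $f$ on an open set $D'\subset\mathbb{C}^k$ is a Nash function if for every $x_0\in D'$ there are an open neighbourhood $V$ of $x_0$ and a nonzero polynomial $P:\mathbb{C}^k\times\mathbb{C}\to\mathbb{C}$ with $P(x,f(x))=0$ for all $x\in V$. Polarization: if $u$ is real analytic on an open coordinate set $U\subset\mathbb{C}^m$, its polarization is the holomorphic function $u(z,w)$ on an open neighbourhood $W\subset U\times\mathrm{conj}(U)$ of the diagonal $\{(z,\bar z)\}$, where $\mathrm{conj}(U)=\{z:\bar z\in U\}$, such that $u(z,\bar z)=u(z)$. Relatives: two Kähler manifolds are relatives if they have a common Kähler submanifold (of positive dimension) with their induced metrics, i.e. there are a complex manifold $S$ of positive dimension and holomorphic immersions of $S$ into both manifolds which induce the same Kähler metric on $S$. *)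

(* Defs.v *)
From HB Require Import structures.
From mathcomp Require Import all_boot all_order all_algebra.
From mathcomp Require Import all_classical all_reals all_analysis.
From mathcomp Require Import complex.
(* The notations of mpoly clash with those of mathcomp-analysis. *)
From mathcomp Require mpoly.
Import (canonicals) mpoly.
Import Order.TTheory GRing.Theory Num.Theory.
Import numFieldNormedType.Exports.

Set Implicit Arguments.
Unset Strict Implicit.
Unset Printing Implicit Defensive.

Local Open Scope classical_set_scope.
Local Open Scope complex_scope.
Local Open Scope ring_scope.

(* The complex numbers, declared as a numClosedFieldType so that they and the
   matrices over them get the topology that mathcomp-analysis puts on numeric
   fields. *)
Definition Cplx (R : realType) : numClosedFieldType := R[i].

Definition Ci (R : realType) : Cplx R := 0 +i* 1.

(** * Functions on open subsets of C^m *)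

(* [differentiable] is Frechet differentiability over the base field, which is
   Cplx R here: complex differentiability. *)
Definition holomorphic (R : realType) (V W : normedModType (Cplx R))
    (D : set V) (f : V -> W) : Prop :=
  open D /\ forall x, D x -> differentiable f x.

(* The polynomial P lives on C^k x C; its last variable stands for f(x). *)
Definition nash (R : realType) (k : nat) (D : set 'rV[Cplx R]_k)
    (f : 'rV[Cplx R]_k -> Cplx R) : Prop :=
  holomorphic D f /\
  forall x0, D x0 ->
    exists (V : set 'rV[Cplx R]_k) (P : mpoly.mpoly (k + 1) (Cplx R)),
      [/\ open V, V x0, V `<=` D, P != 0 &
          forall x, V x ->
            mpoly.meval (fun i => row_mx x (const_mx (f x)) 0 i) P = 0].

(* Local expansion as a power series in the N real variables; the bound on the
   coefficients makes the series converge absolutely on the open cube of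
   half-side r, so the order of summation is immaterial. *)
Definition analytic_at (R : realType) (N : nat) (u : 'rV[R]_N -> R)
    (p : 'rV[R]_N) : Prop :=
  exists (a : ('I_N -> nat) -> R) (r A : R),
    [/\ 0 < r,
        forall al : 'I_N -> nat, `|a al| * r ^+ (\sum_i al i)%N <= A &
        forall x : 'rV[R]_N, (forall i, `|x 0 i - p 0 i| < r) ->
          (fun n : nat => \sum_(al : {ffun 'I_N -> 'I_n})
              a (fun i => al i : nat) * \prod_i (x 0 i - p 0 i) ^+ al i)
            @ \oo --> u x].

Definition of_real_coords (R : realType) (m : nat) (x : 'rV[R]_(m + m)) :
    'rV[Cplx R]_m :=
  \row_i (lsubmx x 0 i +i* rsubmx x 0 i).

Definition real_analytic (R : realType) (m : nat) (U : set 'rV[Cplx R]_m)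
    (u : 'rV[Cplx R]_m -> R) : Prop :=
  forall x : 'rV[R]_(m + m), U (of_real_coords x) ->
    analytic_at (u \o @of_real_coords R m) x.

Definition conj_vec (R : realType) (m : nat) (z : 'rV[Cplx R]_m) : 'rV[Cplx R]_m :=
  map_mx (@conjc R) z.

Definition polarization (R : realType) (m : nat) (U : set 'rV[Cplx R]_m)
    (u : 'rV[Cplx R]_m -> R)
    (W : set 'rV[Cplx R]_(m + m)) (h : 'rV[Cplx R]_(m + m) -> Cplx R) : Prop :=
  [/\ holomorphic W h,
      forall z w, W (row_mx z w) -> U z /\ U (conj_vec w) &
      forall z, U z ->
        W (row_mx z (conj_vec z)) /\ h (row_mx z (conj_vec z)) = (u z)%:C].

Definition real_deriv (R : realType) (m : nat) (f : 'rV[Cplx R]_m -> Cplx R)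
    (v z : 'rV[Cplx R]_m) : Cplx R :=
  derive1 (fun t : R => complex.Re (f (z + t%:C *: v))) 0 +i*
  derive1 (fun t : R => complex.Im (f (z + t%:C *: v))) 0.

(* Wirtinger derivatives d/dz_j and d/dzbar_j. *)
Definition dz (R : realType) (m : nat) (j : 'I_m) (f : 'rV[Cplx R]_m -> Cplx R)
    (z : 'rV[Cplx R]_m) : Cplx R :=
  2^-1 * (real_deriv f (delta_mx 0 j) z - Ci R * real_deriv f (Ci R *: delta_mx 0 j) z).

Definition dzbar (R : realType) (m : nat) (j : 'I_m) (f : 'rV[Cplx R]_m -> Cplx R)
    (z : 'rV[Cplx R]_m) : Cplx R :=
  2^-1 * (real_deriv f (delta_mx 0 j) z + Ci R * real_deriv f (Ci R *: delta_mx 0 j) z).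

(** * Hermitian forms and real (1,1)-forms *)

(* A matrix G stands for the (1,1)-form
   (i/2) sum_jk G_jk dz_j /\ dzbar_k, equivalently for the Hermitian form
   (v, w) |-> sum_jk v_j G_jk conj(w_k).  *)

(* The matrix of d dbar u: it represents the form (i/2) d dbar u. *)
Definition ddbar (R : realType) (m : nat) (u : 'rV[Cplx R]_m -> R)
    (z : 'rV[Cplx R]_m) : 'M[Cplx R]_m :=
  \matrix_(j, k) dz j (dzbar k (fun w => (u w)%:C)) z.

(* Tangent vectors are rows, pushed forward by v |-> v *m J. *)
Definition pull (R : realType) (k m : nat) (J : 'M[Cplx R]_(k, m))
    (G : 'M[Cplx R]_m) : 'M[Cplx R]_k :=
  J *m G *m (map_mx (@conjc R) J)^T.

Definition hermitian_posdef (R : realType) (m : nat) (G : 'M[Cplx R]_m) : Prop :=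
  (map_mx (@conjc R) G)^T = G /\
  forall v : 'rV[Cplx R]_m, v != 0 -> 0 < pull v G 0 0.

(** * Complex manifolds *)

Record chart (R : realType) (T : topologicalType) (m : nat) := Chart {
  cdom : set T;
  cfun : T -> 'rV[Cplx R]_m;
  cinv : 'rV[Cplx R]_m -> T }.

Definition crange (R : realType) (T : topologicalType) (m : nat)
    (c : chart R T m) : set 'rV[Cplx R]_m := cfun c @` cdom c.

Definition is_chart (R : realType) (T : topologicalType) (m : nat)
    (c : chart R T m) : Prop :=
  [/\ open (cdom c), open (crange c),
      forall x, cdom c x -> cinv c (cfun c x) = x,
      forall x, cdom c x -> {for x, continuous (cfun c)} &
      forall z, crange c z -> {for z, continuous (cinv c)}].

Definition transition (R : realType) (T : topologicalType) (m : nat)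
    (c d : chart R T m) : 'rV[Cplx R]_m -> 'rV[Cplx R]_m := cfun d \o cinv c.

Definition compatible (R : realType) (T : topologicalType) (m : nat)
    (c d : chart R T m) : Prop :=
  forall x, cdom c x -> cdom d x ->
    differentiable (transition c d) (cfun c x) /\
    differentiable (transition d c) (cfun d x).

(* The carrier of a manifold of dimension m and a holomorphic atlas, which need
   not be maximal. *)
Record manifold (R : realType) (m : nat) := Manifold {
  carrier :> topologicalType;
  atlas : set (chart R carrier m) }.
Arguments atlas {R m} _.

Definition complex_manifold (R : realType) (m : nat) (M : manifold R m) : Prop :=
  [/\ hausdorff_space M, @second_countable M,
      forall c, atlas M c -> is_chart c,
      forall c d, atlas M c -> atlas M d -> compatible c d &
      forall x : M, exists2 c, atlas M c & cdom c x].

Definition holomorphic_coordinates (R : realType) (m : nat) (M : manifold R m)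
    (d : chart R M m) : Prop :=
  is_chart d /\ forall c, atlas M c -> compatible c d.

Definition local_rep (R : realType) (k m : nat) (X : manifold R k)
    (Y : manifold R m) (c : chart R X k) (d : chart R Y m) (f : X -> Y) :
    'rV[Cplx R]_k -> 'rV[Cplx R]_m :=
  cfun d \o f \o cinv c.

Definition holomorphic_map (R : realType) (k m : nat) (X : manifold R k)
    (Y : manifold R m) (D : set X) (f : X -> Y) : Prop :=
  open D /\
  forall x, D x ->
    {for x, continuous f} /\
    forall c d, atlas X c -> atlas Y d -> cdom c x -> cdom d (f x) ->
      differentiable (local_rep c d f) (cfun c x).

Definition holomorphic_immersion (R : realType) (k m : nat) (X : manifold R k)
    (Y : manifold R m) (f : X -> Y) : Prop :=
  holomorphic_map setT f /\
  forall x c d, atlas X c -> atlas Y d -> cdom c x -> cdom d (f x) ->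
    row_free ('J (local_rep c d f) (cfun c x)).

(** * Kaehler metrics *)

(* [g c x] is the matrix, in the coordinates of the chart c of the atlas, of the
   metric at the point x of the domain of c. *)
Definition metric (R : realType) (m : nat) (M : manifold R m) : Type :=
  chart R M m -> M -> 'M[Cplx R]_m.

Definition hermitian_metric (R : realType) (m : nat) (M : manifold R m)
    (g : metric M) : Prop :=
  (forall c x, atlas M c -> cdom c x -> hermitian_posdef (g c x)) /\
  (forall c d x, atlas M c -> atlas M d -> cdom c x -> cdom d x ->
     g c x = pull ('J (transition c d) (cfun c x)) (g d x)).

Definition real_analytic_metric (R : realType) (m : nat) (M : manifold R m)
    (g : metric M) : Prop :=
  forall c j k, atlas M c ->
    real_analytic (crange c) (fun z => complex.Re (g c (cinv c z) j k)) /\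
    real_analytic (crange c) (fun z => complex.Im (g c (cinv c z) j k)).

(* The vanishing of the (2,1) and (1,2) components of the exterior derivative
   of (i/2) sum_jk g_jk dz_j /\ dzbar_k. *)
Definition closed_form (R : realType) (m : nat) (M : manifold R m)
    (g : metric M) : Prop :=
  forall c z j k l, atlas M c -> crange c z ->
    dz l (fun w => g c (cinv c w) j k) z = dz j (fun w => g c (cinv c w) l k) z /\
    dzbar l (fun w => g c (cinv c w) j k) z = dzbar k (fun w => g c (cinv c w) j l) z.

Definition real_analytic_kahler (R : realType) (m : nat) (M : manifold R m)
    (g : metric M) : Prop :=
  [/\ hermitian_metric g, real_analytic_metric g & closed_form g].

(* The form of g is (i/2) d dbar psi on the domain of the coordinates d. *)
Definition kahler_potential (R : realType) (m : nat) (M : manifold R m)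
    (g : metric M) (d : chart R M m) (psi : M -> R) : Prop :=
  forall c x, atlas M c -> cdom c x -> cdom d x ->
    g c x = pull ('J (transition c d) (cfun c x))
                 (ddbar (psi \o cinv d) (cfun d x)).

Definition pullback (R : realType) (k m : nat) (X : manifold R k)
    (Y : manifold R m) (g : metric Y) (c : chart R X k) (d : chart R Y m)
    (f : X -> Y) (x : X) : 'M[Cplx R]_k :=
  pull ('J (local_rep c d f) (cfun c x)) (g d (f x)).

Definition same_pullback (R : realType) (k m n : nat) (X : manifold R k)
    (Y : manifold R m) (Z : manifold R n) (gY : metric Y) (gZ : metric Z)
    (D : set X) (f : X -> Y) (h : X -> Z) : Prop :=
  forall x c d e, D x -> atlas X c -> atlas Y d -> atlas Z e ->
    cdom c x -> cdom d (f x) -> cdom e (h x) ->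
    pullback gY c d f x = pullback gZ c e h x.

(* S has to be nonempty, otherwise any two manifolds would be relatives. The
   metric induced by a Kaehler metric under a holomorphic immersion is
   automatically Kaehler. *)
Definition relatives (R : realType) (m n : nat) (M : manifold R m)
    (N : manifold R n) (gM : metric M) (gN : metric N) : Prop :=
  exists (s : nat) (S : manifold R s) (f : S -> M) (h : S -> N),
    [/\ (0 < s)%N, complex_manifold S, [set: S] !=set0,
        holomorphic_immersion f /\ holomorphic_immersion h &
        same_pullback gM gN setT f h].

(** * The complex line and the flat space C^n *)

Definition complex_line (R : realType) : manifold R 1 :=
  @Manifold R 1 (Cplx R)
    [set Chart setT (fun z : Cplx R => const_mx z) (fun v => v 0 0)].

Definition complex_space (R : realType) (n : nat) : manifold R n :=
  @Manifold R n 'rV[Cplx R]_n [set Chart setT id id].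

Definition flat_metric (R : realType) (n : nat) : metric (complex_space R n) :=
  fun _ z => ddbar (fun w => \sum_i (complex.Re (w 0 i) ^+ 2 + complex.Im (w 0 i) ^+ 2)) z.

(* Main.v *)
(* Polarizing |F'|^2 = L^* (d dbar psi) in t, one finds that the Nash functions
   h (L tau, w), restricted to the conjugate curve w = Lbar s, satisfy
   h (L tau, Lbar s) / h (L t0, Lbar s) = const * exp ((F tau - F t0) . Fbar s).
   These exponentials are algebraic over the field generated by the m coordinates
   of Lbar s. If F' (t0) != 0, take the product of such a quotient over r points
   s_1, ..., s_r for which the vectors Fbar' (s_i) span Fbar' (s0), with r maximal.
   For more than r m values of tau these products are algebraically dependent;
   differentiating the relation in the direction of Fbar' (s0) multiplies each
   monomial by a constant, these constants are distinct for suitable values of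
   tau, and hence all the coefficients vanish. *)
Require Import Defs.
From HB Require Import structures.
From mathcomp Require Import all_boot all_order all_algebra.
From mathcomp Require Import all_classical all_reals all_analysis.
From mathcomp Require Import complex zify ring lra.
From mathcomp Require mpoly.
Import (canonicals, coercions) mpoly.
Import Order.TTheory GRing.Theory Num.Theory.
Import numFieldNormedType.Exports.

Set Implicit Arguments.
Unset Strict Implicit.
Unset Printing Implicit Defensive.

Local Open Scope classical_set_scope.
Local Open Scope complex_scope.
Local Open Scope ring_scope.

(** The obstacle is that the logarithmic derivatives (F tau - F t0) . Fbar' s of the exponentials
    vary with s, so that differentiating a relation at a single point s does not multiply its terms
    by constants. With r points, Fbar' s0 is a combination of the Fbar' s_i whose coefficients
    depend on the points but not on tau; the same combination of partial derivatives acts on each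
    monomial by a number free of the points. Maximality of r keeps this true on open sets of points,
    which is what allows a relation to be differentiated again and again. The order of the choices
    matters. The degree D of the algebraic relations depends on the Nash polynomial alone, r on F
    near t0, and the bound d on the exponents on m, r and D. Only then are the tau_j chosen, because
    the distinctness of the multipliers involves d, and last the discs in s, because these depend on
    the tau_j. The discs cannot be centred at prescribed points: the leading coefficient of an
    algebraic relation may vanish there. *)

Local Notation Re := (@complex.Re _).
Local Notation Im := (@complex.Im _).

(** * One complex variable *)

(* Norms over Cplx R take values in Cplx R; nr is the same number as a real. *)
Definition nr (R : realType) (V : normedModType (Cplx R)) (x : V) : R := Re `|x|.

(** * Epsilon-delta forms of continuity and differentiability over C *)

Section RealNorm.
Context {R : realType}.
Notation C := (Cplx R).
Implicit Types V W : normedModType C.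

Lemma nrE V (x : V) : `|x| = (nr x)%:C.
Proof. by rewrite /nr; apply/esym/RRe_real/ger0_real/normr_ge0. Qed.

Lemma nr_ge0 V (x : V) : 0 <= nr x.
Proof. by rewrite -ler0c -nrE. Qed.

Lemma nrD V (x y : V) : nr (x + y) <= nr x + nr y.
Proof. by have := ler_normD x y; rewrite !nrE -rmorphD lecR.
Qed.

Lemma nrN V (x : V) : nr (- x) = nr x.
Proof. by rewrite /nr normrN. Qed.

Lemma nrB V (x y : V) : nr (x - y) = nr (y - x).
Proof. by rewrite /nr distrC. Qed.

Lemma nrZ V (k : C) (x : V) : nr (k *: x) = nr k * nr x.
Proof. by have := normrZ k x; rewrite !nrE -rmorphM => /complexI. Qed.

Lemma nrM (x y : C) : nr (x * y) = nr x * nr y.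
Proof. by have := normrM x y; rewrite !nrE -rmorphM => /complexI. Qed.

Lemma nrX (x : C) n : nr (x ^+ n) = nr x ^+ n.
Proof. by have := normrX n x; rewrite !nrE -rmorphXn => /complexI. Qed.

Lemma nrV (x : C) : nr x^-1 = (nr x)^-1.
Proof. by have := normfV x; rewrite !nrE -fmorphV => /complexI. Qed.

Lemma nr0 V : nr (0 : V) = 0.
Proof. by rewrite /nr normr0. Qed.

Lemma nr1 : nr (1 : C) = 1.
Proof. by rewrite /nr normr1. Qed.

Lemma nr_eq0 V (x : V) : nr x = 0 -> x = 0.
Proof. by move=> h; apply/normr0_eq0; rewrite nrE h. Qed.

Lemma nr_gt0 V (x : V) : (0 < nr x) = (x != 0).
Proof. by rewrite -ltcR -nrE normr_gt0. Qed.

Lemma nrC (x : R) : nr (x%:C : C) = `|x|.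
Proof. by rewrite /nr normc_def /= expr0n /= addr0 sqrtr_sqr. Qed.

Lemma nr_conj (z : C) : nr (conjc z : C) = nr z.
Proof. by rewrite /nr normcJ. Qed.

Lemma ler_Re_nr (z : C) : `|Re z| <= nr z.
Proof. by rewrite -lecR -nrE; exact: normc_ge_Re. Qed.

Lemma nr_i : nr (Ci R) = 1.
Proof. by rewrite /nr normc_def /= expr0n expr1n /= add0r sqrtr1. Qed.

Lemma complex_split (z : C) : z = (Re z)%:C + Ci R * (Im z)%:C.
Proof. by rewrite {1}(complexE z). Qed.

Lemma ler_Im_nr (z : C) : `|Im z| <= nr z.
Proof.
have -> : Im z = Re (- (Ci R) * z :> C).
  by case: z => a b; rewrite /Ci mulNr /= mul0r mul1r sub0r opprK.
by apply: le_trans (ler_Re_nr _) _; rewrite nrM nrN nr_i mul1r.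
Qed.

Lemma nr_leReIm (z : C) : nr z <= `|Re z| + `|Im z|.
Proof.
rewrite {1}(complex_split z); apply: le_trans (nrD _ _) _.
by rewrite nrM nr_i mul1r !nrC.
Qed.

Lemma nbhs_nrP V (x : V) (A : set V) :
  nbhs x A <-> exists2 e : R, 0 < e & forall y, nr (y - x) < e -> A y.
Proof.
rewrite -filter_from_norm_nbhs; split => [[e /= e0 sA]|[e e0 sA]].
- have Ee : e = (Re e)%:C by rewrite RRe_real ?gtr0_real.
  exists (Re e); first by rewrite -ltcR -Ee.
  by move=> y yx; apply: sA => /=; rewrite distrC nrE Ee ltcR.
- exists e%:C; first by rewrite /= ltcR.
  by move=> y /= ; rewrite distrC nrE ltcR => /sA.
Qed.

Lemma cvg_nrP V W (f : V -> W) x l :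
  (f y @[y --> x] --> l) <->
  forall e : R, 0 < e -> exists2 d : R, 0 < d &
    forall y, nr (y - x) < d -> nr (f y - l) < e.
Proof.
split => [cf e e0|h A].
- have /cf : nbhs l (fun z => nr (z - l) < e) by apply/nbhs_nrP; exists e.
  by move/nbhs_nrP => [d d0 hd]; exists d.
- by case/nbhs_nrP => e e0 hA; have [d d0 hd] := h e e0; apply/nbhs_nrP; exists d => // y /hd /hA.
Qed.

Lemma continuous_nrP V W (f : V -> W) x : {for x, continuous f} <->
  forall e : R, 0 < e -> exists2 d : R, 0 < d &
    forall y, nr (y - x) < d -> nr (f y - f x) < e.
Proof. exact: cvg_nrP. Qed.

Lemma open_nrP V (A : set V) : open A <->
  forall x, A x -> exists2 e : R, 0 < e & forall y, nr (y - x) < e -> A y.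
Proof.
rewrite openE; split=> h x /h; first by move/nbhs_nrP.
by move=> ?; apply/nbhs_nrP.
Qed.

Lemma differentiable_nr V W (f : V -> W) x : differentiable f x ->
  forall e : R, 0 < e -> exists2 d : R, 0 < d &
    forall y, nr (y - x) < d -> nr (f y - f x - 'd f x (y - x)) <= e * nr (y - x).
Proof.
move=> df e e0.
have := diff_locally df; move/eqaddoP.
move=> /(_ e%:C); rewrite ltcR => /(_ e0) /nbhs_nrP [d d0 hd].
exists d => // y yx; have := hd (y - x).
rewrite subr0 => /(_ yx) /=; rewrite !nrE.
rewrite -rmorphM lecR; congr (nr _ <= _).
by rewrite /= !fctE subrK opprD addrA.
Qed.

(** The bound makes [L] continuous, which the uniqueness of the differential requires since [V] may
    have infinite dimension. *)
Lemma nr_differentiable V W (f : V -> W) x (L : {linear V -> W}) (M : R) :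
  (forall y, nr (L y) <= M * nr y) ->
  (forall e : R, 0 < e -> exists2 d : R, 0 < d &
    forall y, nr (y - x) < d -> nr (f y - f x - L (y - x)) <= e * nr (y - x)) ->
  differentiable f x /\ 'd f x = L :> (V -> W).
Proof.
move=> bL h.
have cL : continuous L.
  move=> z; apply/continuous_nrP => e e0.
  have M1 : 0 < `|M| + 1 by rewrite ltr_wpDl.
  exists (e / (`|M| + 1)); first exact: divr_gt0.
  move=> y yz; rewrite -linearB; apply: le_lt_trans (bL _) _.
  apply: le_lt_trans (_ : (`|M| + 1) * nr (y - z) < _).
    apply: ler_wpM2r; first exact: nr_ge0.
    by apply: le_trans (ler_norm _) _; rewrite lerDl.
  by rewrite mulrC -ltr_pdivlMr.
have E : f \o shift x = cst (f x) + L +o_ 0 id.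
  apply/eqaddoP => e e0.
  have Ee : e = (Re e)%:C by rewrite RRe_real ?gtr0_real.
  have e0' : 0 < Re e by rewrite -ltcR -Ee.
  have [d d0 hd] := h _ e0'.
  apply/nbhs_nrP; exists d => // y; rewrite subr0 => yd.
  rewrite !nrE Ee -rmorphM lecR.
  have := hd (y + x); rewrite addrK => /(_ yd); congr (nr _ <= _).
  by rewrite /= !fctE opprD addrA.
have dE := diff_unique cL E; split => //.
by apply/diff_locallyP; rewrite dE.
Qed.

End RealNorm.

Arguments nr {R V} x.

(** * Integrals of complex functions of a real variable *)

Section Primitive.
Context {R : realType}.
Notation C := (Cplx R).
Local Notation mu := (@lebesgue_measure R).

(* The base point -2 is arbitrary: all the segments of integration below have their
   parameter in [-2, 2], where the integrands are assumed to be continuous. *)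
Definition prim (p : R -> R) (x : R) : R := (\int[mu]_(t in [set` `[(-2), x]]) p t)%R.

Lemma prim_derive (p : R -> R) (x : R) : (forall x : R, `|x| <= 2 -> {for x, continuous p}) ->
  `|x| < 2 -> is_derive x 1 (prim p) (p x).
Proof.
move=> cp x2.
have [x2' x2''] : -2 < x /\ x < 2 by move: x2; rewrite ltr_norml => /andP.
have ip : mu.-integrable `[(-2), 2] (EFin \o p).
  apply: continuous_compact_integrable; first exact: segment_compact.
  apply: continuous_in_subspaceT => y; rewrite inE /= in_itv /= -ler_norml.
  exact: cp.
have [dp <-] := @continuous_FTC1_closed R p (-2) x 2 x2'' ip x2' (cp x (ltW x2)).
by rewrite derive1E; apply: derivableP.
Qed.

Lemma prim_diff (p G : R -> R) (a b : R) :
  (forall x : R, `|x| <= 2 -> {for x, continuous p}) ->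
  -2 < a -> a <= b -> b < 2 ->
  (forall x, a <= x <= b -> is_derive x 1 G (p x)) ->
  prim p b - prim p a = G b - G a.
Proof.
move=> cp a2 ab b2 dG.
have dH x : a <= x <= b -> is_derive x 1 (prim p - G) 0.
  move=> /[dup] axb /andP[ax xb].
  have dp : is_derive x 1 (prim p) (p x).
    by apply: prim_derive => //; rewrite ltr_norml; apply/andP; split; lra.
  have := dG x axb => dGx.
  by apply: is_derive_eq; rewrite subrr.
have [||c _] := @MVT_segment _ (prim p - G) (fun=> 0) a b ab.
- by move=> x; rewrite in_itv /= => /andP[ax xb]; apply: dH; rewrite !ltW.
- apply: derivable_within_continuous => x; rewrite in_itv /= => axb.
  by have := dH x axb => -[].
- by rewrite mul0r !fctE => ?; lra.
Qed.

Lemma prim_bound (p : R -> R) (M a b : R) :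
  (forall x : R, `|x| <= 2 -> {for x, continuous p}) ->
  -2 < a -> a <= b -> b < 2 -> (forall x, a <= x <= b -> `|p x| <= M) ->
  `|prim p b - prim p a| <= M * (b - a).
Proof.
move=> cp a2 ab b2 pM.
have dp x : a <= x <= b -> is_derive x 1 (prim p) (p x).
  by move=> /andP[ax xb]; apply: prim_derive => //; rewrite ltr_norml; apply/andP; split; lra.
have [||c cab ->] := @MVT_segment _ (prim p) p a b ab.
- by move=> x; rewrite in_itv /= => /andP[ax xb]; apply: dp; rewrite !ltW.
- apply: derivable_within_continuous => x; rewrite in_itv /= => axb.
  by have := dp x axb => -[].
- rewrite normrM (ger0_norm (_ : 0 <= b - a)) ?subr_ge0 // ler_wpM2r ?subr_ge0 //.
  by apply: pM; move: cab; rewrite in_itv.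
Qed.

Definition ccont (p : R -> C) := forall x : R, `|x| <= 2 ->
  {for x, continuous (Re \o p)} /\ {for x, continuous (Im \o p)}.

(** As a difference of values of one primitive, the integral is additive in the interval for end
    points in any order. *)
Definition Int (p : R -> C) (a b : R) : C :=
  (prim (Re \o p) b - prim (Re \o p) a) +i* (prim (Im \o p) b - prim (Im \o p) a).

Definition cderR (G : R -> C) (x : R) (d : C) :=
  is_derive x 1 (Re \o G) (Re d) /\ is_derive x 1 (Im \o G) (Im d).

Lemma Int_FTC p G (a b : R) : ccont p -> -2 < a -> a <= b -> b < 2 ->
  (forall x, a <= x <= b -> cderR G x (p x)) -> Int p a b = G b - G a.
Proof.
move=> cp a2 ab b2 dG; rewrite /Int.
have -> : prim (Re \o p) b - prim (Re \o p) a = Re (G b) - Re (G a).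
  by apply: (@prim_diff (Re \o p) (Re \o G)) => // x; [case/cp|case/dG].
have -> : prim (Im \o p) b - prim (Im \o p) a = Im (G b) - Im (G a).
  by apply: (@prim_diff (Im \o p) (Im \o G)) => // x; [case/cp|case/dG].
by case: (G b) (G a) => ? ? [].
Qed.

Lemma Int_cat p a b c : Int p a b + Int p b c = Int p a c.
Proof. by rewrite /Int; apply/eqP; rewrite eq_complex /=; apply/andP; split; apply/eqP; ring. Qed.

(** The factor 2 is the price of bounding the real and the imaginary part separately. *)
Lemma Int_bound p (M a b : R) : ccont p -> -2 < a -> a <= b -> b < 2 ->
  (forall x, a <= x <= b -> nr (p x) <= M) -> nr (Int p a b) <= 2 * M * (b - a).
Proof.
move=> cp a2 ab b2 pM.
apply: le_trans (nr_leReIm _) _ => /=.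
have h1 := @prim_bound (Re \o p) M a b (fun x hx => (cp x hx).1) a2 ab b2.
have h2 := @prim_bound (Im \o p) M a b (fun x hx => (cp x hx).2) a2 ab b2.
have := h1 (fun x hx => le_trans (ler_Re_nr _) (pM x hx)).
have := h2 (fun x hx => le_trans (ler_Im_nr _) (pM x hx)).
by lra.
Qed.

Lemma ccont_lin k (p q : R -> C) : ccont p -> ccont q -> ccont (fun x => k * p x + q x).
Proof.
move=> cp cq x x2; have [cp1 cp2] := cp x x2; have [cq1 cq2] := cq x x2.
split.
- have -> : Re \o (fun x => k * p x + q x) =
    (fun x => Re k * (Re \o p) x - Im k * (Im \o p) x + (Re \o q) x).
    by apply/funext => y /=; case: k (p y) (q y) => ? ? [? ?] [].
  by apply: cvgD => //; apply: cvgB; apply: cvgMr.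
- have -> : Im \o (fun x => k * p x + q x) =
    (fun x => Re k * (Im \o p) x + Im k * (Re \o p) x + (Im \o q) x).
    by apply/funext => y /=; case: k (p y) (q y) => ? ? [? ?] [].
  by apply: cvgD => //; apply: cvgD; apply: cvgMr.
Qed.

Lemma Int_derive p (a x : R) : ccont p -> `|x| < 2 -> cderR (Int p a) x (p x).
Proof.
move=> cp x2; split.
- have dp : is_derive x 1 (prim (Re \o p)) (Re (p x)).
    exact: (@prim_derive (Re \o p) x (fun x hx => (cp x hx).1)).
  have -> : Re \o Int p a = prim (Re \o p) - cst (prim (Re \o p) a) by apply/funext.
  by apply: is_derive_eq; rewrite subr0.
- have dp : is_derive x 1 (prim (Im \o p)) (Im (p x)).
    exact: (@prim_derive (Im \o p) x (fun x hx => (cp x hx).2)).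
  have -> : Im \o Int p a = prim (Im \o p) - cst (prim (Im \o p) a) by apply/funext.
  by apply: is_derive_eq; rewrite subr0.
Qed.

Lemma cderR_lin k p q (x : R) dp dq : cderR p x dp -> cderR q x dq ->
  cderR (fun x => k * p x + q x) x (k * dp + dq).
Proof.
move=> [p1 p2] [q1 q2]; split.
- have -> : Re \o (fun x => k * p x + q x) =
    (Re k *: (Re \o p) - Im k *: (Im \o p) + (Re \o q)).
    by apply/funext => y; rewrite !fctE /=; case: k (p y) (q y) => ? ? [? ?] [].
  have h := is_deriveD (is_deriveB (is_deriveZ (Re k) p1) (is_deriveZ (Im k) p2)) q1.
  by apply: (is_derive_eq h); case: k dp dq {p1 p2 q1 q2 h} => ? ? [? ?] [? ?].
- have -> : Im \o (fun x => k * p x + q x) =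
    (Re k *: (Im \o p) + Im k *: (Re \o p) + (Im \o q)).
    by apply/funext => y; rewrite !fctE /=; case: k (p y) (q y) => ? ? [? ?] [].
  have h := is_deriveD (is_deriveD (is_deriveZ (Re k) p2) (is_deriveZ (Im k) p1)) q2.
  by apply: (is_derive_eq h); case: k dp dq {p1 p2 q1 q2 h} => ? ? [? ?] [? ?].
Qed.

(** The right-hand side, as a function of the upper end point, is a primitive of the integrand that
    vanishes at [a]. *)
Lemma Int_lin k p q (a b : R) : ccont p -> ccont q -> -2 < a -> a <= b -> b < 2 ->
  Int (fun x => k * p x + q x) a b = k * Int p a b + Int q a b.
Proof.
move=> cp cq a2 ab b2.
have D x : a <= x <= b -> cderR (fun x => k * Int p a x + Int q a x) x (k * p x + q x).
  move=> /andP[ax xb]; have x2 : `|x| < 2 by rewrite ltr_norml; apply/andP; split; lra.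
  exact: cderR_lin (Int_derive a cp x2) (Int_derive a cq x2).
rewrite (Int_FTC (ccont_lin k cp cq) a2 ab b2 D).
have I0 r : Int r a a = 0 by rewrite /Int !subrr.
by rewrite !I0 mulr0 addr0 subr0.
Qed.

End Primitive.

(** * Contour integrals along segments and rectangles *)

Section Rectangles.
Context {R : realType}.
Notation C := (Cplx R).
Notation ci := (Ci R).

Lemma is_derive_real (f : R -> R) (x D : R) :
  (forall e : R, 0 < e -> exists2 d : R, 0 < d & forall y : R, `|y - x| < d ->
     `|f y - f x - D * (y - x)| <= e * `|y - x|) -> is_derive x 1 f D.
Proof.
move=> h.
have cD : h^-1 *: ((f \o shift x) (h *: (1 : R)) - f x) @[h --> 0^'] --> D.
  apply/cvgrPdist_le => e e0; have [d d0 hd] := h _ e0.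
  near=> t; have t0 : t != 0 by near: t; exact: nbhs_dnbhs_neq.
  have td : `|t| < d by near: t; apply: dnbhs0_lt.
  have := hd (t + x); rewrite addrK => /(_ td); rewrite distrC.
  rewrite /= /GRing.scale /= mulr1 => h1.
  rewrite -[X in X - _](mulKf t0) -mulrBr normrM normfV ler_pdivrMl ?normr_gt0 //.
  by rewrite [t * D]mulrC [leRHS]mulrC.
split; first by apply/cvg_ex; exists D.
exact: cvg_lim.
Unshelve. all: by end_near. Qed.

Lemma derivable_nr (f : C -> C) z : derivable f z 1 ->
  forall e : R, 0 < e -> exists2 d : R, 0 < d &
    forall w, nr (w - z) < d -> nr (f w - f z - 'D_1 f z * (w - z)) <= e * nr (w - z).
Proof.
move=> /derivable1_diffP df e e0.
have [d d0 hd] := differentiable_nr df e0; exists d => // w /hd.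
have -> : 'd f z (w - z) = 'D_1 f z * (w - z).
  by rewrite deriveE // -{1}[w - z]mulr1 -[(w - z) * 1]/((w - z) *: (1 : C)) linearZ mulrC.
by [].
Qed.

Lemma derivable_cont (f : C -> C) z : derivable f z 1 -> {for z, continuous f}.
Proof. by move=> /derivable1_diffP /differentiable_continuous. Qed.

Lemma cderR_line (f : C -> C) (u z : C) (t : R) : derivable f (z + t%:C * u) 1 ->
  cderR (fun t : R => f (z + t%:C * u)) t (u * 'D_1 f (z + t%:C * u)).
Proof.
move=> df; set p := z + _ in df *.
have H e : 0 < e -> exists2 d : R, 0 < d & forall y : R, `|y - t| < d ->
    nr (f (z + y%:C * u) - f p - (y - t)%:C * (u * 'D_1 f p)) <= e * `|y - t|.
  move=> e0.
  have u1 : 0 < nr u + 1 by rewrite ltr_wpDl ?nr_ge0.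
  have [d d0 hd] := derivable_nr df (divr_gt0 e0 u1).
  exists (d / (nr u + 1)); first exact: divr_gt0.
  move=> y yt; have E : z + y%:C * u - p = (y - t)%:C * u.
    by rewrite /p rmorphB /=; ring.
  have n1 : `|y - t| * nr u <= `|y - t| * (nr u + 1) by rewrite ler_wpM2l // lerDl.
  have -> : (y - t)%:C * (u * 'D_1 f p) = 'D_1 f p * (z + y%:C * u - p) by rewrite E; ring.
  have Ed : nr (z + y%:C * u - p) = `|y - t| * nr u by rewrite E nrM nrC.
  apply: le_trans (hd _ _) _; rewrite Ed.
    by apply: le_lt_trans n1 _; rewrite -ltr_pdivlMr.
  apply: le_trans (ler_wpM2l _ n1) _; first by rewrite ltW ?divr_gt0.
  by rewrite mulrCA divfK ?lt0r_neq0 // mulrC.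
have RM (k : R) (w : C) : Re (k%:C * w) = k * Re w by case: w => a b /=; rewrite mul0r subr0.
have IM (k : R) (w : C) : Im (k%:C * w) = k * Im w by case: w => a b /=; rewrite mul0r addr0.
split; apply: is_derive_real => e /H [d d0 hd]; exists d => // y /hd; apply: le_trans.
- apply: le_trans (ler_Re_nr _); rewrite -/p mulrC -RM /=.
  by rewrite !raddfB /= .
- apply: le_trans (ler_Im_nr _); rewrite -/p mulrC -IM /=.
  by rewrite !raddfB /= .
Qed.

Definition lcont (f : C -> C) (z u : C) :=
  forall t : R, `|t| <= 2 -> {for z + t%:C * u, continuous f}.

Lemma lcont_ccont f z u : lcont f z u -> ccont (fun t => f (z + t%:C * u)).
Proof.
move=> cf t /cf /continuous_nrP ct.
have H e : 0 < e -> exists2 d : R, 0 < d & forall y : R, `|y - t| < d ->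
    nr (f (z + y%:C * u) - f (z + t%:C * u)) < e.
  move=> /ct [d d0 hd]; have u1 : 0 < nr u + 1 by rewrite ltr_wpDl ?nr_ge0.
  exists (d / (nr u + 1)); first exact: divr_gt0.
  move=> y yt; apply: hd.
  have -> : z + y%:C * u - (z + t%:C * u) = (y - t)%:C * u by rewrite rmorphB /=; ring.
  rewrite nrM nrC; apply: le_lt_trans (_ : `|y - t| * (nr u + 1) < _).
    by rewrite ler_wpM2l // lerDl.
  by rewrite -ltr_pdivlMr.
split; apply/cvgrPdist_lt => e /H [d d0 hd]; apply/nbhs_normP; exists d => //= y.
- rewrite /= distrC => /hd; rewrite distrC; apply: le_lt_trans.
  by rewrite -raddfB; exact: ler_Re_nr.
- rewrite /= distrC => /hd; rewrite distrC; apply: le_lt_trans.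
  by rewrite -raddfB; exact: ler_Im_nr.
Qed.

(** The contour integral of f along the segment from z + a u to z + b u; the factor [u] is dw/dt. *)
Definition lint f (z u : C) a b : C := u * Int (fun t => f (z + t%:C * u)) a b.

Lemma lint_cat f z u a b c : lint f z u a b + lint f z u b c = lint f z u a c.
Proof. by rewrite /lint -mulrDr Int_cat. Qed.

Lemma lint_FTC G f z u (a b : R) : lcont f z u -> -2 < a -> a <= b -> b < 2 ->
  (forall t : R, a <= t <= b -> is_derive (z + t%:C * u) 1 G (f (z + t%:C * u))) ->
  lint f z u a b = G (z + b%:C * u) - G (z + a%:C * u).
Proof.
move=> cf a2 ab b2 dG.
have c0 : ccont (fun=> 0 : C) by move=> x _; split; apply: cvg_cst.
have cu := lcont_ccont cf.
have Eu : lint f z u a b = Int (fun t => u * f (z + t%:C * u) + 0) a b.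
  rewrite (Int_lin u cu c0 a2 ab b2).
  suff -> : Int (fun=> 0) a b = 0 :> C by rewrite addr0.
  have D (x : R) : a <= x <= b -> cderR (fun=> 0 : C) x 0 by move=> _; split; apply: is_derive_cst.
  by rewrite (Int_FTC c0 a2 ab b2 D) subrr.
have D (t : R) : a <= t <= b -> cderR (fun t => G (z + t%:C * u)) t (u * f (z + t%:C * u) + 0).
  by move=> tab; rewrite addr0; have [dt <-] := dG t tab; exact: cderR_line.
by rewrite Eu (Int_FTC (ccont_lin u cu c0) a2 ab b2 D).
Qed.

Lemma lint_bound f z u (M a b : R) : lcont f z u -> -2 < a -> a <= b -> b < 2 ->
  (forall t : R, a <= t <= b -> nr (f (z + t%:C * u)) <= M) ->
  nr (lint f z u a b) <= 2 * M * nr u * (b - a).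
Proof.
move=> cf a2 ab b2 fM; rewrite /lint nrM.
have := @Int_bound _ _ M a b (lcont_ccont cf) a2 ab b2 fM.
by move=> /(ler_wpM2l (nr_ge0 u)) /le_trans; apply; rewrite le_eqVlt; apply/orP; left; apply/eqP; ring.
Qed.

Lemma lint_lin k f g z u (a b : R) : lcont f z u -> lcont g z u ->
  -2 < a -> a <= b -> b < 2 ->
  lint (fun x => k * f x + g x) z u a b = k * lint f z u a b + lint g z u a b.
Proof.
move=> cf cg a2 ab b2; rewrite /lint.
rewrite (Int_lin k (lcont_ccont cf) (lcont_ccont cg) a2 ab b2).
by rewrite mulrDr mulrCA.
Qed.

(** The counterclockwise contour integral over the boundary of [a, b] x [c, d]: bottom, right, top
    and left side. *)
Definition rect f (a b c d : R) : C :=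
  lint f (ci * c%:C) 1 a b + lint f b%:C ci c d
  - lint f (ci * d%:C) 1 a b - lint f a%:C ci c d.

Definition rlcont f a b c d := [/\ lcont f (ci * c%:C) 1, lcont f b%:C ci,
  lcont f (ci * d%:C) 1 & lcont f a%:C ci].

Definition onrect (P : C -> Prop) (a b c d : R) := [/\
  forall t : R, a <= t <= b -> P (ci * c%:C + t%:C * 1),
  forall t : R, c <= t <= d -> P (b%:C + t%:C * ci),
  forall t : R, a <= t <= b -> P (ci * d%:C + t%:C * 1) &
  forall t : R, c <= t <= d -> P (a%:C + t%:C * ci)].

Definition inbox (a b c d : R) := [/\ -2 < a, a <= b, b < 2 & [/\ -2 < c, c <= d & d < 2]].

Lemma rect_exact G f a b c d : rlcont f a b c d -> inbox a b c d ->
  onrect (fun z => is_derive z 1 G (f z)) a b c d -> rect f a b c d = 0.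
Proof.
move=> [c1 c2 c3 c4] [a2 ab b2 [cc2 cd d2]] [d1 h2 d3 d4].
rewrite /rect (lint_FTC c1 a2 ab b2 d1) (lint_FTC c2 cc2 cd d2 h2).
rewrite (lint_FTC c3 a2 ab b2 d3) (lint_FTC c4 cc2 cd d2 d4) !mulr1.
have E (x y : R) : ci * x%:C + y%:C = y%:C + x%:C * ci by ring.
by rewrite !E; ring.
Qed.

(** The constant is M times the perimeter, with the factor 2 of [Int_bound]. *)
Lemma rect_bound f M a b c d : rlcont f a b c d -> inbox a b c d ->
  onrect (fun z => nr (f z) <= M) a b c d ->
  nr (rect f a b c d) <= 4 * M * ((b - a) + (d - c)).
Proof.
move=> [c1 c2 c3 c4] [a2 ab b2 [cc2 cd d2]] [d1 h2 d3 d4].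
have := lint_bound c1 a2 ab b2 d1; have := lint_bound c2 cc2 cd d2 h2.
have := lint_bound c3 a2 ab b2 d3; have := lint_bound c4 cc2 cd d2 d4.
rewrite nr1 nr_i !mulr1 /rect => h4 h3 h2' h1.
have := nrD (lint f (ci * c%:C) 1 a b + lint f b%:C ci c d
  - lint f (ci * d%:C) 1 a b) (- lint f a%:C ci c d).
have := nrD (lint f (ci * c%:C) 1 a b + lint f b%:C ci c d)
  (- lint f (ci * d%:C) 1 a b).
have := nrD (lint f (ci * c%:C) 1 a b) (lint f b%:C ci c d).
rewrite !nrN; move: (nr _) (nr _) (nr _) (nr _) (nr _) (nr _) (nr _) h1 h2' h3 h4.
by clear; intros; lra.
Qed.

Lemma rect_lin k f g a b c d : rlcont f a b c d -> rlcont g a b c d ->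
  inbox a b c d ->
  rect (fun x => k * f x + g x) a b c d = k * rect f a b c d + rect g a b c d.
Proof.
move=> [c1 c2 c3 c4] [g1 g2 g3 g4] [a2 ab b2 [cc2 cd d2]].
rewrite /rect (lint_lin k c1 g1 a2 ab b2) (lint_lin k c2 g2 cc2 cd d2).
rewrite (lint_lin k c3 g3 a2 ab b2) (lint_lin k c4 g4 cc2 cd d2).
do 8 move: (lint _ _ _ _ _) => ?; by ring.
Qed.

Lemma rect_vsplit f a b c d e :
  rect f a b c d = rect f a e c d + rect f e b c d.
Proof.
rewrite /rect -(lint_cat f _ 1 a e b) -(lint_cat f (ci * d%:C) 1 a e b).
do 7 move: (lint _ _ _ _ _) => ?; by ring.
Qed.

Lemma rect_hsplit f a b c d e :
  rect f a b c d = rect f a b c e + rect f a b e d.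
Proof.
rewrite /rect -(lint_cat f b%:C ci c e d) -(lint_cat f a%:C ci c e d).
do 7 move: (lint _ _ _ _ _) => ?; by ring.
Qed.

End Rectangles.

(** * Goursat's theorem for rectangles *)

Section Goursat.
Context {R : realType}.
Notation C := (Cplx R).
Notation ci := (Ci R).

Definition boxcont (f : C -> C) := forall z, `|Re z| <= 2 -> `|Im z| <= 2 ->
  {for z, continuous f}.

Lemma Re_lin (x y : R) : Re (x%:C + y%:C * ci) = x.
Proof. by rewrite /= mulr0 mul0r subr0 addr0. Qed.
Lemma Im_lin (x y : R) : Im (x%:C + y%:C * ci) = y.
Proof. by rewrite /= mulr1 mul0r addr0 add0r. Qed.
Lemma lin_swap (x y : R) : ci * y%:C + x%:C * 1 = x%:C + y%:C * ci.
Proof. by ring. Qed.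

Lemma boxcont_rlcont f a b c d : inbox a b c d -> boxcont f -> rlcont f a b c d.
Proof.
move=> [a2 ab b2 [c2 cd d2]] cf; split => t t2; rewrite ?lin_swap; apply: cf.
all: rewrite ?Re_lin ?Im_lin // ler_norml; apply/andP; split; lra.
Qed.

Lemma onrectP (P : C -> Prop) a b c d : a <= b -> c <= d ->
  (forall x y : R, a <= x <= b -> c <= y <= d ->
    (x == a) || (x == b) || (y == c) || (y == d) -> P (x%:C + y%:C * ci)) ->
  onrect P a b c d.
Proof.
move=> ab cd h; split => t /[dup] tt /andP[t1 t2]; rewrite ?lin_swap; apply: h => //.
all: by rewrite ?lexx ?ab ?cd ?eqxx ?orbT.
Qed.

Lemma nr_rect (a b c d x y x' y' : R) : a <= x <= b -> c <= y <= d ->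
  a <= x' <= b -> c <= y' <= d ->
  nr (x%:C + y%:C * ci - (x'%:C + y'%:C * ci) : C) <= (b - a) + (d - c).
Proof.
move=> /andP[? ?] /andP[? ?] /andP[? ?] /andP[? ?].
apply: le_trans (nr_leReIm _) _.
rewrite !raddfB /= ?mulr0 ?mul0r ?mulr1 ?subr0 ?addr0 ?add0r.
by apply: lerD; rewrite ler_norml; apply/andP; split; lra.
Qed.

Lemma cder_id (z : C) : is_derive z 1 (fun w : C => w) 1.
Proof. exact: is_derive_id. Qed.

Lemma cder_cst (k z : C) : is_derive z 1 (fun _ : C => k) 0.
Proof. exact: is_derive_cst. Qed.

Lemma cderD (f g : C -> C) (z a b : C) : is_derive z 1 f a -> is_derive z 1 g b ->
  is_derive z 1 (fun w => f w + g w) (a + b).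
Proof. exact: is_deriveD. Qed.

Lemma cderB (f g : C -> C) (z a b : C) : is_derive z 1 f a -> is_derive z 1 g b ->
  is_derive z 1 (fun w => f w - g w) (a - b).
Proof. exact: is_deriveB. Qed.

Lemma cderM (f g : C -> C) (z a b : C) : is_derive z 1 f a -> is_derive z 1 g b ->
  is_derive z 1 (fun w => f w * g w) (a * g z + f z * b).
Proof.
move=> df dg; have h := is_deriveM df dg; apply: (is_derive_eq h).
by rewrite /GRing.scale /= addrC; congr (_ + _); rewrite mulrC.
Qed.

Lemma cderZ (f : C -> C) (k z a : C) : is_derive z 1 f a ->
  is_derive z 1 (fun w => k * f w) (k * a).
Proof. by move=> df; apply: (is_derive_eq (cderM (cder_cst k z) df)); rewrite mul0r add0r. Qed.

Lemma cderV (f : C -> C) (z a : C) : f z != 0 -> is_derive z 1 f a ->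
  is_derive z 1 (fun w => (f w)^-1) (- a / f z ^+ 2).
Proof.
move=> fz [df <-].
have df' : differentiable f z := iffLR (derivable1_diffP _ _) df.
have dV := differentiableV df' fz.
split; first exact: (iffRL (derivable1_diffP _ _) dV).
rewrite (deriveE (1 : C) dV) (diffV df' fz) /= -(deriveE (1 : C) df') /GRing.scale /=.
by rewrite !mulNr mulrC.
Qed.

Lemma cder_affine (c d p z : C) : is_derive z 1 (fun w : C => c + d * (w - p)) d.
Proof.
apply: (is_derive_eq (cderD (cder_cst c z) (cderZ d (cderB (cder_id z) (cder_cst p z))))).
by rewrite add0r subr0 mulr1.
Qed.

Lemma cder_quad (c d p z : C) :
  is_derive z 1 (fun w : C => c * w + d / 2 * ((w - p) * (w - p))) (c + d * (z - p)).
Proof.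
have h := cderB (cder_id z) (cder_cst p z).
apply: (is_derive_eq (cderD (cderZ c (cder_id z)) (cderZ (d / 2) (cderM h h)))).
by field.
Qed.

Lemma ccontB (f g : C -> C) (z : C) : {for z, continuous f} -> {for z, continuous g} ->
  {for z, continuous (fun w => f w - g w)}.
Proof. exact: continuousB. Qed.

Lemma ccontM (f g : C -> C) (z : C) : {for z, continuous f} -> {for z, continuous g} ->
  {for z, continuous (fun w => f w * g w)}.
Proof. exact: continuousM. Qed.

Lemma ccontV (f : C -> C) (z : C) : f z != 0 -> {for z, continuous f} ->
  {for z, continuous (fun w => (f w)^-1)}.
Proof. exact: continuousV. Qed.

(** The affine part of f at the point has a quadratic primitive and integrates to 0. What remains is
    at most e / 4 times the half-perimeter on the boundary, and [rect_bound] contributes 4 times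
    another half-perimeter. *)
Lemma goursat_local f (x0 y0 : R) : boxcont f ->
  derivable f (x0%:C + y0%:C * ci : C) 1 ->
  forall e : R, 0 < e -> exists2 del : R, 0 < del &
    forall a b c d, inbox a b c d -> a <= x0 <= b -> c <= y0 <= d ->
      (b - a) + (d - c) < del ->
      nr (rect f a b c d) <= e * ((b - a) + (d - c)) ^+ 2.
Proof.
move=> cf df e e0; set z0 := _ + _ in df.
have e4 : 0 < e / 4 by lra.
have [del del0 hd] := derivable_nr df e4; exists del => // a b c d ib xab ycd hdel.
have [a2 ab b2 [c2 cd d2]] := ib.
set D := 'D_1 f z0 in hd.
set aff : C -> C := fun w => f z0 + D * (w - z0).
set g : C -> C := fun w => f w - aff w.
have caff : boxcont aff.
  by move=> z _ _; apply: derivable_cont; case: (cder_affine (f z0) D z0 z).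
have cg : boxcont g by move=> z h1 h2; apply: ccontB; [exact: cf | exact: caff].
have R0 : rect aff a b c d = 0.
  pose G := fun w : C => f z0 * w + D / 2 * ((w - z0) * (w - z0)).
  apply: (@rect_exact _ G _ _ _ _ _ (boxcont_rlcont ib caff) ib).
  by apply: (onrectP ab cd) => x y _ _ _; exact: cder_quad.
have -> : rect f a b c d = rect g a b c d.
  transitivity (rect (fun w => 1 * g w + aff w) a b c d).
    suff -> : (fun w => 1 * g w + aff w) = f by [].
    by apply/funext => w; rewrite mul1r subrK.
  by rewrite (rect_lin 1 (boxcont_rlcont ib cg) (boxcont_rlcont ib caff) ib) R0 mul1r addr0.
have := @rect_bound _ g (e / 4 * ((b - a) + (d - c))) a b c d.
move=> /(_ (boxcont_rlcont ib cg) ib) h; apply: le_trans (h _) _; last first.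
  by rewrite le_eqVlt; apply/orP; left; apply/eqP; field.
apply: onrectP => // x y xab' ycd' _; have nb := nr_rect xab' ycd' xab ycd.
have := hd (x%:C + y%:C * ci) (le_lt_trans nb hdel).
have -> : g (x%:C + y%:C * ci) = f (x%:C + y%:C * ci) - f z0 - D * (x%:C + y%:C * ci - z0).
  by rewrite /g /aff opprD addrA.
by move=> /le_trans; apply; rewrite ler_wpM2l // ltW.
Qed.

Lemma expn2_small (K e : R) : 0 < e -> exists n : nat, K / 2 ^+ n < e.
Proof.
move=> e0; have [K0|K0] := leP K 0.
  by exists 0%N; rewrite expr0 divr1; apply: le_lt_trans K0 e0.
exists (Num.bound (K / e)).
rewrite ltr_pdivrMr ?exprn_gt0 // mulrC -ltr_pdivrMr //.
apply: lt_trans (archi_boundP _) _; first by rewrite ltW ?divr_gt0.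
by rewrite -natrX ltr_nat ltn_expl.
Qed.

(** The point is the supremum of the left end points: they increase, and every right end point
    bounds them all. *)
Lemma nested_limit (u : nat -> R) (w a b : R) : 0 <= w ->
  (forall n, u n.+1 = u n \/ u n.+1 = u n + w / 2 ^+ n.+1) ->
  exists x : R, forall n, u n <= x <= u n + w / 2 ^+ n.
Proof.
move=> w0 hu.
have step n : u n <= u n.+1 /\ u n.+1 + w / 2 ^+ n.+1 <= u n + w / 2 ^+ n.
  have E : w / 2 ^+ n = w / 2 ^+ n.+1 + w / 2 ^+ n.+1.
    by rewrite exprS; field; rewrite expf_neq0.
  have p : 0 <= w / 2 ^+ n.+1 by rewrite divr_ge0 ?exprn_ge0.
  by case: (hu n) => ->; rewrite E; split; lra.
have up n k : u n <= u (n + k)%N.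
  by elim: k => [|k ih]; rewrite ?addn0 // addnS; apply: le_trans ih (step _).1.
have dn n k : u (n + k)%N + w / 2 ^+ (n + k) <= u n + w / 2 ^+ n.
  by elim: k => [|k ih]; rewrite ?addn0 // addnS; apply: le_trans (step _).2 ih.
have p n : 0 <= w / 2 ^+ n by rewrite divr_ge0 ?exprn_ge0.
have cmp m n : u m <= u n + w / 2 ^+ n.
  have [mn|/ltnW nm] := leqP m n.
    apply: le_trans (_ : u n <= _); last by rewrite lerDl.
    by rewrite -(subnKC mn) up.
  apply: le_trans (_ : u m + w / 2 ^+ m <= _); first by rewrite lerDl.
  by rewrite -(subnKC nm) dn.
have hs : has_sup (range u).
  split; first by exists (u 0%N), 0%N.
  by exists (u 0%N + w / 2 ^+ 0) => _ [m _ <-].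
exists (sup (range u)) => n; apply/andP; split.
  by apply: (ub_le_sup hs.2); exists n.
by apply: ge_sup; [exact: hs.1|move=> _ [m _ <-]].
Qed.

Lemma goursat f a b c d : boxcont f -> inbox a b c d ->
  (forall x y : R, a <= x <= b -> c <= y <= d -> derivable f (x%:C + y%:C * ci : C) 1) ->
  rect f a b c d = 0.
Proof.
move=> cf ib df; have [a2 ab b2 [c2 cd d2]] := ib.
set w := b - a; set h := d - c.
have w0 : 0 <= w by rewrite subr_ge0.
have h0 : 0 <= h by rewrite subr_ge0.
apply: nr_eq0; apply/eqP; rewrite eq_le nr_ge0 andbT.
apply/ler_addgt0Pl => e' e'0; rewrite addr0.
have [e e0 ee] : exists2 e : R, 0 < e & e * (w + h) ^+ 2 <= e'.
  have K : 0 < (w + h) ^+ 2 + 1 by rewrite ltr_wpDl // sqr_ge0.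
  exists (e' / ((w + h) ^+ 2 + 1)); first exact: divr_gt0.
  by rewrite mulrAC ler_pdivrMr //; apply: ler_wpM2l; [exact: ltW | rewrite lerDl].
apply: le_trans ee; rewrite leNgt; apply/negP => bad0.
(* A state is the generation n of a bisected rectangle with its lower left corner. It is bad if its
   integral is too large for the local estimate. *)
pose bad (s : nat * (R * R)) := let: (n, (x, y)) := s in
  e * ((w + h) / 2 ^+ n) ^+ 2 < nr (rect f x (x + w / 2 ^+ n) y (y + h / 2 ^+ n)).
(* The implication makes the relation total, as [dependent_choice] requires; badness of all the
   states follows by induction. *)
pose nxt (s t : nat * (R * R)) := bad s -> [/\ bad t, t.1 = s.1.+1,
  t.2.1 = s.2.1 \/ t.2.1 = s.2.1 + w / 2 ^+ s.1.+1 &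
  t.2.2 = s.2.2 \/ t.2.2 = s.2.2 + h / 2 ^+ s.1.+1].
have ex s : {t | nxt s t}.
  apply: cid; case: s => n [x y]; rewrite /nxt /=.
  have [bs|] := pselect (bad (n, (x, y))); last by exists (n, (x, y)).
  set w' := w / 2 ^+ n.+1; set h' := h / 2 ^+ n.+1.
  have Ew : w / 2 ^+ n = w' + w' by rewrite /w' exprS; field; rewrite expf_neq0.
  have Eh : h / 2 ^+ n = h' + h' by rewrite /h' exprS; field; rewrite expf_neq0.
  apply: contrapT => no.
  have good x' y' : (x' = x \/ x' = x + w') -> (y' = y \/ y' = y + h') ->
      nr (rect f x' (x' + w') y' (y' + h')) <= e * ((w + h) / 2 ^+ n.+1) ^+ 2.
    move=> hx hy; rewrite leNgt; apply/negP => bd; apply: no.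
    by exists (n.+1, (x', y')).
  have g1 := good x y (or_introl erefl) (or_introl erefl).
  have g2 := good (x + w') y (or_intror erefl) (or_introl erefl).
  have g3 := good x (y + h') (or_introl erefl) (or_intror erefl).
  have g4 := good (x + w') (y + h') (or_intror erefl) (or_intror erefl).
  move: bs; rewrite /bad Ew Eh (addrA x w' w') (addrA y h' h').
  rewrite (rect_vsplit f _ _ _ _ (x + w')).
  rewrite (rect_hsplit f x (x + w') y _ (y + h')) (rect_hsplit f (x + w') (x + w' + w') y _ (y + h')).
  (* The threshold is quadratic in the size, so four good quarters would make a good whole. *)
  have -> : e * ((w + h) / 2 ^+ n) ^+ 2 = 4 * (e * ((w + h) / 2 ^+ n.+1) ^+ 2).
    have : (2 : R) ^+ n != 0 by rewrite expf_neq0.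
    by rewrite [2 ^+ n.+1]exprS; move: (2 ^+ n) (w + h) => p q p0; field.
  move: g1 g2 g3 g4; move: (rect _ _ _ _ _) (rect _ _ _ _ _) (rect _ _ _ _ _) (rect _ _ _ _ _).
  move=> r1 r2 r3 r4; move: (e * _) => E g1 g2 g3 g4.
  have := nrD (r4 + r2) (r3 + r1); have := nrD r4 r2; have := nrD r3 r1.
  move: g1 g2 g3 g4; move: (nr _) (nr _) (nr _) (nr _) (nr _) (nr _) (nr _).
  by clear; intros; lra.
have [s [s0 hs]] := dependent_choice ex (0%N, (a, c)).
have bs n : bad (s n) /\ (s n).1 = n.
  elim: n => [|n [ih1 ih2]].
    by rewrite s0 /bad expr0 !divr1 /w /h !subrKC.
  by have [? -> _ _] := hs n ih1; rewrite ih2.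
have [|x hx] := @nested_limit (fun n => (s n).2.1) w a b w0.
  by move=> n; have [b1 E] := bs n; have [_ _] := hs n b1; rewrite E.
have [|y hy] := @nested_limit (fun n => (s n).2.2) h c d h0.
  by move=> n; have [b1 E] := bs n; have [_ _ _] := hs n b1; rewrite E.
have sbox n : [/\ a <= (s n).2.1, (s n).2.1 + w / 2 ^+ n <= b,
    c <= (s n).2.2 & (s n).2.2 + h / 2 ^+ n <= d].
  elim: n => [|n [i1 i2 i3 i4]].
    by rewrite s0 /= expr0 !divr1 /w /h !subrKC.
  have [b1 E] := bs n; have [_ _] := hs n b1; rewrite E.
  have Ew : w / 2 ^+ n = w / 2 ^+ n.+1 + w / 2 ^+ n.+1 by rewrite exprS; field; rewrite expf_neq0.
  have Eh : h / 2 ^+ n = h / 2 ^+ n.+1 + h / 2 ^+ n.+1 by rewrite exprS; field; rewrite expf_neq0.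
  have p1 : 0 <= w / 2 ^+ n.+1 by rewrite divr_ge0 ?exprn_ge0.
  have p2 : 0 <= h / 2 ^+ n.+1 by rewrite divr_ge0 ?exprn_ge0.
  rewrite Ew in i2; rewrite Eh in i4; case=> -> [] ->; move: i1 i2 i3 i4 p1 p2;
    move: (w / _) (h / _) (s n).2.1 (s n).2.2; clear; intros; split; lra.
have xab : a <= x <= b.
  by have := hx 0%N; rewrite s0 /= expr0 divr1 /w subrKC.
have ycd : c <= y <= d.
  by have := hy 0%N; rewrite s0 /= expr0 divr1 /h subrKC.
have [del del0 hdel] := goursat_local cf (df x y xab ycd) e0.
have [n hn] := expn2_small (w + h) del0.
have [b1 E] := bs n; move: b1 (hx n) (hy n) (sbox n); case: (s n) E => n' [x' y'] /= ->.
move=> b1 hx1 hy1 [i1 i2 i3 i4].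
have p1 : 0 <= w / 2 ^+ n by rewrite divr_ge0 ?exprn_ge0.
have p2 : 0 <= h / 2 ^+ n by rewrite divr_ge0 ?exprn_ge0.
have := hdel x' (x' + w / 2 ^+ n) y' (y' + h / 2 ^+ n) _ hx1 hy1.
rewrite !(addrC x') !(addrC y') !addrK -mulrDl !(addrC _ x') !(addrC _ y').
move=> /(_ _ hn); rewrite leNgt b1 => /(_ _)/negP; apply => //.
rewrite /inbox; move: a2 b2 c2 d2 i1 i2 i3 i4 p1 p2; move: (w / _) (h / _); clear; intros.
by split; [lra|lra|lra|split; lra].
Qed.

End Goursat.

(** * The integral around the square [-1, 1] x [-1, 1] *)

Section SquareIntegral.
Context {R : realType}.
Notation C := (Cplx R).
Notation ci := (Ci R).

Definition sq (f : C -> C) : C := rect f (-1) 1 (-1) 1.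

Definition sqcont (f : C -> C) := forall z : C, `|Re z| <= 2 -> `|Im z| <= 2 -> 1 <= nr z ->
  {for z, continuous f}.

Lemma inbox1 : inbox (-1) 1 (-1) (1 : R).
Proof. by split; [lra|lra|lra|split; lra]. Qed.

Lemma sqcont_rlcont f : sqcont f -> rlcont f (-1) 1 (-1) 1.
Proof.
move=> cf; split => t t2; rewrite ?lin_swap; apply: cf; rewrite ?Re_lin ?Im_lin //.
all: rewrite ?normrN ?normr1; try lra.
- by apply: le_trans (ler_Im_nr _); rewrite Im_lin normrN normr1.
- by apply: le_trans (ler_Re_nr _); rewrite Re_lin normr1.
- by apply: le_trans (ler_Im_nr _); rewrite Im_lin normr1.
- by apply: le_trans (ler_Re_nr _); rewrite Re_lin normrN normr1.
Qed.

(** The whole lines that carry the sides stay outside the open unit disc, so the integrands agree as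
    functions on R. *)
Lemma sq_ext f g : (forall z, 1 <= nr z -> f z = g z) -> sq f = sq g.
Proof.
move=> fg; rewrite /sq /rect /lint.
have H (z u : C) : (forall t : R, 1 <= nr (z + t%:C * u)) ->
    (fun t : R => f (z + t%:C * u)) = (fun t => g (z + t%:C * u)).
  by move=> h; apply/funext => t; exact: fg.
rewrite !H // => t; rewrite ?lin_swap.
- by apply: le_trans (ler_Re_nr _); rewrite Re_lin normrN normr1.
- by apply: le_trans (ler_Im_nr _); rewrite Im_lin normr1.
- by apply: le_trans (ler_Re_nr _); rewrite Re_lin normr1.
- by apply: le_trans (ler_Im_nr _); rewrite Im_lin normrN normr1.
Qed.

Lemma sq_bound f M : sqcont f ->
  (forall z : C, 1 <= nr z -> `|Re z| <= 1 -> `|Im z| <= 1 -> nr (f z) <= M) ->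
  nr (sq f) <= 16 * M.
Proof.
move=> cf fM.
have -> : 16 * M = 4 * M * ((1 - -1) + (1 - -1)) by ring.
apply: rect_bound (sqcont_rlcont cf) inbox1 _.
apply: onrectP => [||x y /andP[x1 x2] /andP[y1 y2] h]; try lra.
apply: fM; rewrite ?Re_lin ?Im_lin ?ler_norml ?x1 ?y1 //.
case/orP: h => [/orP[/orP[]|]|] /eqP e.
- by apply: le_trans (ler_Re_nr _); rewrite Re_lin e normrN normr1.
- by apply: le_trans (ler_Re_nr _); rewrite Re_lin e normr1.
- by apply: le_trans (ler_Im_nr _); rewrite Im_lin e normrN normr1.
- by apply: le_trans (ler_Im_nr _); rewrite Im_lin e normr1.
Qed.

Lemma sq_lin k f g : sqcont f -> sqcont g ->
  sq (fun x => k * f x + g x) = k * sq f + sq g.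
Proof.
move=> cf cg; exact: (rect_lin k (sqcont_rlcont cf) (sqcont_rlcont cg) inbox1).
Qed.

Lemma nr_neq0 (z : C) : 1 <= nr z -> z != 0.
Proof. by move=> h; rewrite -nr_gt0; apply: lt_le_trans h. Qed.

Lemma cderXV n (z : C) : z != 0 ->
  is_derive z 1 (fun w : C => - n.+1%:R^-1 * (w ^+ n.+1)^-1) ((z ^+ n.+2)^-1).
Proof.
move=> z0.
have dX k : is_derive z 1 (fun w : C => w ^+ k.+1) (k.+1%:R * z ^+ k).
  elim: k => [|k ih].
    by rewrite expr0 mulr1; exact: cder_id.
  have h := cderM (cder_id z) ih.
  have -> : (fun w : C => w ^+ k.+2) = (fun w : C => w * w ^+ k.+1).
    by apply/funext => w; rewrite exprS.
  by apply: (is_derive_eq h); rewrite mul1r mulrCA -exprS -[in RHS]natr1 mulrDl mul1r addrC.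
have zn : z ^+ n.+1 != 0 by rewrite expf_neq0.
have h := cderZ (- n.+1%:R^-1) (@cderV _ (fun w : C => w ^+ n.+1) z _ zn (dX n)).
apply: (is_derive_eq h); rewrite !exprS.
have n0 : (n.+1%:R : C) != 0 by rewrite pnatr_eq0.
have p0 : z ^+ n != 0 by rewrite expf_neq0.
by move: (z ^+ n) (n.+1%:R) p0 n0 => p q p0 n0; field; rewrite z0 p0 n0.
Qed.

Lemma ccontXV n (z : C) : z != 0 -> {for z, continuous (fun w : C => (w ^+ n)^-1)}.
Proof.
move=> z0; apply: ccontV; first by rewrite expf_neq0.
elim: n => [|n ih]; first by apply: (@derivable_cont _ (fun=> 1)); case: (cder_cst 1 z).
have -> : (fun w : C => w ^+ n.+1) = (fun w : C => w * w ^+ n).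
  by apply/funext => w; rewrite exprS.
apply: (ccontM _ ih); apply: derivable_cont; by case: (cder_id z).
Qed.

Lemma ccontKer z0 n (z : C) : z != 0 -> z != z0 ->
  {for z, continuous (fun w : C => (w ^+ n)^-1 * (w - z0)^-1)}.
Proof.
move=> z1 z2; apply: ccontM; first exact: ccontXV.
apply: ccontV; first by rewrite subr_eq0.
by apply: derivable_cont; case: (cderB (cder_id z) (cder_cst z0 z)).
Qed.

Lemma sq_XV n : sq (fun w => (w ^+ n.+2)^-1) = 0.
Proof.
have cf : sqcont (fun w => (w ^+ n.+2)^-1) by move=> z _ _ /nr_neq0; exact: ccontXV.
apply: (@rect_exact _ (fun w : C => - n.+1%:R^-1 * (w ^+ n.+1)^-1) _ _ _ _ _ (sqcont_rlcont cf) inbox1).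
apply: onrectP => [||x y _ _ h]; try lra.
apply: cderXV; apply/eqP => /eqP; rewrite eq_complex /=.
rewrite mulr0 mul0r mulr1 mul0r subr0 !addr0 add0r => /andP[/eqP x0 /eqP y0].
by move: h; rewrite x0 y0 !(eq_sym 0) !oppr_eq0 !oner_eq0.
Qed.

(** Cauchy's theorem with one exceptional point of mere continuity. A small square around that point
    is cut out; the four rectangles around it vanish by [goursat], and the integral over the small
    square tends to 0 with its perimeter. *)
Lemma sq_removable q (x0 y0 : R) : boxcont q -> `|x0| < 1 -> `|y0| < 1 ->
  (forall z : C, `|Re z| <= 2 -> `|Im z| <= 2 -> z != x0%:C + y0%:C * ci -> derivable q z 1) ->
  sq q = 0.
Proof.
set z0 := _ + _ => cq hx hy dq.
move: (hx) (hy); rewrite !ltr_norml => /andP[x1 x2] /andP[y1 y2].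
have cz0 : {for z0, continuous q}.
  by apply: cq; rewrite /z0 ?Re_lin ?Im_lin ltW // (lt_trans hx, lt_trans hy) //; lra.
have := iffLR (continuous_nrP _ _) cz0 1 ltr01 => -[d d0 hd].
have small (e : R) : 0 < e -> e < 1 - `|x0| -> e < 1 - `|y0| -> 4 * e < d ->
    nr (sq q) <= 16 * (nr (q z0) + 1) * e.
  move=> e0 ex ey ed.
  have [ex1 ex2] : - 1 < x0 - e /\ x0 + e < 1.
    by have := ler_norm x0; have := ler_norm (- x0); rewrite normrN; lra.
  have [ey1 ey2] : - 1 < y0 - e /\ y0 + e < 1.
    by have := ler_norm y0; have := ler_norm (- y0); rewrite normrN; lra.
  have zero (a b c d' : R) : [/\ -1 <= a, a <= b & b <= 1] -> [/\ -1 <= c, c <= d' & d' <= 1] ->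
     ~~ ((a <= x0 <= b) && (c <= y0 <= d')) -> rect q a b c d' = 0.
    move=> [a1 ab b1] [c1 cd d1] no.
    have ib : inbox a b c d' by clear -a1 ab b1 c1 cd d1; split; [lra|lra|lra|split; lra].
    apply: (goursat cq ib) => x y /[dup] xab /andP[xa xb] /[dup] ycd /andP[yc yd].
    apply: dq; rewrite ?Re_lin ?Im_lin ?ler_norml; try (clear -a1 ab b1 c1 cd d1 xa xb yc yd; apply/andP; split; lra).
    apply: contraNneq no => /[dup] /(congr1 Re) + /(congr1 Im).
    by rewrite !Re_lin !Im_lin => <- <-; rewrite xab ycd.
  have Z1 : rect q (-1) (x0 - e) (-1) 1 = 0.
    by apply: zero; [clear -e0 ex1 ex2|clear|apply/negP => /andP[/andP[u v] _]; clear -e0 u v]; try split; lra.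
  have Z2 : rect q (x0 + e) 1 (-1) 1 = 0.
    by apply: zero; [clear -e0 ex1 ex2|clear|apply/negP => /andP[/andP[u v] _]; clear -e0 u v]; try split; lra.
  have Z3 : rect q (x0 - e) (x0 + e) (-1) (y0 - e) = 0.
    by apply: zero; [clear -e0 ex1 ex2|clear -e0 ey1 ey2|apply/negP => /andP[_ /andP[u v]]; clear -e0 u v]; try split; lra.
  have Z4 : rect q (x0 - e) (x0 + e) (y0 + e) 1 = 0.
    by apply: zero; [clear -e0 ex1 ex2|clear -e0 ey1 ey2|apply/negP => /andP[_ /andP[u v]]; clear -e0 u v]; try split; lra.
  rewrite /sq (rect_vsplit q _ _ _ _ (x0 - e)) Z1 add0r.
  rewrite (rect_vsplit q _ _ _ _ (x0 + e)) Z2 addr0.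
  rewrite (rect_hsplit q _ _ _ _ (y0 - e)) Z3 add0r.
  rewrite (rect_hsplit q _ _ _ _ (y0 + e)) Z4 addr0.
  have ib : inbox (x0 - e) (x0 + e) (y0 - e) (y0 + e) by clear -e0 ex1 ex2 ey1 ey2; split; [lra|lra|lra|split; lra].
  apply: le_trans (@rect_bound _ q (nr (q z0) + 1) _ _ _ _ (boxcont_rlcont ib cq) ib _) _.
    apply: onrectP => [||x y /andP[xa xb] /andP[yc yd] _]; [clear -e0; lra|clear -e0; lra|].
    have : nr (q (x%:C + y%:C * ci) - q z0) < 1.
      apply: hd; apply: le_lt_trans ed.
      have -> : 4 * e = (x0 + e - (x0 - e)) + (y0 + e - (y0 - e)) by ring.
      by apply: nr_rect; clear -xa xb yc yd e0; apply/andP; split; lra.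
    by have := nrD (q (x%:C + y%:C * ci) - q z0) (q z0); rewrite subrK; lra.
  by rewrite le_eqVlt; apply/orP; left; apply/eqP; ring.
apply: nr_eq0; apply/eqP; rewrite eq_le nr_ge0 andbT.
apply/ler_addgt0Pl => e e0; rewrite addr0.
have q0 : 0 < 16 * (nr (q z0) + 1) by have := nr_ge0 (q z0); lra.
(* The first two terms keep the small square inside the large one, the third keeps q within 1 of its
   value at the centre, the last makes the bound at most e. *)
pose m := Num.min (Num.min ((1 - `|x0|) / 2) ((1 - `|y0|) / 2)) (Num.min (d / 8) (e / (16 * (nr (q z0) + 1)))).
have m0 : 0 < m.
  by rewrite /m !lt_min !divr_gt0 ?subr_gt0.
have m1 : m <= (1 - `|x0|) / 2 by rewrite /m !ge_min lexx.
have m2 : m <= (1 - `|y0|) / 2 by rewrite /m !ge_min lexx orbT.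
have m3 : m <= d / 8 by rewrite /m !ge_min lexx ?orbT.
have m4 : m <= e / (16 * (nr (q z0) + 1)) by rewrite /m !ge_min lexx ?orbT.
apply: le_trans (small m m0 _ _ _) _; [clear -m0 m1; lra|clear -m0 m2; lra|clear -m0 m3; lra|].
by rewrite mulrC -ler_pdivlMr.
Qed.

Definition boxhol (f : C -> C) := forall z : C, `|Re z| <= 2 -> `|Im z| <= 2 ->
  derivable f z 1.

(** The Cauchy kernel for n = 0; for larger n, up to z0 ^ n, the remainder after n terms of its
    geometric expansion in z0 / w. *)
Definition ker (f : C -> C) n (z0 : C) : C -> C :=
  fun w => f w * ((w ^+ n)^-1 * (w - z0)^-1).

Lemma neq_nr (z z0 : C) : nr z0 < 1 -> 1 <= nr z -> z != z0.
Proof. by move=> h1 h2; apply: contraTneq h2 => ->; rewrite -ltNge. Qed.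

Lemma ker_sqcont f n z0 : boxcont f -> nr z0 < 1 -> sqcont (ker f n z0).
Proof.
move=> cf z01 z h1 h2 h3; apply: ccontM; first exact: cf.
by apply: ccontKer; [exact: nr_neq0|exact: neq_nr].
Qed.

Lemma pow_sqcont f n : boxcont f -> sqcont (fun w => f w * (w ^+ n)^-1).
Proof.
move=> cf z h1 h2 h3; apply: ccontM; first exact: cf.
by apply: ccontXV; exact: nr_neq0.
Qed.

Lemma boxhol_cont f : boxhol f -> boxcont f.
Proof. by move=> hf z h1 h2; apply: derivable_cont; exact: hf. Qed.

Lemma boxcont_cst (k : C) : boxcont (fun=> k : C).
Proof. by move=> z _ _; apply: (@derivable_cont _ (fun=> k)); case: (cder_cst k z). Qed.

End SquareIntegral.

(** * Cauchy's formula and its expansion *)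

Section CauchyFormula.
Context {R : realType}.
Notation C := (Cplx R).
Notation ci := (Ci R).

(** The difference quotient at z0, completed by the derivative, is continuous and is holomorphic
    away from z0, so its integral vanishes by [sq_removable]. The integral of the kernel of 1 is
    left unevaluated here; [ker1] shows that it does not depend on z0. *)
Lemma cauchy_kernel f z0 : boxhol f -> nr z0 < 1 ->
  sq (ker f 0 z0) = f z0 * sq (ker (fun=> 1 : C) 0 z0).
Proof.
move=> hf z01.
pose q w := if w == z0 then 'D_1 f z0 else (f w - f z0) * (w - z0)^-1.
have [zx zy] : `|Re z0| < 1 /\ `|Im z0| < 1.
  by split; apply: le_lt_trans z01; [exact: ler_Re_nr|exact: ler_Im_nr].
have df0 : derivable f z0 1 by apply: hf; apply: ltW; [move: zx|move: zy]; lra.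
have dq (z : C) : `|Re z| <= 2 -> `|Im z| <= 2 -> z != z0 -> derivable q z 1.
  move=> h1 h2 zz.
  have h := cderM (cderB (derivableP (hf z h1 h2)) (cder_cst (f z0) z))
    (cderV _ (cderB (cder_id z) (cder_cst z0 z))).
  have [|d _] := h; first by rewrite subr_eq0.
  apply: (near_eq_derivable _ d).
  have zz' : 0 < nr (z - z0) by rewrite nr_gt0 subr_eq0.
  apply/nbhs_nrP; exists (nr (z - z0)) => // y hy.
  rewrite /q; case: eqP => // E; move: hy; rewrite E nrB ltxx //.
have cq : boxcont q.
  move=> z h1 h2; have [->|zz] := eqVneq z z0; last exact/derivable_cont/dq.
  apply/continuous_nrP => e e0; have e2 : 0 < e / 2 by lra.
  have [d d0 hd] := derivable_nr df0 e2; exists d => // y yd.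
  rewrite {2}/q eqxx /q; case: eqP => [_|/eqP yz]; first by rewrite subrr nr0.
  have y0 : 0 < nr (y - z0) by rewrite nr_gt0 subr_eq0.
  have y1 : y - z0 != 0 by rewrite subr_eq0.
  have -> : (f y - f z0) * (y - z0)^-1 - 'D_1 f z0 =
    (f y - f z0 - 'D_1 f z0 * (y - z0)) * (y - z0)^-1 by field.
  rewrite nrM nrV ltr_pdivrMr //; apply: le_lt_trans (hd _ yd) _.
  by rewrite ltr_pM2r //; lra.
have z0E : z0 = (Re z0)%:C + (Im z0)%:C * ci by rewrite mulrC; exact: complex_split.
have q0 : sq q = 0.
  by apply: (sq_removable cq zx zy); rewrite -z0E.
have -> : sq (ker f 0 z0) = sq (fun w => f z0 * ker (fun=> 1 : C) 0 z0 w + q w).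
  apply: sq_ext => w hw; have wz := neq_nr z01 hw.
  rewrite /q (negbTE wz) /ker expr0 invr1 !mul1r.
  have : w - z0 != 0 by rewrite subr_eq0.
  by move=> h; field.
have cq' : sqcont q by move=> z h1 h2 _; exact: cq.
by rewrite (sq_lin (f z0) (@ker_sqcont _ _ 0 _ (@boxcont_cst R 1) z01) cq') q0 addr0.
Qed.

(** The n-th Taylor coefficient of f at 0, up to the factor [c0]. *)
Definition coef (f : C -> C) n : C := sq (fun w => f w * (w ^+ n.+1)^-1).

(** Partial fractions: 1 / (w - z0) = 1 / w + z0 / (w (w - z0)). *)
Lemma ker_step f n z0 : boxcont f -> nr z0 < 1 ->
  sq (ker f n z0) = z0 * sq (ker f n.+1 z0) + coef f n.
Proof.
move=> cf z01; rewrite /coef -(sq_lin z0 (@ker_sqcont _ _ n.+1 _ cf z01) (@pow_sqcont _ _ n.+1 cf)).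
apply: sq_ext => w hw; rewrite /ker.
have w0 := nr_neq0 hw.
have wz : w - z0 != 0 by rewrite subr_eq0; exact: neq_nr.
have wn : w ^+ n != 0 by rewrite expf_neq0.
rewrite !exprS; move: (w ^+ n) wn => p p0; move: (f w) => v.
by field; rewrite w0 wz p0.
Qed.

Lemma ker_expand f N z0 : boxcont f -> nr z0 < 1 ->
  sq (ker f 0 z0) = \sum_(n < N) coef f n * z0 ^+ n + z0 ^+ N * sq (ker f N z0).
Proof.
move=> cf z01; elim: N => [|N ih].
  by rewrite big_ord0 add0r mul1r.
by rewrite big_ord_recr /= ih (ker_step N cf z01) exprS; ring.
Qed.

(** On the contour |w ^ N| >= 1 and |w - z0| >= 1 / 2, hence 32 is 2 times the 16 of [sq_bound]. *)
Lemma ker_bound f M N z0 : boxcont f -> nr z0 <= 1 / 2 ->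
  (forall z : C, `|Re z| <= 1 -> `|Im z| <= 1 -> nr (f z) <= M) ->
  nr (sq (ker f N z0)) <= 32 * M.
Proof.
move=> cf z0h fM; have z01 : nr z0 < 1 by apply: le_lt_trans z0h _; lra.
have M0 : 0 <= M by apply: le_trans (nr_ge0 (f 0)) _; apply: fM; rewrite /= normr0.
apply: le_trans (_ : 16 * (M * 2) <= _); last by rewrite le_eqVlt; apply/orP; left; apply/eqP; ring.
apply: sq_bound; first exact: (ker_sqcont cf z01).
move=> z z1 h1 h2; rewrite /ker nrM; apply: ler_pM; rewrite ?nr_ge0 //; first exact: fM.
rewrite nrM !nrV nrX.
have -> : (2 : R) = 1 * 2 by rewrite mul1r.
apply: ler_pM; rewrite ?invr_ge0 ?exprn_ge0 ?nr_ge0 //.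
  by rewrite invf_le1 ?exprn_ege1 // exprn_gt0 // (lt_le_trans ltr01).
have h : 1 / 2 <= nr (z - z0) by have := nrD (z - z0) z0; rewrite subrK; lra.
rewrite -[leRHS]invrK lef_pV2 ?posrE ?invr_gt0 //; last by apply: lt_le_trans h; lra.
by apply: le_trans h; lra.
Qed.

Lemma ge0_geom0 (x K : R) : 0 <= x -> (forall N : nat, x <= K * (1 / 2) ^+ N) -> x = 0.
Proof.
move=> x0 h; apply/eqP; rewrite eq_le x0 andbT; apply/ler_addgt0Pl => e e0; rewrite addr0.
have [N hN] := expn2_small K e0; apply: le_trans (h N) _.
by rewrite div1r exprVn ltW.
Qed.

(* c0 = 2 i pi, but only c0 != 0 matters. *)
Definition c0 : C := coef (fun=> 1 : C) 0.

(** In the expansion of the kernel of 1 all coefficients but the first are integrals of w ^ -(n +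
    2), which have primitives; the remainder is at most a constant times 2 ^ -N. *)
Lemma ker1 z0 : nr z0 <= 1 / 2 -> sq (ker (fun=> 1 : C) 0 z0) = c0.
Proof.
move=> z0h; have z01 : nr z0 < 1 by apply: le_lt_trans z0h _; lra.
apply/eqP; rewrite -subr_eq0; apply/eqP/nr_eq0.
apply: (@ge0_geom0 _ 16); first exact: nr_ge0.
move=> N; have -> : 16 * (1 / 2) ^+ N = 32 * (1 / 2) ^+ N.+1 :> R by rewrite exprS; field.
rewrite (ker_expand N.+1 (@boxcont_cst R 1) z01) big_ord_recl expr0 mulr1 -/c0.
rewrite big1 ?addr0 => [|i _].
  rewrite addrC addKr nrM nrX; rewrite mulrC.
  apply: ler_pM; rewrite ?exprn_ge0 ?nr_ge0 //.
    rewrite -[leRHS]mulr1; apply: (ker_bound _ (@boxcont_cst R 1) z0h) => z _ _.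
    by rewrite nr1.
  by apply: lerXn2r => //; rewrite nnegrE ?nr_ge0.
rewrite /coef (_ : sq _ = 0) ?mul0r //.
rewrite -[RHS](@sq_XV R i); apply: sq_ext => w _.
by rewrite mul1r.
Qed.

End CauchyFormula.

(** * Taylor's formula on a disc and the identity theorem *)

Section Taylor.
Context {R : realType}.
Notation C := (Cplx R).

Lemma prim_ge (p : R -> R) (M a b : R) :
  (forall x : R, `|x| <= 2 -> {for x, continuous p}) ->
  -2 < a -> a <= b -> b < 2 -> (forall x, a <= x <= b -> M <= p x) ->
  M * (b - a) <= prim p b - prim p a.
Proof.
move=> cp a2 ab b2 pM.
have dp x : a <= x <= b -> is_derive x 1 (prim p) (p x).
  by move=> /andP[ax xb]; apply: prim_derive => //; rewrite ltr_norml; apply/andP; split; lra.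
have [||c cab ->] := @MVT_segment _ (prim p) p a b ab.
- by move=> x; rewrite in_itv /= => /andP[ax xb]; apply: dp; rewrite !ltW.
- apply: derivable_within_continuous => x; rewrite in_itv /= => axb.
  by have := dp x axb => -[].
- by rewrite ler_wpM2r ?subr_ge0 //; apply: pM; move: cab; rewrite in_itv.
Qed.

Lemma prim_le (p : R -> R) (M a b : R) :
  (forall x : R, `|x| <= 2 -> {for x, continuous p}) ->
  -2 < a -> a <= b -> b < 2 -> (forall x, a <= x <= b -> p x <= M) ->
  prim p b - prim p a <= M * (b - a).
Proof.
move=> cp a2 ab b2 pM.
have dp x : a <= x <= b -> is_derive x 1 (prim p) (p x).
  by move=> /andP[ax xb]; apply: prim_derive => //; rewrite ltr_norml; apply/andP; split; lra.
have [||c cab ->] := @MVT_segment _ (prim p) p a b ab.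
- by move=> x; rewrite in_itv /= => /andP[ax xb]; apply: dp; rewrite !ltW.
- apply: derivable_within_continuous => x; rewrite in_itv /= => axb.
  by have := dp x axb => -[].
- by rewrite ler_wpM2r ?subr_ge0 //; apply: pM; move: cab; rewrite in_itv.
Qed.

(** On each of the four sides the imaginary part of dw / w is dt / (1 + t ^ 2), which is at least dt
    / 2. Hence the imaginary part of the integral is at least 4. *)
Lemma c0_neq0 : (c0 : C) != 0.
Proof.
have cK : sqcont (fun w : C => 1 * (w ^+ 1)^-1).
  exact: (@pow_sqcont _ _ 1 (@boxcont_cst R 1)).
have [c1 c2 c3 c4] := sqcont_rlcont cK.
have h (t : R) : -1 <= t <= 1 -> 1 / 2 <= (1 + t ^+ 2)^-1 :> R.
  move=> /andP[t1 t2]; have t3 : t ^+ 2 <= 1 by rewrite expr2; nra.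
  by rewrite -[leLHS]invrK lef_pV2 ?posrE ?ltr_wpDr ?sqr_ge0 //; lra.
have m2 : -2 < -1 :> R by lra.
have m1 : -1 <= 1 :> R by lra.
have m3 : 1 < 2 :> R by lra.
apply/eqP => e0; have : Im (c0 : C) = 0 by rewrite e0.
rewrite /c0 /coef /sq /rect !raddfB raddfD /=.
have := @prim_ge _ (1 / 2) (-1) 1 (fun t ht => (lcont_ccont c1 ht).2) m2 m1 m3.
have := @prim_ge _ (1 / 2) (-1) 1 (fun t ht => (lcont_ccont c2 ht).1) m2 m1 m3.
have := @prim_le _ (-(1 / 2)) (-1) 1 (fun t ht => (lcont_ccont c3 ht).2) m2 m1 m3.
have := @prim_le _ (-(1 / 2)) (-1) 1 (fun t ht => (lcont_ccont c4 ht).1) m2 m1 m3.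
rewrite /lint /Int /= !mul0r !mul1r !addr0 !add0r.

move=> h4 h3 h2 h1 I0.
lapply h1; last by move=> x /h; rewrite !(mulr0, mulr1, mul1r, mul0r, addr0, add0r, subr0, oppr0, sub0r, sqrrN, expr1n, mulN1r, opprK) addrC.
lapply h2; last by move=> x /h; rewrite !(mulr0, mulr1, mul1r, mul0r, addr0, add0r, subr0, oppr0, sub0r, sqrrN, expr1n, mulN1r, opprK).
lapply h3; last by move=> x /h; rewrite !(mulr0, mulr1, mul1r, mul0r, addr0, add0r, subr0, oppr0, sub0r, sqrrN, expr1n, mulN1r, opprK) lerN2 addrC.
lapply h4; last by move=> x /h; rewrite !(mulr0, mulr1, mul1r, mul0r, addr0, add0r, subr0, oppr0, sub0r, sqrrN, expr1n, mulN1r, opprK) lerN2.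
move: I0; move: (prim _ _) (prim _ _) (prim _ _) (prim _ _) (prim _ _) (prim _ _) (prim _ _) (prim _ _).
by clear; intros; lra.
Qed.

Lemma linear_lineE (L : {linear C -> C}) (k : C) : L k = L 1 * k.
Proof. by rewrite -{1}[k]mulr1 -[k * 1]/(k *: (1 : C)) linearZ mulrC. Qed.

Lemma cder_comp (f g : C -> C) (z a b : C) : is_derive z 1 g a -> is_derive (g z) 1 f b ->
  is_derive z 1 (fun w => f (g w)) (b * a).
Proof.
move=> [dg <-] [df <-].
have dg' : differentiable g z := iffLR (derivable1_diffP _ _) dg.
have df' : differentiable f (g z) := iffLR (derivable1_diffP _ _) df.
have dfg : differentiable (f \o g) z := differentiable_comp dg' df'.
split; first exact: (iffRL (derivable1_diffP _ _) dfg).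
rewrite -[LHS]/('D_1 (f \o g) z) (deriveE (1 : C) dfg) (diff_comp dg' df') /=.
rewrite (deriveE (1 : C) df') (deriveE (1 : C) dg').
exact: linear_lineE.
Qed.

Lemma is_derive_nr (f : C -> C) (z D : C) :
  (forall e : R, 0 < e -> exists2 d : R, 0 < d & forall w, nr (w - z) < d ->
     nr (f w - f z - D * (w - z)) <= e * nr (w - z)) -> is_derive z 1 f D.
Proof.
move=> h.
have cD : h^-1 *: ((f \o shift z) (h *: (1 : C)) - f z) @[h --> (0 : C)^'] --> D.
  apply/cvgrPdist_le => e e0.
  have Ee : e = (Re e)%:C by rewrite RRe_real ?gtr0_real.
  have e0' : 0 < Re e by rewrite -ltcR -Ee.
  have [d d0 hd] := h _ e0'.
  near=> t; have t0 : t != 0 by near: t; exact: nbhs_dnbhs_neq.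
  have td : nr t < d.
    by rewrite -ltcR -nrE; near: t; apply: dnbhs0_lt; rewrite ltcR.
  have := hd (t + z); rewrite addrK => /(_ td) h1.
  rewrite Ee nrE lecR.
  have -> : D - t^-1 *: ((f \o shift z) (t *: (1 : C)) - f z) =
      - (t^-1 * (f (t + z) - f z - D * t)).
    by rewrite /= /GRing.scale /= mulr1; field.
  by rewrite nrN nrM nrV mulrC ler_pdivrMr // nr_gt0.
split; first by apply/cvg_ex; exists D.
exact: cvg_lim.
Unshelve. all: by end_near. Qed.

Lemma taylor_unit f M N z : boxhol f ->
  (forall z : C, `|Re z| <= 1 -> `|Im z| <= 1 -> nr (f z) <= M) ->
  nr z <= 1 / 2 ->
  nr (f z - \sum_(n < N) (coef f n / c0) * z ^+ n) <= (32 / nr (c0 : C)) * M * nr z ^+ N.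
Proof.
move=> hf fM zh; have z1 : nr z < 1 by apply: le_lt_trans zh _; lra.
have cf := boxhol_cont hf.
have := cauchy_kernel hf z1; rewrite (ker1 zh) (ker_expand N cf z1) => E.
have -> : f z - \sum_(n < N) (coef f n / c0) * z ^+ n = c0^-1 * (z ^+ N * sq (ker f N z)).
  apply: (mulIf c0_neq0); rewrite mulrBl -E mulr_suml.
  have -> : \sum_(n < N) coef f n / c0 * z ^+ n * c0 = \sum_(n < N) coef f n * z ^+ n.
    by apply: eq_bigr => n _; rewrite mulrAC divfK // c0_neq0.
  by rewrite addrC addKr [RHS]mulrC mulVKf ?c0_neq0.
have := ker_bound N cf zh fM => kb.
rewrite !nrM nrV nrX.
have zN : 0 <= nr z ^+ N by rewrite exprn_ge0 ?nr_ge0.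
apply: le_trans (_ : (nr (c0 : C))^-1 * (nr z ^+ N * (32 * M)) <= _).
  by rewrite ler_wpM2l ?invr_ge0 ?nr_ge0 // ler_wpM2l.
by rewrite le_eqVlt; apply/orP; left; apply/eqP; ring.
Qed.

Definition taylor_cst : R := 32 / nr (c0 : C).

Lemma taylor_cst_gt0 : 0 < taylor_cst.
Proof. by rewrite divr_gt0 // nr_gt0 c0_neq0. Qed.

Lemma taylor (f : C -> C) (a : C) (r M : R) : 0 < r ->
  (forall w, nr (w - a) <= r -> derivable f w 1) ->
  (forall w, nr (w - a) <= r -> nr (f w) <= M) ->
  exists c : nat -> C, forall N z, nr (z - a) <= r / 8 ->
    nr (f z - \sum_(n < N) c n * (z - a) ^+ n) <= taylor_cst * M * (4 / r * nr (z - a)) ^+ N.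
Proof.
(* Points of the box with sides from -2 to 2 have norm at most 4, so the scale r / 4 maps it into
   the disc of radius r, and |z - a| <= r / 8 corresponds to the disc of radius 1 / 2 of
   [taylor_unit]. *)
move=> r0 df fM; set k : C := (r / 4)%:C.
have k0 : k != 0 by rewrite -nr_gt0 nrC normr_gt0; lra.
have nk : nr k = r / 4 by rewrite nrC ger0_norm; lra.
pose g w := f (a + k * w).
have inb (w : C) : `|Re w| <= 2 -> `|Im w| <= 2 -> nr (a + k * w - a) <= r.
  move=> h1 h2; rewrite addrC addKr nrM nk.
  have n4 : nr w <= 4 by have := nr_leReIm w; lra.
  have : r / 4 * nr w <= r / 4 * 4 by rewrite ler_wpM2l //; lra.
  by lra.
have hg : boxhol g.
  move=> w h1 h2.
  have dk : is_derive w 1 (fun w : C => a + k * w) k.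
    by apply: (is_derive_eq (cderD (cder_cst a w) (cderZ k (cder_id w)))); rewrite add0r mulr1.
  by case: (cder_comp dk (derivableP (df _ (inb w h1 h2)))).
have gM (w : C) : `|Re w| <= 1 -> `|Im w| <= 1 -> nr (g w) <= M.
  by move=> h1 h2; apply: fM; apply: inb; lra.
exists (fun n => coef g n / c0 / k ^+ n) => N z hz.
set w := k^-1 * (z - a).
have zE : z - a = k * w by rewrite /w mulrA mulfV // mul1r.
have nw : nr w = 4 / r * nr (z - a).
  by rewrite /w nrM nrV nk; field; rewrite lt0r_neq0.
have wh : nr w <= 1 / 2.
  by rewrite nw mulrAC ler_pdivrMr //; lra.
have -> : f z = g w by rewrite /g -zE addrC subrK.
rewrite -nw.
have -> : \sum_(n < N) coef g n / c0 / k ^+ n * (z - a) ^+ n = \sum_(n < N) (coef g n / c0) * w ^+ n.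
  by apply: eq_bigr => n _; rewrite zE exprMn mulrA divfK // expf_neq0.
exact: (taylor_unit N hg gM wh).
Qed.

(** Zeros on a real segment determine all the Taylor coefficients: once the earlier ones vanish,
    Taylor's formula at a + t shows that the n-th one is O(t). The remainder then vanishes as well,
    since it decays geometrically on the disc of radius r / 8. *)
Lemma identity_real (f : C -> C) (a : C) (r M del : R) : 0 < r ->
  (forall w, nr (w - a) <= r -> derivable f w 1) ->
  (forall w, nr (w - a) <= r -> nr (f w) <= M) -> 0 < del ->
  (forall t : R, `|t| < del -> f (a + t%:C) = 0) ->
  forall z, nr (z - a) <= r / 8 -> f z = 0.
Proof.
move=> r0 df fM del0 f0; have [c hc] := taylor r0 df fM.
have M0 : 0 <= M by apply: le_trans (nr_ge0 (f a)) (fM a _); rewrite subrr nr0 ltW.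
have c_eq0 n : c n = 0.
  elim/ltn_ind: n => n ih; apply/nr_eq0/eqP; rewrite eq_le nr_ge0 andbT.
  apply/ler_addgt0Pl => e e0; rewrite addr0.
  set B := taylor_cst * M * (4 / r) ^+ n.+1.
  have k0 : 0 <= taylor_cst * M by rewrite mulr_ge0 // ltW // taylor_cst_gt0.
  have r4 : 0 <= 4 / r by rewrite divr_ge0 // ltW.
  have B0 : 0 <= B by rewrite mulr_ge0 // exprn_ge0.
  pose t := Num.min (Num.min (del / 2) (r / 8)) (e / (B + 1)).
  have B1 : 0 < B + 1 by lra.
  have t0 : 0 < t by rewrite /t !lt_min !divr_gt0.
  have t1 : t <= del / 2 by rewrite /t !ge_min lexx.
  have t2 : t <= r / 8 by rewrite /t !ge_min lexx orbT.
  have t3 : t <= e / (B + 1) by rewrite /t !ge_min lexx orbT.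
  have nt : nr (a + t%:C - a) = t by rewrite addrC addKr nrC ger0_norm // ltW.
  have := hc n.+1 (a + t%:C); rewrite nt => /(_ t2).
  rewrite f0 ?ger0_norm ?(ltW t0) //; last by lra.
  rewrite big_ord_recr /= big1 => [|i _]; last by rewrite ih // mul0r.
  have -> : a + t%:C - a = t%:C by rewrite addrC addKr.
  rewrite sub0r nrN add0r nrM nrX nrC (ger0_norm (ltW t0)).
  rewrite exprMn mulrA -/B exprS mulrA ler_pM2r ?exprn_gt0 // => /le_trans; apply.
  apply: le_trans (_ : B * (e / (B + 1)) <= _); first exact: ler_wpM2l.
  by rewrite mulrA ler_pdivrMr // mulrC ler_pM2l // lerDl.
move=> z hz; apply: nr_eq0; apply: (@ge0_geom0 _ _ (taylor_cst * M)); first exact: nr_ge0.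
move=> N; have := hc N z hz.
rewrite big1 ?subr0 => [|i _]; last by rewrite c_eq0 mul0r.
have k0 : 0 <= taylor_cst * M by rewrite mulr_ge0 // ltW // taylor_cst_gt0.
move=> /le_trans; apply; apply: (ler_wpM2l k0).
have h0 : 0 <= 4 / r * nr (z - a) by rewrite mulr_ge0 ?nr_ge0 ?divr_ge0 // ltW.
have h1 : 4 / r * nr (z - a) <= 1 / 2 by rewrite mulrAC ler_pdivrMr //; lra.
by apply: lerXn2r; rewrite ?nnegrE //; apply: le_trans h1.
Qed.

End Taylor.

(** * Holomorphy of directional derivatives *)

Section UniformTaylor.
Context {R : realType}.
Notation C := (Cplx R).

Lemma nr_sub_le0 (x y : C) : nr (x - y) <= 0 -> x = y.
Proof.
move=> h; have : nr (x - y) = 0 by apply/eqP; rewrite eq_le h nr_ge0.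
by move=> /nr_eq0 /eqP; rewrite subr_eq0 => /eqP.
Qed.

Lemma linZ (V : normedModType C) (L : {linear V -> C}) (k : C) u : L (k *: u) = L u * k.
Proof. by rewrite linearZ mulrC. Qed.

Lemma boxhol_derive0 (f : C -> C) M : boxhol f ->
  (forall z : C, `|Re z| <= 1 -> `|Im z| <= 1 -> nr (f z) <= M) ->
  'D_1 f 0 = coef f 1 / c0 /\ forall z, nr z <= 1 / 2 ->
    nr (f z - f 0 - 'D_1 f 0 * z) <= taylor_cst * M * nr z ^+ 2 /\
    nr ('D_1 f 0) <= 2 * taylor_cst * M.
Proof.
move=> hf fM; pose a : nat -> C := fun n => coef f n / c0.
have n0 : nr (0 : C) <= 1 / 2 by rewrite nr0; lra.
have h N z := @taylor_unit R f M N z hf fM.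
have f0 : f 0 = a 0%N.
  have := h 1%N 0 n0; rewrite big_ord1 expr0 mulr1 nr0 expr0n /= mulr0 => h0.
  exact: nr_sub_le0.
have h2 z : nr z <= 1 / 2 -> nr (f z - f 0 - a 1%N * z) <= taylor_cst * M * nr z ^+ 2.
  by move=> /(h 2%N); rewrite big_ord_recr big_ord1 /= expr0 expr1 mulr1 -/(a 0%N) -/(a 1%N) -f0 opprD addrA.
have M0 : 0 <= M by apply: le_trans (nr_ge0 (f 0)) (fM 0 _ _); rewrite /= normr0.
have K0 : 0 <= taylor_cst * M by rewrite mulr_ge0 // ltW // taylor_cst_gt0.
have d0 : 'D_1 f 0 = a 1%N.
  suff [] : is_derive (0 : C) 1 f (a 1%N) by [].
  apply: is_derive_nr => e e0.
  exists (Num.min (1 / 2) (e / (taylor_cst * M + 1))).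
    by rewrite lt_min !divr_gt0 //; lra.
  move=> w; rewrite subr0 lt_min => /andP[w1 w2].
  apply: le_trans (h2 w (ltW w1)) _.
  rewrite expr2 mulrA ler_wpM2r ?nr_ge0 //.
  apply: le_trans (_ : (taylor_cst * M + 1) * nr w <= _); first by rewrite ler_wpM2r ?nr_ge0 //; lra.
  by rewrite mulrC -ler_pdivlMr ?ltW //; lra.
split => // z zh; split; first by rewrite d0; exact: h2.
rewrite d0.
(* The bound on the derivative is read off by comparing the estimates of orders 1 and 2 at the point
   1 / 2. *)
pose p : C := (1 / 2)%:C.
have np : nr p = 1 / 2 by rewrite nrC ger0_norm //; lra.
have ph : nr p <= 1 / 2 by rewrite np.
have := h2 p ph; have := h 1%N p ph.
rewrite big_ord1 expr0 mulr1 -/(a 0%N) -f0 expr1 => h1 h2'.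
have := nrD (f p - f 0) (- (f p - f 0 - a 1%N * p)).
have -> : f p - f 0 - (f p - f 0 - a 1%N * p) = a 1%N * p by ring.
rewrite nrN nrM np; rewrite np in h1; rewrite np in h2'.
have E : 2 * taylor_cst * M = 2 * (taylor_cst * M) by rewrite mulrA.
rewrite E; move: (taylor_cst * M) K0 h1 h2' => KM K0 h1 h2'; nra.
Qed.

Lemma cder_line (V : normedModType C) (f : V -> C) (y u : V) (z : C) :
  differentiable f (y + z *: u) ->
  is_derive z 1 (fun z : C => f (y + z *: u)) ('d f (y + z *: u) u).
Proof.
move=> /differentiable_nr H; apply: is_derive_nr => e e0.
have u1 : 0 < nr u + 1 by rewrite ltr_wpDl ?nr_ge0.
have [d d0 hd] := H _ (divr_gt0 e0 u1).
exists (d / (nr u + 1)); first exact: divr_gt0.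
move=> w wz.
have E : y + w *: u - (y + z *: u) = (w - z) *: u.
  by rewrite opprD addrACA subrr add0r scalerBl.
have n1 : nr (w - z) * nr u <= nr (w - z) * (nr u + 1) by rewrite ler_wpM2l ?nr_ge0 // lerDl.
have := hd (y + w *: u); rewrite E linZ nrZ => /(_ _)/le_trans.
apply; first by apply: le_lt_trans n1 _; rewrite -ltr_pdivlMr.
apply: le_trans (ler_wpM2l _ n1) _; first by rewrite ltW ?divr_gt0.
by rewrite mulrCA divfK ?lt0r_neq0 // mulrC.
Qed.

(** Restriction of f to the complex line through y directed by xi reduces this to one variable. The
    constants do not depend on the direction, and this uniformity gives Frechet differentiability
    later on. *)
Lemma diff_quadratic (V : normedModType C) (f : V -> C) (y : V) (rho M : R) : 0 < rho ->
  (forall x, nr (x - y) < rho -> differentiable f x /\ nr (f x) <= M) ->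
  forall xi, (nr xi <= rho / 16 ->
      nr (f (y + xi) - f y - 'd f y xi) <= taylor_cst * M * (8 / rho * nr xi) ^+ 2)
    /\ nr ('d f y xi) <= 2 * taylor_cst * M * (8 / rho * nr xi).
Proof.
move=> r0 hf xi.
have [->|xi0] := eqVneq xi 0.
  have L0 : 'd f y 0 = 0 by exact: linear0.
  by rewrite L0 !addr0 subrr subr0 !nr0 !mulr0 expr2 !mulr0.
have nx : 0 < nr xi by rewrite nr_gt0.
(* The rescaled direction has norm rho / 8, so parameters of norm at most 4 stay in the ball of
   radius rho; xi itself has the parameter 1 / s, of norm at most 1 / 2 when |xi| <= rho / 16. *)
pose s : R := rho / (8 * nr xi).
have s0 : 0 < s by rewrite divr_gt0 // mulr_gt0.
have sx : s * nr xi = rho / 8 by rewrite /s; field; rewrite lt0r_neq0.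
pose u := s%:C *: xi.
have nu : nr u = rho / 8 by rewrite /u nrZ nrC ger0_norm ?(ltW s0).
have inb (z : C) : `|Re z| <= 2 -> `|Im z| <= 2 -> nr (y + z *: u - y) < rho.
  move=> h1 h2; rewrite addrC addKr nrZ nu.
  have n4 : nr z <= 4 by have := nr_leReIm z; lra.
  have : nr z * (rho / 8) <= 4 * (rho / 8) by rewrite ler_wpM2r //; lra.
  by lra.
pose g (z : C) := f (y + z *: u).
have dg := @cder_line V f y u.
have hg : boxhol g.
  by move=> z h1 h2; case: (dg z (hf _ (inb z h1 h2)).1).
have gM (z : C) : `|Re z| <= 1 -> `|Im z| <= 1 -> nr (g z) <= M.
  by move=> h1 h2; apply: (hf _ (inb z _ _)).2; lra.
have [_ h] := boxhol_derive0 hg gM.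
have g0 : g 0 = f y by rewrite /g scale0r addr0.
have df0 : differentiable f (y + 0 *: u).
  by apply: (hf _ _).1; rewrite scale0r addr0 subrr nr0.
have d0 : 'D_1 g 0 = s%:C * 'd f y xi.
  have [_ ->] := dg 0 df0; rewrite scale0r addr0 /u.
  by rewrite linZ mulrC.
have z0 : nr (0 : C) <= 1 / 2 by rewrite nr0; lra.
have ss : nr (s%:C : C) = s by rewrite nrC ger0_norm ?(ltW s0).
split.
- move=> xs; pose z : C := s^-1%:C.
  have nz : nr z = 8 / rho * nr xi.
    rewrite nrC ger0_norm ?invr_ge0 ?(ltW s0) // /s; field; rewrite !lt0r_neq0 //.
  have zh : nr z <= 1 / 2 by rewrite nz mulrAC ler_pdivrMr //; lra.
  have [+ _] := h z zh; rewrite g0 nz d0.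
  have sz : s%:C * z = 1 by rewrite /z -rmorphM mulfV ?lt0r_neq0.
  have -> : s%:C * 'd f y xi * z = 'd f y xi by rewrite mulrAC sz mul1r.
  have -> : g z = f (y + xi) by rewrite /g /u scalerA mulrC sz scale1r.
  by [].
- have [_] := h 0 z0; rewrite d0 nrM ss => hb.
  have sE : s^-1 = 8 / rho * nr xi by rewrite /s; field; rewrite !lt0r_neq0.
  by rewrite -sE ler_pdivlMr // mulrC.
Qed.

End UniformTaylor.

(** * Differentiability of a directional derivative *)

Section Regularity.
Context {R : realType}.
Notation C := (Cplx R).

(** For a small fixed t the difference quotient (f (y + t xi) - f y) / t is continuous in y and
    approximates the derivative with an error t K that is uniform in y. *)
Lemma diff_dir_cont (V : normedModType C) (f : V -> C) (x0 : V) (del M : R) y xi :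
  0 < del -> (forall x, nr (x - x0) < del -> differentiable f x /\ nr (f x) <= M) ->
  nr (y - x0) < del / 2 -> {for y, continuous (fun y => 'd f y xi)}.
Proof.
move=> del0 hf.
have sub_ball z rho x : nr (z - x0) + rho <= del -> nr (x - z) < rho ->
    nr (x - x0) < del.
  by move=> h1 h2; have := nrD (x - z) (z - x0); rewrite addrA subrK; lra.
move=> yx; have M0 : 0 <= M.
  by apply: le_trans (nr_ge0 (f x0)) (hf _ _).2; rewrite subrr nr0.
have rho0 : 0 < del / 4 by lra.
have K0 : 0 <= taylor_cst * M by rewrite mulr_ge0 // ltW // taylor_cst_gt0.
pose K := taylor_cst * M * (8 / (del / 4)) ^+ 2 * nr xi ^+ 2.
have KK : 0 <= K by rewrite /K (mulr_ge0 (mulr_ge0 K0 (sqr_ge0 _)) (sqr_ge0 _)).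
apply/continuous_nrP => e e0.
(* Each of the two quadratic errors is then at most t e / 4, and each of the two differences of
   values of f is below t e / 8; the total 3 t e / 4 is divided by t at the end. *)
pose t := Num.min (del / 64 / (nr xi + 1)) (e / (4 * (K + 1))).
have x1 : 0 < nr xi + 1 by have := nr_ge0 xi; lra.
have t0 : 0 < t by rewrite /t lt_min !divr_gt0 //; lra.
have t1 : t * nr xi <= (del / 4) / 16.
  apply: le_trans (_ : t * (nr xi + 1) <= _); first by rewrite ler_wpM2l ?(ltW t0) //; lra.
  by rewrite -ler_pdivlMr // /t ge_min; apply/orP; left; rewrite le_eqVlt; apply/orP; left; apply/eqP; field; lra.
have t2 : t * K <= e / 4.
  apply: le_trans (_ : t * (K + 1) <= _); first by rewrite ler_wpM2l ?(ltW t0) //; lra.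
  rewrite -ler_pdivlMr; last by lra.
  by rewrite /t ge_min; apply/orP; right; rewrite le_eqVlt; apply/orP; left; apply/eqP; field; lra.
pose u := t%:C *: xi.
have nu : nr u = t * nr xi by rewrite nrZ nrC ger0_norm // ltW.
have quad z : nr (z - x0) < del * 3 / 4 -> nr (f (z + u) - f z - 'd f z u) <= t * t * K.
  move=> zx; have hz w : nr (w - z) < del / 4 -> differentiable f w /\ nr (f w) <= M.
    by move=> wz; apply: hf; apply: (@sub_ball z (del / 4) _ _ wz); lra.
  have [+ _] := diff_quadratic rho0 hz u; rewrite nu => /(_ t1) /le_trans; apply.
  by rewrite le_eqVlt; apply/orP; left; apply/eqP; rewrite /K; ring.
have cyu : {for y + u, continuous f}.
  apply: differentiable_continuous; apply: (hf _ _).1.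
  have := nrD (y - x0) u; rewrite addrAC nu.
  have : t * nr xi <= del / 64 by lra.
  by lra.
have cy : {for y, continuous f}.
  by apply: differentiable_continuous; apply: (hf _ _).1; lra.
have te : 0 < t * e / 8 by rewrite divr_gt0 // mulr_gt0.
have [d1 d10 h1] := iffLR (continuous_nrP _ _) cyu _ te.
have [d2 d20 h2] := iffLR (continuous_nrP _ _) cy _ te.
exists (Num.min (del / 4) (Num.min d1 d2)).
  by rewrite !lt_min d10 d20 /=; lra.
move=> z; rewrite !lt_min => /and3P[z1 z2 z3].
have zx : nr (z - x0) < del * 3 / 4.
  by have := nrD (z - y) (y - x0); rewrite addrA subrK; lra.
have qz := quad z zx; have yx' : nr (y - x0) < del * 3 / 4 by lra.
have qy := quad y yx'.
have e1 := h2 z z3.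
have e2 : nr (f (z + u) - f (y + u)) < t * e / 8.
  by apply: h1; rewrite opprD addrACA subrr addr0.
have E : 'd f z u - 'd f y u = (f (z + u) - f (y + u)) - (f z - f y)
   - (f (z + u) - f z - 'd f z u) + (f (y + u) - f y - 'd f y u) by ring.
have n1 := nrD (f (z + u) - f (y + u) - (f z - f y) - (f (z + u) - f z - 'd f z u)) (f (y + u) - f y - 'd f y u).
have n2 := nrD (f (z + u) - f (y + u) - (f z - f y)) (- (f (z + u) - f z - 'd f z u)).
have n3 := nrD (f (z + u) - f (y + u)) (- (f z - f y)).
rewrite -E in n1; rewrite nrN in n2; rewrite nrN in n3.
have E2 : 'd f z u - 'd f y u = ('d f z xi - 'd f y xi) * t%:C.
  have Lu w : 'd f w u = 'd f w xi * t%:C by exact: linZ.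
  by rewrite !Lu mulrBl.
have n4 : nr ('d f z u - 'd f y u) <= t * e / 4 + 2 * (t * t * K) by lra.
rewrite E2 nrM nrC (ger0_norm (ltW t0)) in n4.
have n5 : t * t * K <= t * (e / 4) by rewrite -mulrA ler_wpM2l ?(ltW t0).
have n6 : nr ('d f z xi - 'd f y xi) * t < e * t.
  apply: le_lt_trans n4 _; rewrite [e * t]mulrC.
  have te0 : 0 < t * e by rewrite mulr_gt0.
  by move: n5 te0; rewrite !mulrA; lra.
by rewrite ltr_pM2r in n6.
Qed.

Lemma Re_box (z : C) : `|Re z| <= 2 -> `|Im z| <= 2 -> nr z <= 4.
Proof. by move=> h1 h2; have := nr_leReIm z; lra. Qed.

(* Differentiation under the integral sign in Cauchy's formula
   'D_v f x = c0^-1 s^-1 \oint f (x + s z v) z^-2 dz. *)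
Lemma differentiable_derive_local (V : normedModType C) (f : V -> C) (x0 v : V) (del M : R) :
  0 < del -> (forall x, nr (x - x0) < del -> differentiable f x /\ nr (f x) <= M) ->
  differentiable (fun x => 'd f x v) x0.
Proof.
move=> del0 hf.
have M0 : 0 <= M.
  by apply: le_trans (nr_ge0 (f x0)) (hf _ _).2; rewrite subrr nr0.
have K0 : 0 <= taylor_cst * M by rewrite mulr_ge0 // ltW // taylor_cst_gt0.
have rho0 : 0 < del / 4 by lra.
have v1 : 0 < nr v + 1 by have := nr_ge0 v; lra.
(* Displacements by z s v with z in the box then have norm at most del / 4. *)
pose s : R := del / (16 * (nr v + 1)).
have s0 : 0 < s by rewrite divr_gt0 // mulr_gt0.
have sv : s * nr v <= del / 16.
  apply: le_trans (_ : s * (nr v + 1) <= _); first by rewrite ler_wpM2l ?(ltW s0) //; lra.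
  by rewrite /s le_eqVlt; apply/orP; left; apply/eqP; field; lra.
pose u := s%:C *: v.
have nu : nr u <= del / 16 by rewrite nrZ nrC ger0_norm // ltW.
have nzu (z : C) : `|Re z| <= 2 -> `|Im z| <= 2 -> nr (z *: u) <= del / 4.
  move=> h1 h2; have z4 := Re_box h1 h2; rewrite nrZ.
  apply: le_trans (_ : 4 * (del / 16) <= _); last by lra.
  by apply: ler_pM; rewrite ?nr_ge0.
have inx x (z : C) : nr (x - x0) < del / 4 -> `|Re z| <= 2 -> `|Im z| <= 2 ->
    nr (x + z *: u - x0) < del / 2.
  move=> hx h1 h2; have := nzu z h1 h2; have := nrD (x - x0) (z *: u).
  by rewrite addrAC; lra.
pose g x (z : C) := f (x + z *: u).
have hg x : nr (x - x0) < del / 4 -> boxhol (g x).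
  move=> hx z h1 h2; have hz := inx x z hx h1 h2.
  have [|df _] := hf (x + z *: u) _; first by lra.
  by case: (cder_line df).
have Cg x : nr (x - x0) < del / 4 -> 'd f x v = (s%:C * c0)^-1 * coef (g x) 1.
  move=> hx; have gM (z : C) : `|Re z| <= 1 -> `|Im z| <= 1 -> nr (g x z) <= M.
    move=> h1 h2; have hz : nr (x + z *: u - x0) < del / 2 by apply: inx; lra.
    by apply: (hf _ _).2; lra.
  have [d0 _] := boxhol_derive0 (hg x hx) gM.
  have df : differentiable f (x + 0 *: u).
    by apply: (hf _ _).1; rewrite scale0r addr0; lra.
  have [_] := cder_line df; rewrite d0 scale0r addr0 => E.
  have L : 'd f x u = 'd f x v * s%:C by exact: linZ.
  have s1 : (s%:C : C) != 0 by rewrite -nr_gt0 nrC normr_gt0 lt0r_neq0.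
  rewrite L in E; rewrite invfM -mulrA [c0^-1 * _]mulrC E mulrCA mulVf ?mulr1 //.
(* The derivative of the Cauchy integrand at x0 in the direction xi; [diff_dir_cont] makes it
   continuous in z, hence integrable. *)
pose Df : V -> C -> C := fun xi z => 'd f (x0 + z *: u) xi.
have cDf xi : boxcont (Df xi).
  move=> z h1 h2; apply: (iffRL (@continuous_nrP R C C (Df xi) z)) => e e0.
  have hz : nr (x0 + z *: u - x0) < del / 2.
    by apply: inx => //; rewrite subrr nr0.
  have [d d0 hd] := iffLR (continuous_nrP _ _) (@diff_dir_cont V f x0 del M _ xi del0 hf hz) e e0.
  have u1 : 0 < nr u + 1 by have := nr_ge0 u; lra.
  exists (d / (nr u + 1)); first exact: divr_gt0.
  move=> y yz; apply: hd.
  have -> : x0 + y *: u - (x0 + z *: u) = (y - z) *: u.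
    by rewrite opprD addrACA subrr add0r scalerBl.
  rewrite nrZ; apply: le_lt_trans (_ : nr (y - z) * (nr u + 1) < _).
    by rewrite ler_wpM2l ?nr_ge0 //; lra.
  by rewrite -ltr_pdivlMr.
pose k : C := (s%:C * c0)^-1.
(* The candidate for the differential at x0: the Cauchy integral [Cg] differentiated under the
   integral sign. *)
pose L (xi : V) : C := k * coef (Df xi) 1.
have Llin : linear L.
  move=> a x y; rewrite /L /coef.
  have -> : sq (fun w => Df (a *: x + y) w * (w ^+ 2)^-1) =
     a * sq (fun w => Df x w * (w ^+ 2)^-1) + sq (fun w => Df y w * (w ^+ 2)^-1).
    rewrite -(sq_lin a (@pow_sqcont _ _ 2 (cDf x)) (@pow_sqcont _ _ 2 (cDf y))).
    apply: sq_ext => w _; rewrite /Df linearP mulrDl mulrA //.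
  by rewrite mulrDr mulrCA.
pose LL : {linear V -> C} := HB.pack L (GRing.isLinear.Build _ _ _ _ L Llin).
have hz0 (z w : V) : nr (z - x0) < del / 2 -> nr (w - z) < del / 4 ->
    differentiable f w /\ nr (f w) <= M.
  move=> zx wz; apply: hf; have := nrD (w - z) (z - x0); rewrite addrA subrK; lra.
pose B := 16 * (2 * taylor_cst * M * (8 / (del / 4))).
pose Q := 16 * (taylor_cst * M * (8 / (del / 4)) ^+ 2).
have Q0 : 0 <= Q by rewrite /Q mulr_ge0 // mulr_ge0 // sqr_ge0.
have invz (z : C) : 1 <= nr z -> nr ((z ^+ 2)^-1) <= 1.
  move=> z1; rewrite nrV nrX invf_le1 ?exprn_ege1 // exprn_gt0 //; lra.
have box2 (z : C) : `|Re z| <= 1 -> `|Im z| <= 1 -> nr (x0 + z *: u - x0) < del / 2.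
  by move=> h1 h2; apply: inx; rewrite ?subrr ?nr0; lra.
have [] // := @nr_differentiable R V C (fun x => 'd f x v) x0 LL (nr k * B).
- move=> xi; rewrite /= /L nrM -mulrA ler_wpM2l ?nr_ge0 //.
  apply: le_trans (_ : 16 * (2 * taylor_cst * M * (8 / (del / 4) * nr xi)) <= _); last first.
    by rewrite /B le_eqVlt; apply/orP; left; apply/eqP; ring.
  apply: sq_bound; first exact: (@pow_sqcont _ _ 2 (cDf xi)).
  move=> z z1 h1 h2; rewrite nrM -[leRHS]mulr1; apply: ler_pM; rewrite ?nr_ge0 ?invz //.
  by apply: (diff_quadratic rho0 (fun w => hz0 _ w (box2 z h1 h2)) xi).2.
- move=> e e0; pose d := Num.min (del / 64) (e / (nr k * Q + 1)).
  have kQ : 0 < nr k * Q + 1 by rewrite ltr_wpDl // mulr_ge0 // nr_ge0.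
  exists d; first by rewrite /d lt_min !divr_gt0.
  move=> y; rewrite /d lt_min => /andP[y1 y2]; pose xi := y - x0.
  have yx : nr (y - x0) < del / 4 by lra.
  have xx : nr (x0 - x0) < del / 4 by rewrite subrr nr0.
  rewrite (Cg y yx) (Cg x0 xx) -/k /= /L -!mulrBr -/xi.
  have bg x (hx : nr (x - x0) < del / 4) := @pow_sqcont _ _ 2 (boxhol_cont (hg x hx)).
  (* The remainder is the contour integral of the first-order remainders of f at the points x0 + z
     u, which [diff_quadratic] bounds by one constant times |xi| ^ 2. *)
  have -> : coef (g y) 1 - coef (g x0) 1 - coef (Df xi) 1 =
    sq (fun w => (g y w - g x0 w - Df xi w) * (w ^+ 2)^-1).
    rewrite /coef.
    have c2 := @pow_sqcont _ _ 2 (cDf xi).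
    have c3 : sqcont (fun w => -1 * (g x0 w * (w ^+ 2)^-1) + g y w * (w ^+ 2)^-1).
      have h0 : boxcont (fun w => g y w - g x0 w).
        by move=> z h1 h2; apply: ccontB; [exact: (boxhol_cont (hg y yx))|exact: (boxhol_cont (hg x0 xx))].
      have := @pow_sqcont _ _ 2 h0.
      by congr sqcont; apply/funext => w; ring.
    transitivity (-1 * sq (fun w => Df xi w * (w ^+ 2)^-1) +
       sq (fun w => -1 * (g x0 w * (w ^+ 2)^-1) + g y w * (w ^+ 2)^-1)).
      by rewrite (sq_lin (-1) (bg x0 xx) (bg y yx)); ring.
    rewrite -(sq_lin (-1) c2 c3); apply: sq_ext => w _; ring.
  rewrite nrM; apply: le_trans (_ : nr k * (Q * nr xi ^+ 2) <= _).
    rewrite ler_wpM2l ?nr_ge0 //.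
    apply: le_trans (_ : 16 * (taylor_cst * M * (8 / (del / 4) * nr xi) ^+ 2) <= _); last first.
      by rewrite /Q le_eqVlt; apply/orP; left; apply/eqP; ring.
    apply: sq_bound.
      have h0 : boxcont (fun w => g y w - g x0 w - Df xi w).
        move=> z h1 h2; apply: ccontB; last exact: cDf.
        by apply: ccontB; [exact: (boxhol_cont (hg y yx))|exact: (boxhol_cont (hg x0 xx))].
      exact: (@pow_sqcont _ _ 2 h0).
    move=> z z1 h1 h2; rewrite nrM -[leRHS]mulr1; apply: ler_pM; rewrite ?nr_ge0 ?invz //.
    have := (diff_quadratic rho0 (fun w => hz0 _ w (box2 z h1 h2)) xi).1.
    have -> : x0 + z *: u + xi = y + z *: u by rewrite /xi addrAC subrKC.
    by apply; rewrite /xi; lra.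
  have n0 := nr_ge0 xi.
  rewrite mulrA expr2 mulrA ler_wpM2r //.
  apply: le_trans (_ : (nr k * Q + 1) * nr xi <= _); first by rewrite ler_wpM2r //; lra.
  by rewrite mulrC -ler_pdivlMr // ltW.
Qed.

(** Continuity at x supplies the local bound on f that the Cauchy estimates need. *)
Lemma differentiable_diff (V : normedModType C) (D : set V) (f : V -> C) (v : V) :
  open D -> (forall x, D x -> differentiable f x) ->
  forall x, D x -> differentiable (fun x => 'd f x v) x.
Proof.
move=> oD df x Dx.
have [d1 d10 h1] := iffLR (open_nrP _) oD x Dx.
have [d2 d20 h2] := iffLR (continuous_nrP _ _) (differentiable_continuous (df x Dx)) 1 ltr01.
apply: (@differentiable_derive_local V f x v (Num.min d1 d2) (nr (f x) + 1)).
  by rewrite lt_min d10 d20.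
move=> y; rewrite lt_min => /andP[y1 y2]; split; first exact/df/h1.
by have := h2 y y2; have := nrD (f y - f x) (f x); rewrite subrK; lra.
Qed.

End Regularity.

(** * Rules for Frechet differentials *)

Section Calculus.
Context {R : realType}.
Notation C := (Cplx R).

Lemma differentiable_fst (p : (C * C)%type) : differentiable (fun q : (C * C)%type => q.1) p /\
  forall v, 'd (fun q : (C * C)%type => q.1) p v = v.1.
Proof.
have c : continuous (fst : (C * C)%type -> C) by move=> x; exact: cvg_fst.
split; first exact: (@linear_differentiable _ _ _ (fst : {linear (C * C)%type -> C})).
by move=> v; rewrite (@diff_lin _ _ _ (fst : {linear (C * C)%type -> C})).
Qed.

Lemma differentiable_snd (p : (C * C)%type) : differentiable (fun q : (C * C)%type => q.2) p /\
  forall v, 'd (fun q : (C * C)%type => q.2) p v = v.2.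
Proof.
have c : continuous (snd : (C * C)%type -> C) by move=> x; exact: cvg_snd.
split; first exact: (@linear_differentiable _ _ _ (snd : {linear (C * C)%type -> C})).
by move=> v; rewrite (@diff_lin _ _ _ (snd : {linear (C * C)%type -> C})).
Qed.

Lemma diff_coord n (p : 'rV[C]_n) j : differentiable (fun x : 'rV[C]_n => x 0 j : C) p /\
  forall v, 'd (fun x : 'rV[C]_n => x 0 j : C) p v = v 0 j.
Proof.
split; first exact: differentiable_coord.
move=> v.
have Llin : linear (fun x : 'rV[C]_n => x 0 j : C) by move=> a x y; rewrite !mxE.
pose LL : {linear 'rV[C]_n -> C} := HB.pack (fun x : 'rV[C]_n => x 0 j : C) (GRing.isLinear.Build _ _ _ _ _ Llin).
by rewrite -[X in 'd X _ _]/(LL : _ -> _) diff_lin //; exact: coord_continuous.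
Qed.

Lemma diff_comp_app (V W U : normedModType C) (f : W -> U) (g : V -> W) (x : V) :
  differentiable g x -> differentiable f (g x) ->
  differentiable (fun y => f (g y)) x /\
  forall v, 'd (fun y => f (g y)) x v = 'd f (g x) ('d g x v).
Proof.
move=> dg df; split; first exact: (differentiable_comp dg df).
move=> v; have E : 'd (f \o g) x = 'd f (g x) \o 'd g x :> (V -> U) := diff_comp dg df.
exact: (congr1 (fun F : V -> U => F v) E).
Qed.

Lemma diff_D1 (f : C -> C) (z k : C) : derivable f z 1 -> 'd f z k = 'D_1 f z * k.
Proof.
move=> /derivable1_diffP df; rewrite (deriveE (1 : C) df).
exact: (linear_lineE ('d f z) k).
Qed.

Lemma cdiff_comp1 (V : normedModType C) (f : C -> C) (g : V -> C) (x : V) :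
  differentiable g x -> derivable f (g x) 1 ->
  differentiable (fun y => f (g y)) x /\
  forall v, 'd (fun y => f (g y)) x v = 'D_1 f (g x) * 'd g x v.
Proof.
move=> dg df; have df' : differentiable f (g x) by apply/derivable1_diffP.
have [d E] := diff_comp_app dg df'.
by split => // v; apply: etrans (E v) _; exact: diff_D1.
Qed.

Lemma diff_rV (V : normedModType C) n (F : V -> 'rV[C]_n) (x : V) :
  (forall i, differentiable (fun y => F y 0 i : C) x) ->
  differentiable F x /\ forall v i, ('d F x v) 0 i = 'd (fun y => F y 0 i : C) x v.
Proof.
move=> dF.
have dS : differentiable F x.
  have -> : F = \sum_(i < n) (fun y => F y 0 i *: (delta_mx 0 i : 'rV[C]_n)).
    by apply/funext => y; rewrite fct_sumE [LHS]row_sum_delta.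
  apply: differentiable_sum => i; apply: differentiableZl; exact: dF.
split => // v i.
have [dc dcE] := diff_coord (F x) i.
have [_ E] := diff_comp_app dS dc.
by apply: etrans (esym (dcE _)) (esym (E v)).
Qed.

Lemma diffc_M (V : normedModType C) (f g : V -> C) x :
  differentiable f x -> differentiable g x ->
  differentiable (fun y => f y * g y) x /\
  forall v, 'd (fun y => f y * g y) x v = f x * 'd g x v + g x * 'd f x v.
Proof.
move=> df dg; split; first exact: differentiableM.
have E := diffM df dg.
by move=> v; apply: (congr1 (fun F : V -> C => F v) E).
Qed.

Lemma diffc_V (V : normedModType C) (f : V -> C) x :
  differentiable f x -> f x != 0 ->
  differentiable (fun y => (f y)^-1) x /\
  forall v, 'd (fun y => (f y)^-1) x v = - (f x) ^- 2 * 'd f x v.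
Proof.
move=> df fx; split; first exact: differentiableV.
have E := diffV df fx.
by move=> v; apply: (congr1 (fun F : V -> C => F v) E).
Qed.

Lemma diffc_sum (V : normedModType C) n (f : 'I_n -> V -> C) x :
  (forall i, differentiable (f i) x) ->
  differentiable (fun y => \sum_i f i y) x /\
  forall v, 'd (fun y => \sum_i f i y) x v = \sum_i 'd (f i) x v.
Proof.
elim: n f => [|n ih] f df.
  have -> : (fun y => \sum_i f i y) = cst 0 by apply/funext => y; rewrite big_ord0.
  split; first exact: differentiable_cst.
  have E := @diff_cst _ V C 0 x.
  by move=> v; rewrite big_ord0; apply: (congr1 (fun F : V -> C => F v) E).
have [d1 E1] := ih (fun i => f (widen_ord (leqnSn n) i)) (fun i => df _).
have -> : (fun y => \sum_i f i y) =
   (fun y => \sum_i f (widen_ord (leqnSn n) i) y) + f ord_max.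
  by apply/funext => y; rewrite big_ord_recr.
split; first exact: differentiableD.
have E := diffD d1 (df ord_max).
by move=> v; apply: etrans (congr1 (fun F : V -> C => F v) E) _; rewrite big_ord_recr /= -E1.
Qed.

Lemma diffc_near (V : normedModType C) (f g : V -> C) x :
  (\forall y \near x, f y = g y) -> differentiable f x ->
  differentiable g x /\ forall v, 'd g x v = 'd f x v.
Proof.
move=> /nbhs_nrP [d0 d00 fg] df.
have fgx : f x = g x by apply: fg; rewrite subrr nr0.
have h := differentiable_nr df.
have cL : continuous ('d f x) by exact: diff_continuous.
have E : g \o shift x = cst (g x) + 'd f x +o_ 0 id.
  apply/eqaddoP => e e0.
  have Ee : e = (Re e)%:C by rewrite RRe_real ?gtr0_real.
  have e0' : 0 < Re e by rewrite -ltcR -Ee.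
  have [d dd hd] := h _ e0'.
  apply/nbhs_nrP; exists (Num.min d0 d); first by rewrite lt_min d00 dd.
  move=> y; rewrite subr0 lt_min => /andP[y0 yd].
  rewrite !nrE Ee -rmorphM lecR.
  have := hd (y + x); rewrite addrK => /(_ yd).
  by rewrite fg ?addrK // fgx /= !fctE opprD addrA.
have dE := diff_unique cL E.
split; last by move=> v; apply: (congr1 (fun F : V -> C => F v) dE).
pose P (L : V -> C) := continuous L /\ g \o shift x = cst (g x) + L +o_ 0 id.
have PL : P ('d f x) by split.
exact: (iffRL (diff_locallyP x g) (eq_ind_r P PL dE)).
Qed.

End Calculus.

(** * Polarization of the metric identity *)

Section Wirtinger.
Context {R : realType}.
Notation C := (Cplx R).
Notation ci := (Ci R).

Definition diag_pt m (z : 'rV[C]_m) : 'rV[C]_(m + m) := row_mx z (conj_vec z).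

Lemma conjc_lin (a b : C) (t : R) : conjc (a + t%:C * b) = conjc a + t%:C * conjc b :> C.
Proof.
case: a b => a1 a2 [b1 b2]; apply/eqP; rewrite eq_complex /=.
by apply/andP; split; apply/eqP; ring.
Qed.

Lemma pd_line m (z v : 'rV[C]_m) (t : R) :
  diag_pt (z + t%:C *: v) = diag_pt z + t%:C *: row_mx v (conj_vec v).
Proof.
rewrite /diag_pt scale_row_mx add_row_mx; congr row_mx.
by apply/rowP => i; rewrite !mxE conjc_lin.
Qed.

Lemma is_deriveE (f : R -> R) (x d : R) : is_derive x 1 f d -> 'D_1 f x = d.
Proof. by case. Qed.

Lemma real_deriv_line m (f : 'rV[C]_m -> C) (g : C -> C) (z v : 'rV[C]_m) (d : C) (e : R) :
  0 < e -> (forall t : R, `|t| < e -> f (z + t%:C *: v) = g t%:C) -> is_derive (0 : C) 1 g d ->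
  real_deriv f v z = d.
Proof.
move=> e0 fg [dg dE].
have dg' : derivable g (0 + (0 : R)%:C * 1) 1 by rewrite mul0r addr0.
have [h1 h2] := cderR_line dg'.
have E : 'D_1 g (0 + (0 : R)%:C * 1) = d by rewrite mul0r addr0.
rewrite E mul1r in h1 h2.
have near0 : \forall t \near (0 : R), g (0 + t%:C * 1) = f (z + t%:C *: v).
  apply/nbhs_normP; exists e => //= t; rewrite /= sub0r normrN => te.
  by rewrite fg // mulr1 add0r.
have k1 : is_derive (0 : R) 1 (fun t : R => Re (f (z + t%:C *: v))) (Re d).
  apply: (near_eq_is_derive _ h1); apply: filterS near0 => t /= -> //.
have k2 : is_derive (0 : R) 1 (fun t : R => Im (f (z + t%:C *: v))) (Im d).
  apply: (near_eq_is_derive _ h2); apply: filterS near0 => t /= -> //.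
rewrite /real_deriv !derive1E (is_deriveE k1) (is_deriveE k2).
by case: (d).
Qed.

Lemma real_deriv_pol m (k : 'rV[C]_(m + m) -> C) (z v : 'rV[C]_m) :
  differentiable k (diag_pt z) ->
  real_deriv (fun z => k (diag_pt z)) v z = 'd k (diag_pt z) (row_mx v (conj_vec v)).
Proof.
move=> dk; set u := row_mx _ _.
have dk' : differentiable k (diag_pt z + (0 : C) *: u) by rewrite scale0r addr0.
have h := cder_line dk'; rewrite scale0r addr0 in h.
by apply: (real_deriv_line (g := fun w => k (diag_pt z + w *: u)) ltr01 _ h) => t _; rewrite pd_line.
Qed.

Lemma conj_ci (x : C) : conjc (ci * x) = - ci * conjc x :> C.
Proof.
case: x => a b; apply/eqP; rewrite eq_complex /=.
by apply/andP; split; apply/eqP; ring.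
Qed.

Lemma conj_vec_delta m (j : 'I_m) : conj_vec (delta_mx 0 j : 'rV[C]_m) = delta_mx 0 j.
Proof. by apply/rowP => i; rewrite !mxE; case: (_ && _); rewrite ?conjc1 ?conjc0. Qed.

Lemma conj_vec_ci m (v : 'rV[C]_m) : conj_vec (ci *: v) = - ci *: conj_vec v.
Proof. by apply/rowP => i; rewrite !mxE conj_ci. Qed.

Lemma ci2 : ci * ci = -1.
Proof. by rewrite -expr2; exact: sqr_i. Qed.

Lemma dir_split m (L : {linear 'rV[C]_(m + m) -> C}) (j : 'I_m) (a b : C) :
  L (row_mx (a *: delta_mx 0 j) (b *: delta_mx 0 j)) =
    a * L (row_mx (delta_mx 0 j) 0) + b * L (row_mx 0 (delta_mx 0 j)).
Proof.
have -> : row_mx (a *: delta_mx 0 j) (b *: delta_mx 0 j) =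
    a *: row_mx (delta_mx 0 j) 0 + b *: row_mx 0 (delta_mx 0 j) :> 'rV[C]_(m + m).
  by rewrite !scale_row_mx !scaler0 add_row_mx addr0 add0r.
by rewrite linearD !linZ !(mulrC _ (L _)).
Qed.

(** The real derivative is a complex linear form in the pair (v, conj v). Replacing v by i v
    multiplies the first half by i and the second by -i, so the two Wirtinger combinations isolate
    the halves. *)
Lemma dz_of m (f : 'rV[C]_m -> C) (z : 'rV[C]_m) (j : 'I_m) (L : {linear 'rV[C]_(m + m) -> C}) :
  (forall v, real_deriv f v z = L (row_mx v (conj_vec v))) ->
  dz j f z = L (row_mx (delta_mx 0 j) 0) /\ dzbar j f z = L (row_mx 0 (delta_mx 0 j)).
Proof.
move=> hL; rewrite /dz /dzbar !hL conj_vec_ci conj_vec_delta.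
have -> : L (row_mx (delta_mx 0 j) (delta_mx 0 j)) =
    1 * L (row_mx (delta_mx 0 j) 0) + 1 * L (row_mx 0 (delta_mx 0 j)).
  by rewrite -dir_split !scale1r.
rewrite (dir_split L j ci (- ci)).
move: (L _) (L _) => b a; have i2 := ci2.
have n2 : (2 : C) != 0 by rewrite pnatr_eq0.
split.
  have -> : 1 * a + 1 * b - ci * (ci * a + - ci * b) = a + b - (ci * ci) * (a - b) by ring.
  by rewrite i2; field.
have -> : 1 * a + 1 * b + ci * (ci * a + - ci * b) = a + b + (ci * ci) * (a - b) by ring.
by rewrite i2; field.
Qed.

Lemma dz_pol m (k : 'rV[C]_(m + m) -> C) (z : 'rV[C]_m) (j : 'I_m) :
  differentiable k (diag_pt z) ->
  dz j (fun z => k (diag_pt z)) z = 'd k (diag_pt z) (row_mx (delta_mx 0 j) 0) /\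
  dzbar j (fun z => k (diag_pt z)) z = 'd k (diag_pt z) (row_mx 0 (delta_mx 0 j)).
Proof. by move=> dk; apply: (@dz_of _ _ z j ('d k (diag_pt z))) => v; exact: real_deriv_pol. Qed.

Lemma real_deriv_near m (f g : 'rV[C]_m -> C) (v z : 'rV[C]_m) :
  (\forall w \near z, f w = g w) -> real_deriv f v z = real_deriv g v z.
Proof.
move=> /nbhs_nrP [e e0 fg].
have v1 : 0 < nr v + 1 by have := nr_ge0 v; lra.
have N : \forall t \near (0 : R), f (z + t%:C *: v) = g (z + t%:C *: v).
  apply/nbhs_normP; exists (e / (nr v + 1)) => /=; first exact: divr_gt0.
  move=> t /=; rewrite sub0r normrN => te; apply: fg.
  rewrite addrC addKr nrZ nrC; apply: le_lt_trans (_ : `|t| * (nr v + 1) < _).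
    by rewrite ler_wpM2l //; lra.
  by rewrite -ltr_pdivlMr.
rewrite /real_deriv !derive1E; congr (_ +i* _); apply: near_eq_derive; apply: filterS N => t -> //.
Qed.

Lemma dz_near m (f g : 'rV[C]_m -> C) (j : 'I_m) (z : 'rV[C]_m) :
  (\forall w \near z, f w = g w) -> dz j f z = dz j g z.
Proof. by move=> fg; rewrite /dz !(real_deriv_near _ fg). Qed.

(** Differentiability of psi along real lines is not assumed: it comes from psi = ln (exp psi) and
    the differentiability of h. As h is real on the diagonal, its derivative there has no imaginary
    part. *)
Lemma real_deriv_log m (U : set 'rV[C]_m) (psi : 'rV[C]_m -> R) (h : 'rV[C]_(m + m) -> C)
    (z v : 'rV[C]_m) :
  open U -> U z -> (forall w, U w -> h (diag_pt w) = (expR (psi w))%:C) ->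
  differentiable h (diag_pt z) ->
  real_deriv (fun w => (psi w)%:C) v z = 'd h (diag_pt z) (row_mx v (conj_vec v)) / h (diag_pt z).
Proof.
move=> oU Uz hU dh; set u := row_mx _ _.
have dh' : differentiable h (diag_pt z + (0 : C) *: u) by rewrite scale0r addr0.
have hl := cder_line dh'; rewrite scale0r addr0 in hl.
set D := 'd h (diag_pt z) u in hl *.
have [dl lE] := hl.
have dl' : derivable (fun w : C => h (diag_pt z + w *: u)) (0 + (0 : R)%:C * 1) 1.
  by rewrite mul0r addr0; exact: dl.
have [h1 h2] := cderR_line dl'.
have E : 'D_1 (fun w : C => h (diag_pt z + w *: u)) (0 + (0 : R)%:C * 1) = D by rewrite mul0r addr0.
rewrite E mul1r in h1 h2.
have [e e0 he] := iffLR (open_nrP U) oU z Uz.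
have v1 : 0 < nr v + 1 by have := nr_ge0 v; lra.
have N : \forall t \near (0 : R), h (diag_pt z + (0 + t%:C * 1) *: u) = (expR (psi (z + t%:C *: v)))%:C.
  apply/nbhs_normP; exists (e / (nr v + 1)) => /=; first exact: divr_gt0.
  move=> t /=; rewrite sub0r normrN => te.
  rewrite add0r mulr1 -pd_line; apply: hU; apply: he.
  rewrite addrC addKr nrZ nrC; apply: le_lt_trans (_ : `|t| * (nr v + 1) < _).
    by rewrite ler_wpM2l //; lra.
  by rewrite -ltr_pdivlMr.
have k1 : is_derive (0 : R) 1 (fun t : R => expR (psi (z + t%:C *: v))) (Re D).
  by apply: (near_eq_is_derive _ h1); apply: filterS N => t /= ->.
have k2 : is_derive (0 : R) 1 (fun t : R => 0 : R) (Im D).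
  by apply: (near_eq_is_derive _ h2); apply: filterS N => t /= ->.
have ID : Im D = 0.
  have k3 : is_derive (0 : R) 1 (fun t : R => 0 : R) (0 : R) by exact: is_derive_cst.
  by rewrite -(is_deriveE k2) (is_deriveE k3).
have z0 : z + (0 : R)%:C *: v = z by rewrite scale0r addr0.
have p0 : 0 < expR (psi (z + (0 : R)%:C *: v)) by exact: expR_gt0.
have k4 := @is_derive1_comp _ (@ln R) (fun t => expR (psi (z + t%:C *: v))) 0 _ _ (is_derive1_ln p0) k1.
have k5 : is_derive (0 : R) 1 (fun t : R => psi (z + t%:C *: v)) ((expR (psi (z + (0 : R)%:C *: v)))^-1 * Re D).
  suff <- : @ln R \o (fun t : R => expR (psi (z + t%:C *: v))) = (fun t : R => psi (z + t%:C *: v)) by [].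
  by apply/funext => t /=; rewrite expRK.
rewrite /real_deriv !derive1E /= (is_deriveE k5) z0.
have k3 : is_derive (0 : R) 1 (fun t : R => 0 : R) (0 : R) by exact: is_derive_cst.
rewrite (is_deriveE k3) hU //.
have -> : D = (Re D)%:C by rewrite {1}(complex_split D) ID mulr0 addr0.
by rewrite -[LHS]/(((expR (psi z))^-1 * Re D)%:C) rmorphM fmorphV mulrC.
Qed.

(* d log h / d w_k, without a branch of the logarithm. *)
Definition logd m (h : 'rV[C]_(m + m) -> C) (k : 'I_m) : 'rV[C]_(m + m) -> C :=
  fun P => 'd h P (row_mx 0 (delta_mx 0 k)) / h P.

Lemma logd_differentiable m (W : set 'rV[C]_(m + m)) h k P :
  open W -> (forall Q, W Q -> differentiable h Q) -> W P -> h P != 0 ->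
  differentiable (logd h k) P.
Proof.
move=> oW dh WP hP.
have d1 := differentiable_diff (row_mx 0 (delta_mx 0 k)) oW dh WP.
have [d2 _] := diffc_V (dh P WP) hP.
exact: (diffc_M d1 d2).1.
Qed.

(** Near z the first derivative of psi is the restriction to the diagonal of [logd h k], again
    holomorphic where h does not vanish, so [dz_pol] yields the second one. *)
Lemma ddbar_log m (U : set 'rV[C]_m) (W : set 'rV[C]_(m + m)) (psi : 'rV[C]_m -> R)
    (h : 'rV[C]_(m + m) -> C) (z : 'rV[C]_m) :
  open U -> U z -> open W -> (forall Q, W Q -> differentiable h Q) ->
  (forall w, U w -> W (diag_pt w) /\ h (diag_pt w) = (expR (psi w))%:C) ->
  ddbar psi z = \matrix_(j, k) 'd (logd h k) (diag_pt z) (row_mx (delta_mx 0 j) 0).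
Proof.
move=> oU Uz oW dh hU; apply/matrixP => j k; rewrite !mxE.
have h0 w : U w -> h (diag_pt w) != 0.
  by move=> /hU [_ ->]; rewrite -nr_gt0 nrC normr_gt0 lt0r_neq0 ?expR_gt0.
have [Wz _] := hU z Uz.
have [e e0 he] := iffLR (open_nrP U) oU z Uz.
have N : \forall w \near z, dzbar k (fun w => (psi w)%:C) w = logd h k (diag_pt w).
  apply/nbhs_nrP; exists e => // w /he Uw.
  have dw := dh _ (hU w Uw).1.
  pose L0 (x : 'rV[C]_(m + m)) : C := (h (diag_pt w))^-1 * 'd h (diag_pt w) x.
  have Llin : linear L0 by move=> a x y; rewrite /L0 linearP mulrDr mulrCA.
  pose L : {linear 'rV[C]_(m + m) -> C} := HB.pack L0 (GRing.isLinear.Build _ _ _ _ _ Llin).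
  have [_ ->] := @dz_of m (fun w => (psi w)%:C) w k L
     (fun v => etrans (real_deriv_log v oU Uw (fun x hx => (hU x hx).2) dw) (mulrC _ _)).
  by rewrite /logd /= /L0 mulrC.
rewrite (dz_near j N).
exact: (dz_pol j (logd_differentiable k oW dh Wz (h0 z Uz))).1.
Qed.

Lemma flat_ddbar n (z : 'rV[C]_n) :
  ddbar (fun w : 'rV[C]_n => \sum_i (Re (w 0 i) ^+ 2 + Im (w 0 i) ^+ 2)) z = 1%:M.
Proof.
apply/matrixP => j k; rewrite !mxE.
(* The polarization of the sum of the |z_i| ^ 2. *)
pose K (P : 'rV[C]_(n + n)) : C := \sum_i P 0 (lshift n i) * P 0 (rshift n i).
have KE : (fun w : 'rV[C]_n => (\sum_i (Re (w 0 i) ^+ 2 + Im (w 0 i) ^+ 2))%:C) = (fun w => K (diag_pt w)).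
  apply/funext => w; rewrite /K rmorph_sum; apply: eq_bigr => i _.
  rewrite row_mxEl row_mxEr mxE; case: (w 0 i) => a b /=.
  by apply/eqP; rewrite eq_complex /=; apply/andP; split; apply/eqP; ring.
have dK P : differentiable K P /\ forall v, 'd K P v =
   \sum_i (P 0 (lshift n i) * v 0 (rshift n i) + P 0 (rshift n i) * v 0 (lshift n i)).
  have di i := diffc_M (diff_coord P (lshift n i)).1 (diff_coord P (rshift n i)).1.
  have [d E] := diffc_sum (fun i => (di i).1).
  split => // v; apply: etrans (E v) _; apply: eq_bigr => i _.
  apply: etrans ((di i).2 v) _.
  have e1 := (diff_coord P (lshift n i)).2 v; have e2 := (diff_coord P (rshift n i)).2 v.
  exact: (f_equal2 (fun a b : C => P 0 (lshift n i) * a + P 0 (rshift n i) * b) e2 e1).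
rewrite KE.
have N : dzbar k (fun w => K (diag_pt w)) = (fun w => (fun P : 'rV[C]_(n + n) => P 0 (lshift n k) : C) (diag_pt w)).
  apply/funext => w; have [dKw E] := dK (diag_pt w).
  rewrite (dz_pol k dKw).2 E (bigD1 k) //= big1 => [|i ik].
    by rewrite !row_mxEl !row_mxEr !mxE !eqxx mulr0 mulr1 !addr0.
  by rewrite !row_mxEl !row_mxEr !mxE eqxx (negbTE ik) !mulr0 addr0.
rewrite N (dz_pol j (diff_coord (diag_pt z) (lshift n k)).1).1.
by rewrite (diff_coord (diag_pt z) (lshift n k)).2 row_mxEl !mxE eqxx /= eq_sym.
Qed.

End Wirtinger.

(** * Uniqueness of polarization; conjugate curves *)

Section Polarize.
Context {R : realType}.
Notation C := (Cplx R).

Lemma cder_line_at (V : normedModType C) (f : V -> C) (y u : V) (z : C) :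
  differentiable f (y + z *: u) -> derivable (fun z : C => f (y + z *: u)) z 1.
Proof. by move=> /cder_line []. Qed.

Lemma const_ball (f : C -> C) (a : C) (r : R) :
  (forall z, nr (z - a) < r -> is_derive z 1 f 0) ->
  forall z, nr (z - a) < r -> f z = f a.
Proof.
move=> df z zr.
pose u := z - a.
have hl (t : R) : 0 <= t <= 1 -> cderR (fun t : R => f (a + t%:C * u)) t 0.
  move=> /andP[t0 t1].
  have tr : nr (a + t%:C * u - a) < r.
    rewrite addrC addKr nrM nrC ger0_norm //; apply: le_lt_trans zr.
    by rewrite ler_piMl ?nr_ge0.
  have [d1 E] := df _ tr.
  by have := cderR_line d1; rewrite E mulr0.
have key (g : R -> R) : (forall t : R, 0 <= t <= 1 -> is_derive t 1 g 0) -> g 1 = g 0.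
  move=> dg; have [||c _] := @MVT_segment _ g (fun=> 0) 0 1 ler01.
  - by move=> x; rewrite in_itv /= => /andP[ax xb]; apply: dg; rewrite !ltW.
  - apply: derivable_within_continuous => x; rewrite in_itv /= => axb.
    by have := dg x axb => -[].
  - by rewrite mul0r => /eqP; rewrite subr_eq0 => /eqP.
have kR := key (Re \o (fun t : R => f (a + t%:C * u))) (fun t ht => (hl t ht).1).
have kI := key (Im \o (fun t : R => f (a + t%:C * u))) (fun t ht => (hl t ht).2).
have e1 : a + (1 : R)%:C * u = z by rewrite mul1r /u addrC subrK.
have e0 : a + (0 : R)%:C * u = a by rewrite mul0r addr0.
move: kR kI; rewrite /= e1 e0; case: (f z) (f a) => ? ? [? ?] /= -> -> //.
Qed.

(** [identity_real] is applied to one parameter after the other: the first becomes complex while the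
    second is still real, then the second follows. *)
Lemma polarization_zero (V : normedModType C) (K : V -> C) (p0 u1 u2 : V) (d : R) :
  0 < d -> (forall p, nr (p - p0) < d -> differentiable K p) ->
  (forall a b : R, `|a| < d -> `|b| < d -> K (p0 + a%:C *: u1 + b%:C *: u2) = 0) ->
  exists2 eta : R, 0 < eta & forall x y : C, nr x < eta -> nr y < eta ->
    K (p0 + x *: u1 + y *: u2) = 0.
Proof.
move=> d0 dK K0.
have cK : {for p0, continuous K}.
  by apply: differentiable_continuous; apply: dK; rewrite subrr nr0.
have [d1 d10 h1] := iffLR (continuous_nrP _ _) cK 1 ltr01.
pose rho := Num.min d d1.
have rho0 : 0 < rho by rewrite lt_min d0 d10.
have hK p : nr (p - p0) < rho -> differentiable K p /\ nr (K p) <= nr (K p0) + 1.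
  rewrite lt_min => /andP[diag_pt' pd1]; split; first exact: dK.
  by have := h1 p pd1; have := nrD (K p - K p0) (K p0); rewrite subrK; lra.
pose N := nr u1 + nr u2 + 1.
have N0 : 0 < N by rewrite /N; have := nr_ge0 u1; have := nr_ge0 u2; lra.
pose r := Num.min (rho / (2 * N)) (d / 2).
have r0 : 0 < r by rewrite lt_min !divr_gt0 // mulr_gt0.
have rd : r <= d / 2 by rewrite /r ge_min lexx orbT.
have rN : r * N <= rho / 2.
  rewrite -ler_pdivlMr // /r ge_min; apply/orP; left.
  by rewrite le_eqVlt; apply/orP; left; apply/eqP; field; rewrite lt0r_neq0.
have inb (x y : C) : nr x <= r -> nr y <= r -> nr (p0 + x *: u1 + y *: u2 - p0) < rho.
  move=> xr yr; rewrite -[p0 + _ + _]addrA [p0 + _]addrC addrK.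
  have := nrD (x *: u1) (y *: u2); rewrite !nrZ => h.
  have h2 : nr x * nr u1 <= r * nr u1 by rewrite ler_wpM2r ?nr_ge0.
  have h3 : nr y * nr u2 <= r * nr u2 by rewrite ler_wpM2r ?nr_ge0.
  have : r * nr u1 + r * nr u2 + r <= rho / 2 by move: rN; rewrite /N; lra.
  by lra.
have step1 (b : R) (x : C) : `|b| < r -> nr x <= r / 8 -> K (p0 + x *: u1 + b%:C *: u2) = 0.
  move=> br; pose f (x : C) := K (p0 + b%:C *: u2 + x *: u1).
  have E (x' : C) : p0 + b%:C *: u2 + x' *: u1 = p0 + x' *: u1 + b%:C *: u2 by rewrite addrAC.
  have inb' (x' : C) : nr (x' - 0) <= r -> nr (p0 + b%:C *: u2 + x' *: u1 - p0) < rho.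
    by rewrite subr0 E => x'r; apply: inb => //; rewrite nrC ltW.
  have := @identity_real R f 0 r (nr (K p0) + 1) r r0.
  move=> /(_ _ _ r0 _ x); rewrite subr0 /f E; apply.
  - by move=> w /inb' /hK [dw _]; exact: cder_line_at.
  - by move=> w /inb' /hK [].
  - move=> t tr; rewrite add0r E; apply: K0; first by apply: lt_le_trans tr _; lra.
    by apply: lt_le_trans br _; lra.
exists (r / 8); first by lra.
move=> x y xr yr; pose f (y : C) := K (p0 + x *: u1 + y *: u2).
have inb' (y' : C) : nr (y' - 0) <= r -> nr (p0 + x *: u1 + y' *: u2 - p0) < rho.
  by rewrite subr0 => y'r; apply: inb => //; lra.
have := @identity_real R f 0 r (nr (K p0) + 1) r r0.
move=> /(_ _ _ r0 _ y); rewrite subr0 /f; apply; last exact: ltW.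
- by move=> w /inb' /hK [dw _]; exact: cder_line_at.
- by move=> w /inb' /hK [].
- by move=> t tr; rewrite add0r; apply: step1 => //; apply: ltW.
Qed.

Lemma nr_pairE (p : (C * C)%type) : nr p = Num.max (nr p.1) (nr p.2).
Proof.
have -> : nr p = Re (Order.max `|p.1| `|p.2|) by [].
rewrite !nrE /Order.max ltcR; by case: ifP.
Qed.

Lemma conjcKC (x : C) : conjc (conjc x) = x :> C.
Proof. by case: x => a b; rewrite /= opprK. Qed.

Definition conj_reflect (f : C -> C) : C -> C := fun s => conjc (f (conjc s)).

Lemma is_derive_conj_reflect (f : C -> C) (s : C) : derivable f (conjc s : C) 1 ->
  is_derive s 1 (conj_reflect f) (conjc ('D_1 f (conjc s))).
Proof.
move=> df; apply: is_derive_nr => e e0.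
have [d d0 hd] := derivable_nr df e0; exists d => // w ws.
have ws' : nr (conjc w - conjc s : C) < d by rewrite -(rmorphB (@conjc R)) nr_conj.
have E1 : nr (w - s) = nr (conjc w - conjc s : C) by rewrite -(rmorphB (@conjc R)) nr_conj.
have E2 : conj_reflect f w - conj_reflect f s - conjc ('D_1 f (conjc s)) * (w - s) =
   conjc (f (conjc w) - f (conjc s) - 'D_1 f (conjc s) * (conjc w - conjc s)) :> C.
  rewrite (rmorphB (@conjc R)) (rmorphM (@conjc R)) !(rmorphB (@conjc R)).
  by congr (_ - _ * (_ - _)); exact: esym (conjcKC _).
by rewrite E1 E2 nr_conj; exact: hd.
Qed.

Definition D1 m (l : C -> 'rV[C]_m) (t : C) : 'rV[C]_m := \row_j 'D_1 (fun t => l t 0 j : C) t.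

Definition curve_at m (l : C -> 'rV[C]_m) (t : C) := forall j, derivable (fun t => l t 0 j : C) t 1.

(** The conjugate curve: holomorphic in s, with the value conj (l t) at s = conj t. *)
Definition cbar m (l : C -> 'rV[C]_m) (s : C) : 'rV[C]_m := conj_vec (l (conjc s)).

Lemma cbar_derive m (l : C -> 'rV[C]_m) (s : C) j : curve_at l (conjc s) ->
  is_derive s 1 (fun s => cbar l s 0 j : C) (conjc (D1 l (conjc s) 0 j)).
Proof.
move=> dl; have -> : (fun s => cbar l s 0 j : C) = conj_reflect (fun t => l t 0 j : C).
  by apply/funext => w; rewrite /cbar /conj_reflect mxE.
by rewrite mxE; exact: is_derive_conj_reflect.
Qed.

Lemma cbar_curve m (l : C -> 'rV[C]_m) (s : C) : curve_at l (conjc s) -> curve_at (cbar l) s.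
Proof. by move=> dl j; case: (cbar_derive j dl). Qed.

Lemma D1_cbar m (l : C -> 'rV[C]_m) (s : C) : curve_at l (conjc s) ->
  D1 (cbar l) s = conj_vec (D1 l (conjc s)).
Proof. by move=> dl; apply/rowP => j; rewrite !mxE; case: (cbar_derive j dl) => _ ->; rewrite mxE. Qed.

Lemma open_nball (V : normedModType C) (a : V) (r : R) : open [set t | nr (t - a) < r].
Proof.
apply/open_nrP => x /= xr; exists (r - nr (x - a)); first by lra.
by move=> y yx; have := nrD (y - x) (x - a); rewrite addrA subrK; lra.
Qed.

Lemma derivable_D1 m (l : C -> 'rV[C]_m) (a : C) (r : R) j :
  (forall t, nr (t - a) < r -> curve_at l t) -> forall t, nr (t - a) < r ->
  derivable (fun t => D1 l t 0 j : C) t 1.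
Proof.
move=> dl t tr.
have oB := open_nball a r.
have dd : forall x, [set t | nr (t - a) < r] x -> differentiable (fun t => l t 0 j : C) x.
  by move=> x /= /dl /(_ j) /derivable1_diffP.
have h := differentiable_diff (1 : C) oB dd tr.
have [h2 _] : differentiable (fun t => D1 l t 0 j : C) t /\ forall v, 'd (fun t => D1 l t 0 j : C) t v = 'd (fun x => 'd (fun t => l t 0 j : C) x 1) t v.
  apply: (diffc_near _ h); apply/nbhs_nrP; exists (r - nr (t - a)); first by lra.
  move=> y yt; rewrite mxE (diff_D1 1) ?mulr1 //; apply: dl.
  by have := nrD (y - t) (t - a); rewrite addrA subrK; lra.
by apply/derivable1_diffP.
Qed.

End Polarize.

(** * The surface (l t, cbar l s) in the doubled space *)

Section JointCurve.
Context {R : realType}.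
Notation C := (Cplx R).

Definition dotp n (x y : 'rV[C]_n) : C := \sum_i x 0 i * y 0 i.

Definition joint m (l : C -> 'rV[C]_m) (p : (C * C)%type) : 'rV[C]_(m + m) :=
  row_mx (l p.1) (cbar l p.2).

Lemma diff_joint m (l : C -> 'rV[C]_m) (p : (C * C)%type) :
  curve_at l p.1 -> curve_at l (conjc p.2) ->
  differentiable (joint l) p /\ forall v,
    'd (joint l) p v = row_mx (v.1 *: D1 l p.1) (v.2 *: D1 (cbar l) p.2).
Proof.
move=> d1 d2; have d2' := cbar_curve d2.
have [df Ef] := differentiable_fst p; have [ds Es] := differentiable_snd p.
have key i : differentiable (fun y => joint l y 0 i : C) p /\
    forall v, 'd (fun y => joint l y 0 i : C) p v =
      row_mx (v.1 *: D1 l p.1) (v.2 *: D1 (cbar l) p.2) 0 i.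
  case: (split_ordP i) => j ->.
    have -> : (fun y => joint l y 0 (lshift m j) : C) = (fun y : (C * C)%type => l y.1 0 j : C).
      by apply/funext => y; rewrite /joint row_mxEl.
    have [dd E] := @cdiff_comp1 R _ (fun t => l t 0 j : C) _ p df (d1 j).
    split; first exact: dd.
  move=> v; apply: etrans (E v) _.
    apply: etrans (congr1 (fun z => 'D_1 (fun t => l t 0 j : C) p.1 * z) (Ef v)) _.
    by rewrite row_mxEl !mxE mulrC.
  have -> : (fun y => joint l y 0 (rshift m j) : C) = (fun y : (C * C)%type => cbar l y.2 0 j : C).
    by apply/funext => y; rewrite /joint row_mxEr.
  have [dd E] := @cdiff_comp1 R _ (fun t => cbar l t 0 j : C) _ p ds (d2' j).
  split; first exact: dd.
  move=> v; apply: etrans (E v) _.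
  apply: etrans (congr1 (fun z => 'D_1 (fun t => cbar l t 0 j : C) p.2 * z) (Es v)) _.
  by rewrite row_mxEr !mxE mulrC.
have [dG E] := diff_rV (fun i => (key i).1).
split; first exact: dG.
move=> v; apply/rowP => i; apply: etrans (E v i) _; exact: (key i).2.
Qed.

Lemma row_mx_sum_r m (L : {linear 'rV[C]_(m + m) -> C}) (v : 'rV[C]_m) :
  L (row_mx 0 v) = \sum_k v 0 k * L (row_mx 0 (delta_mx 0 k)).
Proof.
rewrite {1}[v]row_sum_delta.
have -> : row_mx 0 (\sum_k v 0 k *: delta_mx 0 k) =
   \sum_k v 0 k *: row_mx 0 (delta_mx 0 k) :> 'rV[C]_(m + m).
  apply/rowP => i; rewrite summxE.
  case: (split_ordP i) => j ->; rewrite ?row_mxEl ?row_mxEr.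
    by rewrite mxE big1 // => k _; rewrite mxE row_mxEl mxE mulr0.
  by rewrite summxE; apply: eq_bigr => k _; rewrite [RHS]mxE row_mxEr [LHS]mxE.
by rewrite linear_sum; apply: eq_bigr => k _; rewrite linZ mulrC.
Qed.

Lemma row_mx_sum_l m (L : {linear 'rV[C]_(m + m) -> C}) (v : 'rV[C]_m) :
  L (row_mx v 0) = \sum_k v 0 k * L (row_mx (delta_mx 0 k) 0).
Proof.
rewrite {1}[v]row_sum_delta.
have -> : row_mx (\sum_k v 0 k *: delta_mx 0 k) 0 =
   \sum_k v 0 k *: row_mx (delta_mx 0 k) 0 :> 'rV[C]_(m + m).
  apply/rowP => i; rewrite summxE.
  case: (split_ordP i) => j ->; rewrite ?row_mxEl ?row_mxEr.
    by rewrite summxE; apply: eq_bigr => k _; rewrite [RHS]mxE row_mxEl [LHS]mxE.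
  by rewrite mxE big1 // => k _; rewrite mxE row_mxEr mxE mulr0.
by rewrite linear_sum; apply: eq_bigr => k _; rewrite linZ mulrC.
Qed.

Lemma nr_pair_lt (p : (C * C)%type) (d : R) : nr p < d <-> nr p.1 < d /\ nr p.2 < d.
Proof. by rewrite nr_pairE gt_max; split => /andP. Qed.

End JointCurve.

(** * The differential equation of the quotients *)

Section PolarizedIdentity.
Context {R : realType}.
Notation C := (Cplx R).
Notation ci := (Ci R).

Lemma nr_ci : nr (ci : C) = 1. Proof. exact: nr_i. Qed.

(* The quotient is exp ((F tau - F t0) . (cbar F s - cbar F s0)) up to a factor that
   does not depend on s; its differential equation is all that is needed. *)
Lemma polarized_ode m n (U : set 'rV[C]_m) (W : set 'rV[C]_(m + m)) (psi : 'rV[C]_m -> R)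
    (h : 'rV[C]_(m + m) -> C) (l : C -> 'rV[C]_m) (F : C -> 'rV[C]_n) (t0 : C) (e : R) :
  open U -> open W -> (forall Q, W Q -> differentiable h Q) ->
  (forall w, U w -> W (diag_pt w) /\ h (diag_pt w) = (expR (psi w))%:C) -> 0 < e ->
  (forall t, nr (t - t0) < e -> [/\ U (l t), curve_at l t, curve_at F t &
     dotp (D1 F t) (conj_vec (D1 F t)) =
     \sum_j \sum_k D1 l t 0 j * ddbar psi (l t) j k * conjc (D1 l t 0 k)]) ->
  exists2 d : R, 0 < d <= e & forall tau s : C, nr (tau - t0) < d -> nr (s - conjc t0 : C) < d ->
    [/\ W (row_mx (l tau) (cbar l s)), h (row_mx (l tau) (cbar l s)) != 0 &
      is_derive s 1 (fun s => h (row_mx (l tau) (cbar l s)) / h (row_mx (l t0) (cbar l s)))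
        (dotp (F tau - F t0) (D1 (cbar F) s) *
          (h (row_mx (l tau) (cbar l s)) / h (row_mx (l t0) (cbar l s))))].
Proof.
move=> oU oW dh hU e0 hl.
set s0 : C := conjc t0.
have cs (s : C) : nr (s - s0) < e -> nr (conjc s - t0 : C) < e.
  rewrite -(nr_conj (s - s0)) (rmorphB (@conjc R)).
  have -> : (conjc s - t0 : C) = (conjc s - conjc s0 : C) by rewrite /s0 conjcKC.
  by [].
pose G := joint l.
have dG p : nr (p.1 - t0) < e -> nr (p.2 - s0) < e -> differentiable G p /\
    forall v, 'd G p v = row_mx (v.1 *: D1 l p.1) (v.2 *: D1 (cbar l) p.2).
  move=> h1 /cs h2; have [_ c1 _ _] := hl _ h1; have [_ c2 _ _] := hl _ h2.
  exact: diff_joint c1 c2.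
pose p0 : C * C := (t0, s0).
have z1 : nr (p0.1 - t0) < e by rewrite subrr nr0.
have z2 : nr (p0.2 - s0) < e by rewrite subrr nr0.
have Gp0 : G p0 = diag_pt (l t0) by rewrite /G /joint /cbar /= /s0 conjcKC.
have [Ul0 _ _ _] := hl _ z1.
have [W0 h0] := hU _ Ul0.
have hn0 : h (G p0) != 0 by rewrite Gp0 h0 -nr_gt0 nrC normr_gt0 lt0r_neq0 ?expR_gt0.
have [d1 /andP[d10 d1e] hd1] : exists2 d1 : R, 0 < d1 <= e & forall p, nr (p - p0) < d1 ->
    W (G p) /\ h (G p) != 0.
  have WG : W (G p0) by rewrite Gp0.
  have [r1 r10 hr1] := iffLR (open_nrP _) oW _ WG.
  have nh : 0 < nr (h (G p0)) by rewrite nr_gt0.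
  have [r2 r20 hr2] := iffLR (continuous_nrP _ _) (differentiable_continuous (dh _ WG)) _ nh.
  have mr : 0 < Num.min r1 r2 by rewrite lt_min r10 r20.
  have [r3 r30 hr3] := iffLR (continuous_nrP _ _) (differentiable_continuous (dG _ z1 z2).1) _ mr.
  exists (Num.min e r3); first by rewrite lt_min e0 r30 ge_min lexx.
  move=> p; rewrite lt_min => /andP[_ /hr3]; rewrite lt_min => /andP[/hr1 ? /hr2 hp].
  split => //; apply: contraTneq hp => ->.
  by rewrite sub0r nrN -leNgt.
have inB p : nr (p - p0) < d1 -> nr (p.1 - t0) < e /\ nr (p.2 - s0) < e.
  by move=> /nr_pair_lt [q1 q2]; split; [apply: lt_le_trans q1 _|apply: lt_le_trans q2 _].
have dcl : forall s, nr (s - s0) < e -> curve_at (cbar l) s.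
  by move=> s /cs h2; have [_ c _ _] := hl _ h2; exact: cbar_curve.
have dcF : forall s, nr (s - s0) < e -> curve_at (cbar F) s.
  by move=> s /cs h2; have [_ _ c _] := hl _ h2; exact: cbar_curve.
(* The logarithmic derivative of h (l t, cbar l s) in s. *)
pose N : (C * C)%type -> C := fun p => \sum_k D1 (cbar l) p.2 0 k * logd h k (G p).
have dN p : nr (p - p0) < d1 -> differentiable N p /\ forall x : C,
    'd N p (x, 0) = \sum_k D1 (cbar l) p.2 0 k * 'd (logd h k) (G p) (row_mx (x *: D1 l p.1) 0).
  move=> hp; have [q1 q2] := inB p hp; have [WG hG] := hd1 p hp.
  have [dGp EG] := dG p q1 q2.
  have [ds Es] := differentiable_snd p.
  have k1 k := cdiff_comp1 ds (@derivable_D1 R m (cbar l) s0 e k dcl p.2 q2).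
  have k2 k := diff_comp_app dGp (logd_differentiable k oW dh WG hG).
  have k3 k := diffc_M (k1 k).1 (k2 k).1.
  have [dNp EN] := diffc_sum (fun k => (k3 k).1).
  split; first exact: dNp.
  move=> x; apply: etrans (EN (x, 0)) _; apply: eq_bigr => k _.
  apply: etrans ((k3 k).2 (x, 0)) _.
  have e1 : 'd (fun y : C * C => D1 (cbar l) y.2 0 k : C) p (x, 0) = 0.
    by apply: etrans ((k1 k).2 (x, 0)) _; rewrite Es mulr0.
  have e2 : 'd (fun y => logd h k (G y)) p (x, 0) = 'd (logd h k) (G p) (row_mx (x *: D1 l p.1) 0).
    by apply: etrans ((k2 k).2 (x, 0)) _; rewrite EG scale0r.
  apply: etrans (f_equal2 (fun a b : C => D1 (cbar l) p.2 0 k * a + logd h k (G p) * b) e2 e1) _.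
  by rewrite mulr0 addr0.
(* The defect of the polarized metric identity; at s = conj t it vanishes by the given one. *)
pose K : (C * C)%type -> C := fun p => 'd N p (1, 0) - dotp (D1 F p.1) (D1 (cbar F) p.2).
have oB := open_nball p0 d1.
have dK p : nr (p - p0) < d1 -> differentiable K p.
  move=> hp; have [q1 q2] := inB p hp.
  have a1 := differentiable_diff ((1, 0) : C * C) oB (fun x hx => (dN x hx).1) hp.
  have [df _] := differentiable_fst p; have [ds _] := differentiable_snd p.
  have dF t : nr (t - t0) < e -> curve_at F t by move=> /hl [].
  have k1 i := cdiff_comp1 df (@derivable_D1 R n F t0 e i dF p.1 q1).
  have k2 i := cdiff_comp1 ds (@derivable_D1 R n (cbar F) s0 e i dcF p.2 q2).
  have k3 i := diffc_M (k1 i).1 (k2 i).1.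
  have [a2 _] := diffc_sum (fun i => (k3 i).1).
  exact: (differentiableB a1 a2).
have Kdiag t : nr (t - t0) < d1 -> K (t, conjc t) = 0.
  move=> ht.
  have hs : nr (conjc t - s0 : C) < d1 by rewrite -(rmorphB (@conjc R)) nr_conj.
  have hp : nr ((t, conjc t : C) - p0) < d1 by apply/nr_pair_lt.
  have hte : nr (t - t0) < e by apply: lt_le_trans ht _.
  have [Ult ct cFt E] := hl t hte.
  have ct' : curve_at l (conjc (conjc t)) by rewrite conjcKC.
  have cFt' : curve_at F (conjc (conjc t)) by rewrite conjcKC.
  rewrite /K ((dN _ hp).2 1) /= (D1_cbar ct') (D1_cbar cFt') conjcKC scale1r E.
  have -> : G (t, conjc t : C) = diag_pt (l t) by rewrite /G /joint /cbar /= conjcKC.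
  rewrite (ddbar_log oU Ult oW dh hU) exchange_big /=.
  apply/eqP; rewrite subr_eq0; apply/eqP; apply: eq_bigr => k _.
  have ek : conj_vec (D1 l t) 0 k = conjc (D1 l t 0 k) by rewrite [LHS]mxE.
  apply: etrans (congr1 (fun z : C => _ * z) (row_mx_sum_l ('d (logd h k) (diag_pt (l t))) (D1 l t))) _.
  rewrite ek mulr_sumr; apply: eq_bigr => j _.
  rewrite [in RHS]mxE; exact: mulrC.
(* The pairs (t, conj t) form the real plane through p0 directed by (1, 1) and (i, -i). These two
   vectors span C^2 over C, so vanishing on the plane spreads to a neighbourhood. *)
have [eta eta0 heta] : exists2 eta : R, 0 < eta & forall x y : C, nr x < eta -> nr y < eta ->
    K (p0 + x *: ((1, 1) : C * C) + y *: ((ci, - ci) : C * C)) = 0.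
  have d12 : 0 < d1 / 2 by lra.
  apply: (polarization_zero d12) => [p hp|a b ha hb]; first by apply: dK; lra.
  have -> : p0 + a%:C *: ((1, 1) : C * C) + b%:C *: ((ci, - ci) : C * C) =
     (t0 + (a%:C + b%:C * ci), conjc (t0 + (a%:C + b%:C * ci))).
    apply: injective_projections => /=.
      by rewrite /GRing.scale /= mulr1 addrA.
    rewrite (rmorphD (@conjc R)) /= -/s0 /GRing.scale /= mulr1 -addrA; congr (_ + _).
    apply/eqP; rewrite eq_complex /=; apply/andP; split; apply/eqP; ring.
  apply: Kdiag; rewrite addrC addKr.
  apply: le_lt_trans (nrD _ _) _; rewrite nrM nr_ci mulr1 !nrC; lra.
pose d := Num.min d1 eta.
have d0 : 0 < d by rewrite lt_min d10 eta0.
have dd1 : d <= d1 by rewrite ge_min lexx.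
have K0 (t s : C) : nr (t - t0) < d -> nr (s - s0) < d -> K (t, s) = 0.
  rewrite !lt_min => /andP[t1 t2] /andP[s1 s2].
  have n2 : (2 : C) != 0 by rewrite pnatr_eq0.
  have i0 : ci != 0 by rewrite -nr_gt0 nr_ci ltr01.
  pose x : C := ((t - t0) + (s - s0)) / 2.
  pose y : C := ((t - t0) - (s - s0)) / (2 * ci).
  have two : nr (2 : C) = 2 by have := nrC (2 : R); rewrite ger0_norm // => <-; rewrite rmorph_nat.
  have -> : (t, s) = p0 + x *: ((1, 1) : C * C) + y *: ((ci, - ci) : C * C).
    have E1 : t = t0 + x * 1 + y * ci.
      by rewrite /x /y; move: (ci) i0 => c c0; field; rewrite c0.
    have E2 : s = s0 + x * 1 + y * - ci.
      by rewrite /x /y; move: (ci) i0 (s0) => c c0 ?; field; rewrite c0.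
    by apply: injective_projections; [exact: E1|exact: E2].
  apply: heta.
    rewrite /x nrM nrV two ltr_pdivrMr //; apply: le_lt_trans (nrD _ _) _; lra.
  rewrite /y nrM nrV nrM two nr_ci mulr1 ltr_pdivrMr //; apply: le_lt_trans (nrD _ _) _.
  by rewrite nrN; lra.
have hB (t s : C) : nr (t - t0) < d -> nr (s - s0) < d -> nr (((t, s) : C * C) - p0) < d1.
  by move=> h1 h2; apply/nr_pair_lt; split; [apply: lt_le_trans h1 _|apply: lt_le_trans h2 _].
(* The identity K = 0 is integrated in t from t0 to tau, with s fixed. *)
have Nid (tau s : C) : nr (tau - t0) < d -> nr (s - s0) < d ->
    N (tau, s) - N (t0, s) = dotp (F tau - F t0) (D1 (cbar F) s).
  move=> ht hs.
  have t00 : nr (t0 - t0) < d by rewrite subrr nr0.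
  pose phi (z : C) := N (z, s) - \sum_i F z 0 i * D1 (cbar F) s 0 i.
  have E : phi tau = phi t0.
    apply: (@const_ball R phi t0 d _ tau ht) => z zd.
    have e1 : is_derive z 1 (fun z : C => N (z, s)) ('d N (z, s) (1, 0)).
      have eqp (w : C) : ((0, s) : C * C) + w *: ((1, 0) : C * C) = (w, s).
        by apply: injective_projections; rewrite /= /GRing.scale /= ?mulr1 ?mulr0 ?addr0 ?add0r.
      have dNz : differentiable N (((0, s) : C * C) + z *: ((1, 0) : C * C)).
        by rewrite eqp; exact: (dN _ (hB z s zd hs)).1.
      have := cder_line dNz; rewrite eqp.
      have -> : (fun z0 : C => N (((0, s) : C * C) + z0 *: ((1, 0) : C * C))) = (fun z => N (z, s)).
        by apply/funext => w; rewrite eqp.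
      by [].
    have ze : nr (z - t0) < e by apply: lt_le_trans zd _; lra.
    have [_ _ cFz _] := hl z ze.
    have e2 : is_derive z 1 (fun z : C => \sum_i F z 0 i * D1 (cbar F) s 0 i)
       (dotp (D1 F z) (D1 (cbar F) s)).
      have dF i : is_derive z 1 (fun t => F t 0 i : C) (D1 F z 0 i).
        by rewrite [D1 F z 0 i]mxE; exact: derivableP (cFz i).
      have di i := cderM (dF i) (cder_cst (D1 (cbar F) s 0 i) z).
      have := @is_derive_sum _ C C n (fun i z => F z 0 i * D1 (cbar F) s 0 i) z 1 _ di.
      have -> : \sum_(i < n) (fun z : C => F z 0 i * D1 (cbar F) s 0 i) =
          (fun z : C => \sum_i F z 0 i * D1 (cbar F) s 0 i).
        by apply/funext => w; rewrite fct_sumE.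
      move=> hh; apply: (is_derive_eq hh); apply: eq_bigr => i _.
      have aux (a b c : C) : a * b + c * 0 = a * b by rewrite mulr0 addr0.
      exact: aux.
    apply: (is_derive_eq (cderB e1 e2)).
    exact: (K0 z s zd hs).
  have -> : dotp (F tau - F t0) (D1 (cbar F) s) =
     \sum_i F tau 0 i * D1 (cbar F) s 0 i - \sum_i F t0 0 i * D1 (cbar F) s 0 i.
    by rewrite /dotp -sumrB; apply: eq_bigr => i _; rewrite !mxE mulrBl.
  move: E; rewrite /phi => /eqP; rewrite subr_eq => /eqP ->.
  by ring.
exists d; first by rewrite d0 (le_trans dd1).
move=> tau s ht hs.
have Ader (t : C) : nr (t - t0) < d ->
    is_derive s 1 (fun s => h (row_mx (l t) (cbar l s))) (N (t, s) * h (row_mx (l t) (cbar l s))).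
  move=> htt; have hp := hB t s htt hs; have [q1 q2] := inB _ hp; have [WG hG] := hd1 _ hp.
  have [dGp EG] := dG (t, s) q1 q2.
  have [dA EA] := diff_comp_app dGp (dh _ WG).
  have eqp (w : C) : ((t, 0) : C * C) + w *: ((0, 1) : C * C) = (t, w).
    by apply: injective_projections; rewrite /= /GRing.scale /= ?mulr1 ?mulr0 ?addr0 ?add0r.
  have dA' : differentiable (fun y => h (G y)) (((t, 0) : C * C) + s *: ((0, 1) : C * C)).
    by rewrite eqp.
  have := cder_line dA'; rewrite eqp.
  have -> : (fun z0 : C => h (G (((t, 0) : C * C) + z0 *: ((0, 1) : C * C)))) =
     (fun s => h (row_mx (l t) (cbar l s))).
    by apply/funext => w; rewrite eqp.
  move=> hh; apply: (is_derive_eq hh).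
  apply: etrans (EA (0, 1)) _; rewrite EG /= scale0r scale1r.
  rewrite (row_mx_sum_r ('d h (G (t, s)))) /N mulr_suml; apply: eq_bigr => k _.
  by rewrite /logd -mulrA; congr (_ * _); rewrite divfK.
have t00 : nr (t0 - t0) < d by rewrite subrr nr0.
have [W1 h1] := hd1 _ (hB tau s ht hs); have [W2 h2] := hd1 _ (hB t0 s t00 hs).
split; [exact: W1|exact: h1|].
apply: (is_derive_eq (cderM (Ader tau ht) (cderV h2 (Ader t0 t00)))).
rewrite -(Nid tau s ht hs).
rewrite /G /joint /= in h2.
by field.
Qed.

End PolarizedIdentity.

(** * Algebraic dependence *)

Section PolyFun.
Context {K : fieldType}.

(** The degree is bounded in each [lam j] separately, so that all such f lie in the span of the same
    (D + 1) ^ #|J| monomials. *)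
Definition polyfun (J : finType) (X : Type) (lam : J -> X -> K) (D : nat) (f : X -> K) : Prop :=
  exists k : {ffun J -> 'I_D.+1} -> K, forall x, f x = \sum_a k a * \prod_j lam j x ^+ a j.

Section Closure.
Context {J : finType} {X : Type} {lam : J -> X -> K}.
Implicit Types (D : nat) (f g : X -> K).

Lemma polyfun_monomial D (e : J -> nat) (c : K) : (forall j, (e j <= D)%N) ->
  polyfun lam D (fun x => c * \prod_j lam j x ^+ e j).
Proof.
move=> eD; exists (fun a => if a == [ffun j => inord (e j)] then c else 0) => x.
rewrite (bigD1 [ffun j => inord (e j)]) //= eqxx.
rewrite [X in _ + X]big1 ?addr0; last by move=> a /negbTE ->; rewrite mul0r.
by congr (_ * _); apply: eq_bigr => j _; rewrite ffunE inordK // ltnS.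
Qed.

Lemma polyfun_ext D f g : f =1 g -> polyfun lam D f -> polyfun lam D g.
Proof. by move=> /funext ->. Qed.

Lemma polyfun_add D f g : polyfun lam D f -> polyfun lam D g -> polyfun lam D (fun x => f x + g x).
Proof.
move=> [k hk] [k' hk']; exists (fun a => k a + k' a) => x.
by rewrite hk hk' -big_split; apply: eq_bigr => a _; rewrite mulrDl.
Qed.

Lemma polyfun_cst D c : polyfun lam D (fun=> c).
Proof.
apply: (polyfun_ext _ (@polyfun_monomial D (fun=> 0%N) c _)) => // x.
by rewrite big1 ?mulr1 // => j _; rewrite expr0.
Qed.

Lemma polyfun_sum D (I : Type) (s : seq I) (P : pred I) (F : I -> X -> K) :
  (forall i, P i -> polyfun lam D (F i)) -> polyfun lam D (fun x => \sum_(i <- s | P i) F i x).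
Proof.
move=> hF; elim: s => [|i s IH].
  by apply: (polyfun_ext _ (polyfun_cst D 0)) => x; rewrite big_nil.
case Pi: (P i); last by apply: (polyfun_ext _ IH) => x; rewrite big_cons Pi.
by apply: (polyfun_ext _ (polyfun_add (hF i Pi) IH)) => x; rewrite big_cons Pi.
Qed.

Lemma polyfun_mul D1 D2 f g : polyfun lam D1 f -> polyfun lam D2 g -> polyfun lam (D1 + D2) (fun x => f x * g x).
Proof.
move=> [k hk] [k' hk'].
apply: (@polyfun_ext _ (fun x => \sum_a \sum_b (k a * k' b) * \prod_j lam j x ^+ (a j + b j))).
  move=> x; rewrite hk hk' mulr_suml; apply: eq_bigr => a _.
  rewrite mulr_sumr; apply: eq_bigr => b _; rewrite mulrACA; congr (_ * _).
  by rewrite -big_split; apply: eq_bigr => j _; rewrite exprD.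
apply: polyfun_sum => a _; apply: polyfun_sum => b _; apply: polyfun_monomial => j.
by apply: leq_add; rewrite -ltnS.
Qed.

Lemma polyfun_le D1 D2 f : (D1 <= D2)%N -> polyfun lam D1 f -> polyfun lam D2 f.
Proof.
move=> h hf; rewrite -(subnKC h).
by apply: (polyfun_ext _ (polyfun_mul hf (polyfun_cst _ 1))) => x; rewrite mulr1.
Qed.

Lemma polyfun_exp D f n : polyfun lam D f -> polyfun lam (n * D) (fun x => f x ^+ n).
Proof.
move=> hf; elim: n => [|n IH]; first by rewrite mul0n; exact: (polyfun_cst _ 1).
by rewrite mulSn; apply: (polyfun_ext _ (polyfun_mul hf IH)) => x; rewrite exprS.
Qed.

Lemma polyfun_prod D (I : Type) (s : seq I) (F : I -> X -> K) :
  (forall i, polyfun lam D (F i)) -> polyfun lam (size s * D) (fun x => \prod_(i <- s) F i x).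
Proof.
move=> hF; elim: s => [|i s IH].
  by apply: (polyfun_ext _ (polyfun_cst _ 1)) => x; rewrite big_nil.
by rewrite mulSn; apply: (polyfun_ext _ (polyfun_mul (hF i) IH)) => x; rewrite big_cons.
Qed.

(** Division with remainder by the equation of y: each use costs one factor p, its leading
    coefficient, and raises the degree of the coefficients by D. *)
Lemma power_reduction D (Om : set X) (p y : X -> K) (c : nat -> X -> K) :
  polyfun lam D p -> (forall e, polyfun lam D (c e)) ->
  (forall x, Om x -> p x * y x ^+ D.+1 = \sum_(e < D.+1) c e x * y x ^+ e) ->
  forall n a, (a <= n)%N -> exists g : nat -> X -> K,
    (forall e, polyfun lam (n * D) (g e)) /\
    forall x, Om x -> p x ^+ n * y x ^+ a = \sum_(e < D.+1) g e x * y x ^+ e.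
Proof.
move=> hp hc rel; elim=> [|n IH] a.
  rewrite leqn0 => /eqP ->; exists (fun e x => if e == 0%N then 1 else 0); split.
    by move=> e; case: (e == 0%N); exact: polyfun_cst.
  move=> x _; rewrite !expr0 mulr1 big_ord_recl /= mul1r expr0 big1 ?addr0 // => i _.
  by rewrite mul0r.
rewrite leq_eqVlt ltnS => /orP[/eqP ->|an]; last first.
  have [g [hg hgy]] := IH a an; exists (fun e x => p x * g e x); split.
    by move=> e; rewrite mulSn; exact: polyfun_mul.
  move=> x /hgy E; rewrite exprS -mulrA E mulr_sumr.
  by apply: eq_bigr => e _; rewrite mulrA.
have [g [hg hgy]] := IH n (leqnn n).
(* Multiplication by p y shifts the exponents of y by one; the overflow term in y ^ (D + 1) is
   replaced through the relation. *)
exists (fun e x => g D x * c e x + (if e is e'.+1 then p x * g e' x else 0)); split.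
  move=> e; apply: polyfun_add; first by rewrite mulSn addnC; exact: polyfun_mul.
  by case: e => [|e]; [exact: polyfun_cst|rewrite mulSn; exact: polyfun_mul].
move=> x Ox; have := hgy x Ox.
set A := \sum_(e < D.+1) _ => EA.
transitivity (p x * y x * A); first by rewrite -EA !exprS; ring.
under [RHS]eq_bigr do rewrite mulrDl -mulrA.
rewrite big_split /= -mulr_sumr -(rel x Ox) [X in _ + X]big_ord_recl /= mul0r add0r.
rewrite /A big_ord_recr /= mulrDr addrC; congr (_ + _); last by rewrite exprS; ring.
by rewrite mulr_sumr; apply: eq_bigr => i _; rewrite /bump /= add0n exprD; ring.
Qed.

End Closure.

Lemma polyfun_subst (J J' : finType) (X X' : Type) (lam : J -> X -> K) (lam' : J' -> X' -> K)
    (phi : X' -> X) (D : nat) (f : X -> K) :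
  (forall e : J -> nat, (forall j, (e j <= D)%N) ->
     polyfun lam' D (fun x => \prod_j lam j (phi x) ^+ e j)) ->
  polyfun lam D f -> polyfun lam' D (fun x => f (phi x)).
Proof.
move=> h [k hk].
apply: (@polyfun_ext _ _ _ _ (fun x => \sum_a k a * \prod_j lam j (phi x) ^+ a j)).
  by move=> x; rewrite hk.
apply: polyfun_sum => a _.
have [k' hk'] := h (fun j => a j) (fun j => ltn_ord (a j)).
by exists (fun b => k a * k' b) => x; rewrite hk' mulr_sumr; apply: eq_bigr => b _; rewrite mulrA.
Qed.

Lemma polyfun_coord (I J : finType) (X : Type) (lam : J -> X -> K) (i : I) (D : nat) (f : X -> K) :
  polyfun lam D f ->
  polyfun (fun (u : I * J) (S : I -> X) => lam u.2 (S u.1)) D (fun S => f (S i)).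
Proof.
apply: polyfun_subst => e eD.
have h u : ((if u.1 == i then e u.2 else 0) <= D)%N by case: ifP.
apply: (polyfun_ext _ (polyfun_monomial 1 h)) => S; rewrite mul1r.
rewrite -(pair_bigA _ (fun a b => lam b (S a) ^+ (if a == i then e b else 0%N))) /=.
rewrite (bigD1 i) //= eqxx [X in _ * X]big1 ?mulr1 // => a /negbTE ->.
by rewrite big1 // => b _; rewrite expr0.
Qed.

Lemma linear_dependence (A B : finType) (X : Type) (Om : set X) (f : A -> X -> K)
    (phi : B -> X -> K) (k : A -> B -> K) :
  (#|B| < #|A|)%N -> (forall a x, Om x -> f a x = \sum_b k a b * phi b x) ->
  exists c : A -> K, (exists a, c a != 0) /\ forall x, Om x -> \sum_a c a * f a x = 0.
Proof.
move=> BA hf.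
pose M : 'M[K]_(#|A|, #|B|) := \matrix_(i, j) k (enum_val i) (enum_val j).
have : kermx M != 0.
  rewrite kermx_eq0 /row_free neq_ltn; apply/orP; left.
  exact: leq_ltn_trans (rank_leq_col M) BA.
move=> /matrix0Pn [i [j hij]].
pose c a := kermx M i (enum_rank a).
exists c; split; first by exists (enum_val j); rewrite /c enum_valK.
move=> x Ox; under eq_bigr do rewrite hf // mulr_sumr.
rewrite exchange_big /= big1 // => b _.
under eq_bigr do rewrite mulrA.
rewrite -mulr_suml.
have : (kermx M *m M) i (enum_rank b) = 0 by rewrite mulmx_ker mxE.
rewrite mxE (reindex (@enum_rank A)) /=; last exact/onW_bij/enum_rank_bij.
move=> E; rewrite [X in X * _](_ : _ = 0) ?mul0r // -[RHS]E.
by apply: eq_bigr => a _; rewrite [M _ _]mxE !enum_rankK.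
Qed.

End PolyFun.

(** On the left stands the size of a spanning family, of order d ^ (r m) in d; on the right the
    number of products to be spanned, of order d ^ (r m + 1). *)
Lemma monomial_count (m r D : nat) : let N := (r * m).+1 in
  exists d, (D.+1 ^ (r * N.+1) * (r * N.+1 * (N * d * D)).+1 ^ (r * m) < d.+1 ^ N)%N.
Proof.
(* The second base on the left is at most c (d + 1). With d equal to the remaining factors, the left
   side is at most d (d + 1) ^ (r m). *)
move=> N; pose c := (r * N.+1 * (N * D)).+1.
pose d := (D.+1 ^ (r * N.+1) * c ^ (r * m))%N.
exists d.
have h : (r * N.+1 * (N * d * D) < c * d.+1)%N.
  by rewrite mulnAC mulnA /c; set x := (_ * (N * D))%N; rewrite mulSn mulnS; lia.
apply: (@leq_ltn_trans (D.+1 ^ (r * N.+1) * (c * d.+1) ^ (r * m))).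
  by rewrite leq_mul2l; apply/orP; right; case: (posnP (r * m)) => [->//|rm0]; rewrite leq_exp2r.
rewrite /N expnS -/N; by rewrite expnMn mulnA ltn_mul2r expn_gt0 /= ltnSn.
Qed.

(** * Algebraic dependence by counting *)

Section Counting.
Context {K : fieldType} {X : Type}.

(* On r copies of X the functions y_j / y_0 live in an algebraic extension of the
   rational functions of r m coordinates, so r m + 1 of them are dependent. The
   degree d depends on m, r and D only: the y_j are chosen after it. *)
Lemma algebraic_dependence (m r D : nat) : let N := (r * m).+1 in
  exists d, forall (lam : 'I_m -> X -> K) (y : 'I_N.+1 -> X -> K) (Om : 'I_r -> set X),
  (forall i j, exists (p : X -> K) (c : nat -> X -> K),
     [/\ polyfun lam D p, forall e, polyfun lam D (c e) & forall x, Om i x ->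
       p x != 0 /\ p x * y j x ^+ D.+1 = \sum_(e < D.+1) c e x * y j x ^+ e]) ->
  (forall i x, Om i x -> y ord0 x != 0) ->
  exists k : {ffun 'I_N -> 'I_d.+1} -> K, (exists a, k a != 0) /\
    forall S : 'I_r -> X, (forall i, Om i (S i)) ->
    \sum_a k a * \prod_j (\prod_i (y (lift ord0 j) (S i) / y ord0 (S i))) ^+ a j = 0.
Proof.
move=> N; have [d hd] := monomial_count m r D; exists d => lam y Om alg y0.
(* The largest total degree of a monomial with N exponents at most d. *)
pose n := (N * d)%N.
pose U : finType := ('I_r * 'I_N.+1)%type.
have [p hp] := choice (fun u : U => alg u.1 u.2).
have [c hpc] := choice hp.
have hg (ub : U * 'I_n.+1) : exists g : nat -> X -> K,
    (forall e, polyfun lam (n * D) (g e)) /\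
    forall x, Om ub.1.1 x -> p ub.1 x ^+ n * y ub.1.2 x ^+ ub.2 =
       \sum_(e < D.+1) g e x * y ub.1.2 x ^+ e.
  have [h1 h2 h3] := hpc ub.1.
  by apply: (power_reduction h1 h2) => [x /h3 [] //|]; rewrite -ltnS.
have {hg}[g hg] := choice hg.
(* Homogenization: the exponent of y_0 completes the total degree to n, so that y_0 ^ n is a
   denominator common to all a. *)
pose b (a : {ffun 'I_N -> 'I_d.+1}) (j : 'I_N.+1) : nat :=
  if unlift ord0 j is Some j' then a j' else (n - \sum_j a j)%N.
have sa (a : {ffun 'I_N -> 'I_d.+1}) : (\sum_j a j <= n)%N.
  rewrite /n -[X in (_ <= X * _)%N]card_ord -sum_nat_const.
  by apply: leq_sum => j _; rewrite -ltnS.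
have bn a j : (b a j < n.+1)%N.
  rewrite /b ltnS; case: (unlift _ _) => [j'|]; last exact: leq_subr.
  by apply: leq_trans (sa a); rewrite (bigD1 j') //= leq_addr.
pose Omr : set ('I_r -> X) := [set S | forall i, Om i (S i)]%classic.
pose f (a : {ffun 'I_N -> 'I_d.+1}) (S : 'I_r -> X) :=
  \prod_(u : U) (p u (S u.1) ^+ n * y u.2 (S u.1) ^+ b a u.2).
pose lam' (u : 'I_r * 'I_m) (S : 'I_r -> X) := lam u.2 (S u.1).
pose G a (e : {ffun U -> 'I_D.+1}) (S : 'I_r -> X) :=
  \prod_(u : U) g (u, Ordinal (bn a u.2)) (e u) (S u.1).
pose DD := (r * N.+1 * (n * D))%N.
have hG (ae : {ffun 'I_N -> 'I_d.+1} * {ffun U -> 'I_D.+1}) : polyfun lam' DD (G ae.1 ae.2).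
  rewrite /DD; have -> : (r * N.+1)%N = size (index_enum U).
    by rewrite -sum1_size sum1_card card_prod !card_ord.
  apply: polyfun_prod => u; apply: polyfun_coord; exact: (hg _).1.
have {hG}[kk hkk] := choice hG.
(* The spanning family: coordinate monomials times powers of the y_j reduced to exponents at most
   D. *)
pose phi (v : {ffun U -> 'I_D.+1} * {ffun ('I_r * 'I_m) -> 'I_DD.+1}) (S : 'I_r -> X) :=
  (\prod_u lam' u S ^+ v.2 u) * \prod_(u : U) y u.2 (S u.1) ^+ v.1 u.
have hf a S : Omr S -> f a S = \sum_v kk (a, v.1) v.2 * phi v S.
  move=> OS; rewrite /f.
  have -> : \prod_(u : U) (p u (S u.1) ^+ n * y u.2 (S u.1) ^+ b a u.2) =
      \prod_(u : U) \sum_(e < D.+1) g (u, Ordinal (bn a u.2)) e (S u.1) * y u.2 (S u.1) ^+ e.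
    apply: eq_bigr => u _; exact: (hg (u, Ordinal (bn a u.2))).2 (OS u.1).
  rewrite bigA_distr_bigA /=.
  rewrite -(pair_bigA _ (fun e v => kk (a, e) v * phi (e, v) S)) /=.
  apply: eq_bigr => e _; rewrite big_split /=.
  have := hkk (a, e) S; rewrite /G /= => ->.
  by rewrite mulr_suml; apply: eq_bigr => v _; rewrite /phi /= mulrA.
have [|k [knz hk]] := linear_dependence _ hf.
  by rewrite card_prod !card_ffun !card_ord !card_prod !card_ord; exact: hd.
exists k; split => // S OS; have := hk S OS.
pose cc := (\prod_(u : U) p u (S u.1) ^+ n) * \prod_i y ord0 (S i) ^+ n.
have cc0 : cc != 0.
  apply: mulf_neq0; apply/prodf_neq0 => u _; apply: expf_neq0; last exact: y0 (OS u).
  by have [_ _ h] := hpc u; have [] := h _ (OS u.1).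
have E a : f a S = cc * \prod_j (\prod_i (y (lift ord0 j) (S i) / y ord0 (S i))) ^+ a j.
  rewrite /f big_split /= -mulrA; congr (_ * _).
  rewrite -(pair_bigA _ (fun i j => y j (S i) ^+ b a j)) /=.
  under [X in _ * X]eq_bigr do rewrite -prodrXl.
  rewrite [X in _ * X]exchange_big /= -big_split /=; apply: eq_bigr => i _.
  rewrite big_ord_recl /= {1}/b unlift_none.
  have yi := y0 i _ (OS i).
  under [X in _ * X = _]eq_bigr do rewrite /b liftK.
  under [in RHS]eq_bigr do rewrite expr_div_n.
  rewrite big_split /= prodfV prodrXr -[in RHS](subnK (sa a)) exprD.
  have ys : y ord0 (S i) ^+ (\sum_j a j) != 0 by exact: expf_neq0.
  by rewrite -[RHS]mulrA; congr (_ * _); rewrite mulrC divfK.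
under eq_bigr do rewrite E mulrCA.
by rewrite -mulr_sumr => /eqP; rewrite mulf_eq0 (negbTE cc0) => /eqP.
Qed.

End Counting.

(** * Nonvanishing points and degrees of multivariate polynomials *)

Section KroneckerPoint.
Context {K : numFieldType}.

Lemma digits_inj B n (a b : 'I_n -> nat) : (forall i, (a i < B)%N) -> (forall i, (b i < B)%N) ->
  (\sum_i a i * B ^ i = \sum_i b i * B ^ i)%N -> a =1 b.
Proof.
elim: n a b => [|n IH] a b aB bB; first by move=> _ [].
rewrite !big_ord_recl /= !expn0 !muln1 => E.
have sh (c : 'I_n.+1 -> nat) : (\sum_(i < n) c (lift ord0 i) * B ^ bump 0 i =
    B * \sum_(i < n) c (lift ord0 i) * B ^ i)%N.
  by rewrite big_distrr /=; apply: eq_bigr => i _; rewrite expnS mulnCA.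
rewrite !sh in E.
have B0 : (0 < B)%N by apply: leq_ltn_trans (aB ord0).
have E0 : a ord0 = b ord0.
  by have := congr1 (modn^~ B) E; rewrite !(addnC (_ ord0)) !(mulnC B) !modnMDl !modn_small.
move: E; rewrite E0 => /addnI /eqP; rewrite eqn_pmul2l // => /eqP /IH h i.
case: (unliftP ord0 i) => [j ->|-> //]; exact: h (fun j => aB _) (fun j => bB _) j.
Qed.

Lemma poly_nonroot (p : {poly K}) : p != 0 -> exists t, p.[t] != 0.
Proof.
move=> p0; pose s : seq K := [seq i%:R | i <- iota 0 (size p)].
case: (boolP (all (root p) s)) => [h|/allPn [t _ ht]]; last by exists t.
have us : uniq s.
  by rewrite map_inj_uniq ?iota_uniq // => i j /eqP; rewrite eqr_nat => /eqP.
by have := max_poly_roots p0 h us; rewrite size_map size_iota ltnn.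
Qed.

(** Kronecker substitution: x_i = t ^ (B ^ i) with B above all the exponents sends distinct
    monomials to distinct powers of t, by uniqueness of digits in base B. *)
Lemma mpoly_nonroot n (P : mpoly.mpoly n K) : P != 0 -> exists v, mpoly.meval v P != 0.
Proof.
move=> P0; pose B := (\max_(m <- mpoly.msupp P) \max_(i < n) m i).+1%N.
have mB m i : m \in mpoly.msupp P -> (m i < B)%N.
  move=> hm; rewrite ltnS; apply: leq_trans (leq_bigmax_seq _ hm _) => //.
  exact: (leq_bigmax i).
pose kap (m : mpoly.multinom n) := (\sum_i m i * B ^ i)%N.
have kap_inj m m' : m \in mpoly.msupp P -> m' \in mpoly.msupp P -> kap m = kap m' -> m = m'.
  move=> hm hm' /digits_inj h; apply/mpoly.mnmP => i.
  by apply: h => j; exact: mB.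
have [m0 hm0] : exists m, m \in mpoly.msupp P.
  move: P0; rewrite -mpoly.msupp_eq0; case: (mpoly.msupp P) => // m s _.
  by exists m; rewrite inE eqxx.
pose p : {poly K} := \sum_(m <- mpoly.msupp P) mpoly.mcoeff m P *: 'X^(kap m).
have p0 : p != 0.
  apply/eqP => /(congr1 (fun q : {poly K} => q`_(kap m0))) /eqP.
  rewrite coef0 coef_sum (bigD1_seq m0 hm0 (mpoly.msupp_uniq P)) /=.
  rewrite coefZ coefXn eqxx mulr1 big_seq_cond big1 ?addr0.
    by move=> E; have := etrans (esym (mpoly.mcoeff_eq0 P m0)) E; rewrite hm0.
  move=> m /andP[hm mm0]; rewrite coefZ coefXn; case: eqP => [/esym/kap_inj E|]; last by rewrite mulr0.
  by move: mm0; rewrite E ?eqxx.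
have [t ht] := poly_nonroot p0.
exists (fun i => t ^+ (B ^ i)); rewrite mpoly.mevalE.
have -> // : \sum_(m <- mpoly.msupp P) mpoly.mcoeff m P * \prod_(i < n) (t ^+ (B ^ i)) ^+ m i = p.[t].
rewrite horner_sum; apply: eq_bigr => m _; rewrite hornerZ hornerXn; congr (_ * _).
rewrite /kap -prodrXr; apply: eq_bigr => i _; by rewrite -exprM mulnC.
Qed.

Lemma polyfun_lam (J : finType) X (lam : J -> X -> K) (j : J) : polyfun lam 1 (lam j).
Proof.
have h i : ((i == j : nat) <= 1)%N by case: eqP.
apply: (polyfun_ext _ (polyfun_monomial 1 h)) => x; rewrite mul1r (bigD1 j) //= eqxx expr1 big1 ?mulr1 //.
by move=> i /negbTE ->.
Qed.

(** The degree is fixed by P before the functions are given; the counting argument needs one D for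
    all the curves. *)
Lemma meval_polyfun n (P : mpoly.mpoly n K) : exists D, forall (J : finType) X (lam : J -> X -> K)
  (v : 'I_n -> X -> K), (forall i, polyfun lam 1 (v i)) ->
  polyfun lam D (fun x => mpoly.meval (fun i => v i x) P).
Proof.
exists (\max_(m <- mpoly.msupp P) \sum_(i < n) m i)%N => J X lam v hv.
apply: (polyfun_ext (f := fun x => \sum_(m <- mpoly.msupp P | m \in mpoly.msupp P)
   mpoly.mcoeff m P * \prod_i v i x ^+ m i)).
  by move=> x; rewrite mpoly.mevalE [RHS]big_seq_cond; apply: eq_bigl => m; rewrite andbT.
apply: polyfun_sum => m hm.
have h (s : seq 'I_n) : polyfun lam (\sum_(i <- s) m i)%N (fun x => \prod_(i <- s) v i x ^+ m i).
  elim: s => [|i s IH].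
    by rewrite big_nil; apply: (polyfun_ext _ (polyfun_cst _ 1)) => x; rewrite big_nil.
  rewrite big_cons; have hi := polyfun_exp (m i) (hv i); rewrite muln1 in hi.
  by apply: (polyfun_ext _ (polyfun_mul hi IH)) => x; rewrite big_cons.
by apply: polyfun_le (leq_bigmax_seq _ hm _) (polyfun_mul (polyfun_cst 0 _) (h _)).
Qed.

End KroneckerPoint.

Section Split.
Context {K : fieldType} {m : nat} {S : Type} (q : 'I_m -> S -> K).

(** Index 0 is the perturbation parameter eps, index 1 the value Y in the last variable of the
    polynomial, and the others are the coordinates [q]. *)
Definition lam2 (i : 'I_m.+2) (x : (K * K * S)%type) : K :=
  if unlift ord0 i is Some i' then
    if unlift ord0 i' is Some j then q j x.2 else x.1.2
  else x.1.1.

Lemma polyfun_split D (f : (K * K * S)%type -> K) : polyfun lam2 D f ->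
  exists g : nat -> nat -> S -> K, (forall i j, polyfun q D (g i j)) /\
    forall e Y s, f (e, Y, s) = \sum_(i < D.+1) \sum_(j < D.+1) e ^+ i * Y ^+ j * g i j s.
Proof.
move=> [k hk]; pose one : 'I_m.+2 := lift ord0 ord0.
exists (fun i j s => \sum_(a : {ffun 'I_m.+2 -> 'I_D.+1} | (a ord0 == i :> nat) && (a one == j :> nat))
  k a * \prod_l q l s ^+ a (lift ord0 (lift ord0 l))); split.
  by move=> i j; apply: polyfun_sum => a _; apply: polyfun_monomial => l; rewrite -ltnS.
move=> e Y s; rewrite hk.
rewrite (partition_big (fun a : {ffun 'I_m.+2 -> 'I_D.+1} => (a ord0, a one)) predT) //=.
rewrite -(pair_bigA _ (fun i j => \sum_(a : {ffun 'I_m.+2 -> 'I_D.+1} | (a ord0, a one) == (i, j))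
   k a * \prod_l lam2 l (e, Y, s) ^+ a l)) /=.
apply: eq_bigr => i _; apply: eq_bigr => j _; rewrite mulr_sumr.
apply: eq_big => a; first by rewrite xpair_eqE.
rewrite xpair_eqE => /andP[/eqP <- /eqP <-].
rewrite !big_ord_recl /= /lam2 unlift_none liftK unlift_none /=.
rewrite [RHS]mulrCA -[in RHS]mulrA; congr (_ * (_ * (_ * _))).
by apply: eq_bigr => l _; rewrite !liftK.
Qed.

Lemma polyfun_lam2 (f : S -> K) D : polyfun q D f -> polyfun lam2 D (fun x => f x.2).
Proof.
apply: polyfun_subst => e eD.
pose e' (i : 'I_m.+2) : nat := if unlift ord0 i is Some i' then
    if unlift ord0 i' is Some j then e j else 0 else 0.
have h i : (e' i <= D)%N by rewrite /e'; case: (unlift ord0 i) => // i'; case: (unlift ord0 i').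
apply: (polyfun_ext _ (polyfun_monomial 1 h)) => x.
rewrite mul1r !big_ord_recl /e' unlift_none liftK unlift_none !expr0 !mul1r.
by apply: eq_bigr => l _; rewrite /lam2 !liftK.
Qed.

End Split.

(** * An algebraic equation for a Nash function along a curve *)

Section NashRelation.
Context {R : realType}.
Notation C := (Cplx R).

Lemma ccontD (f g : C -> C) (z : C) : {for z, continuous f} -> {for z, continuous g} ->
  {for z, continuous (fun w => f w + g w)}.
Proof. exact: continuousD. Qed.

Lemma ccont_cst (c z : C) : {for z, continuous (fun=> c : C)}.
Proof. exact: cst_continuous. Qed.

Lemma ccont_sum (I : Type) (s : seq I) (F : I -> C -> C) (z : C) :
  (forall i, {for z, continuous (F i)}) -> {for z, continuous (fun w => \sum_(i <- s) F i w)}.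
Proof.
move=> hF; elim: s => [|i s IH].
  have -> : (fun w => \sum_(i <- [::]) F i w) = (fun=> 0 : C) by apply/funext => w; rewrite big_nil.
  exact: ccont_cst.
have -> : (fun w => \sum_(j <- i :: s) F j w) = (fun w => F i w + \sum_(j <- s) F j w).
  by apply/funext => w; rewrite big_cons.
exact: ccontD (hF i) IH.
Qed.

Lemma ccont_prod (I : Type) (s : seq I) (F : I -> C -> C) (z : C) :
  (forall i, {for z, continuous (F i)}) -> {for z, continuous (fun w => \prod_(i <- s) F i w)}.
Proof.
move=> hF; elim: s => [|i s IH].
  have -> : (fun w => \prod_(i <- [::]) F i w) = (fun=> 1 : C) by apply/funext => w; rewrite big_nil.
  exact: ccont_cst.
have -> : (fun w => \prod_(j <- i :: s) F j w) = (fun w => F i w * \prod_(j <- s) F j w).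
  by apply/funext => w; rewrite big_cons.
exact: ccontM (hF i) IH.
Qed.

Lemma ccontX (f : C -> C) (z : C) n : {for z, continuous f} ->
  {for z, continuous (fun w => f w ^+ n)}.
Proof.
move=> hf; elim: n => [|n IH].
  have -> : (fun w => f w ^+ 0) = (fun=> 1 : C) by apply/funext => w; rewrite expr0.
  exact: ccont_cst.
have -> : (fun w => f w ^+ n.+1) = (fun w => f w * f w ^+ n) by apply/funext => w; rewrite exprS.
exact: ccontM.
Qed.

Lemma polyfun_continuous (J : finType) (lam : J -> C -> C) D (f : C -> C) (z : C) :
  (forall j, {for z, continuous (lam j)}) -> polyfun lam D f -> {for z, continuous f}.
Proof.
move=> hl [k hk].
have -> : f = (fun x => \sum_a k a * \prod_j lam j x ^+ a j) by exact/funext.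
apply: (@ccont_sum _ _ (fun (a : {ffun J -> 'I_D.+1}) x => k a * \prod_j lam j x ^+ a j)) => a.
apply: (@ccontM _ (fun=> k a) (fun x => \prod_j lam j x ^+ a j)); first exact: ccont_cst.
by apply: (@ccont_prod _ _ (fun j x => lam j x ^+ a j)) => j; exact: ccontX.
Qed.

Lemma zero_limit (f : C -> C) (r : R) : 0 < r -> {for 0, continuous f} ->
  (forall w : C, w != 0 -> nr w < r -> f w = 0) -> f 0 = 0.
Proof.
move=> r0 cf f0; apply: contrapT => /eqP fn.
have n0 : 0 < nr (f 0) by rewrite nr_gt0.
have [d d0 hd] := iffLR (continuous_nrP _ _) cf _ n0.
pose t := Num.min r d / 2.
have t0 : 0 < t by rewrite divr_gt0 // lt_min r0 d0.
have tm : t < Num.min r d.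
  by have m0 : 0 < Num.min r d; [rewrite lt_min r0 d0|rewrite /t; lra].
have nt : nr (t%:C : C) = t by rewrite nrC ger0_norm // ltW.
have := tm; rewrite lt_min => /andP[tr td].
have := hd t%:C; rewrite subr0 nt => /(_ td).
by rewrite f0 ?nt ?sub0r ?nrN ?ltxx // -nr_gt0 nt.
Qed.

Lemma nr_ball_sub (s1 s2 s : C) (r : R) : nr (s - s2) < r - nr (s2 - s1) -> nr (s - s1) < r.
Proof. by move=> h; have := nrD (s - s2) (s2 - s1); rewrite addrA subrK; lra. Qed.

(* The Nash polynomial P may vanish identically along the curve s |-> (a, q s).
   The lowest order term in eps of P(x + eps u, Y) does not, and it still
   annihilates h by continuity. *)
Lemma nash_relation m (V : set 'rV[C]_(m + m)) (P : mpoly.mpoly (m + m + 1) C)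
    (h : 'rV[C]_(m + m) -> C) :
  open V -> P != 0 -> (forall x, V x -> {for x, continuous h}) ->
  (forall x, V x -> mpoly.meval (fun i => row_mx x (const_mx (h x) : 'rV_1) 0 i) P = 0) ->
  exists D, forall (a : 'rV[C]_m) (q : C -> 'rV[C]_m) (s1 : C) (r : R), 0 < r ->
  (forall s, nr (s - s1) < r -> V (row_mx a (q s)) /\
     forall k, {for s, continuous (fun s => q s 0 k : C)}) ->
  exists (s2 : C) (r2 : R), [/\ 0 < r2, forall s, nr (s - s2) < r2 -> nr (s - s1) < r &
  exists (p : C -> C) (c : nat -> C -> C),
     [/\ polyfun (fun k s => q s 0 k) D p, forall e, polyfun (fun k s => q s 0 k) D (c e) &
     forall s, nr (s - s2) < r2 -> p s != 0 /\
     p s * h (row_mx a (q s)) ^+ D.+1 = \sum_(e < D.+1) c e s * h (row_mx a (q s)) ^+ e]].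
Proof.
move=> oV P0 ch hP; have [D hD] := meval_polyfun P; exists D => a q s1 r r0 hq.
have s1in : nr (s1 - s1) < r by rewrite subrr nr0.
have [v hv] := mpoly_nonroot P0.
pose x1 (s : C) : 'rV[C]_(m + m) := row_mx a (q s).
(* The direction points from the curve at s1 to a nonzero of P, which is reached for eps = 1; hence
   P does not vanish identically in (eps, Y, s). *)
pose u : 'rV[C]_(m + m) := \row_i v (lshift 1 i) - x1 s1.
pose Y1 : C := v (rshift (m + m) ord0).
pose ql (k : 'I_m) (s : C) : C := q s 0 k.
pose w (i : 'I_(m + m + 1)) (x : (C * C * C)%type) : C :=
  row_mx (x1 x.2 + x.1.1 *: u) (const_mx x.1.2 : 'rV_1) 0 i.
have hw i : polyfun (lam2 ql) 1 (w i).
  rewrite /w; case: (split_ordP i) => j ->; last first.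
    apply: (polyfun_ext _ (polyfun_lam (lam2 ql) (lift ord0 ord0))) => x.
    by rewrite row_mxEr mxE /lam2 liftK unlift_none.
  apply: (polyfun_ext (f := fun x => x1 x.2 0 j + lam2 ql ord0 x * u 0 j)).
    by move=> x; rewrite row_mxEl !mxE /lam2 unlift_none.
  apply: polyfun_add; last exact: (polyfun_mul (polyfun_lam (lam2 ql) ord0) (polyfun_cst 0 (u 0 j))).
  apply: (@polyfun_lam2 _ _ _ ql (fun s => x1 s 0 j)); rewrite /x1; case: (split_ordP j) => l ->.
    by apply: (polyfun_ext _ (polyfun_cst 1 (a 0 l))) => x; rewrite row_mxEl.
  by apply: (polyfun_ext _ (polyfun_lam ql l)) => x; rewrite row_mxEr.
have [g [hg Eg]] := polyfun_split (hD _ _ _ _ hw).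
pose B (s : C) := nr (s - s1) < r.
have nz : exists i, (i < D.+1)%N && `[< exists j s, [/\ (j < D.+1)%N, B s & g i j s != 0] >].
  apply: contrapT => hno; move: hv; apply/negP; rewrite negbK.
  have := Eg 1 Y1 s1.
  have -> : (fun i => w i (1, Y1, s1)) = v.
    apply/funext => i; rewrite /w /=; case: (split_ordP i) => j ->.
      by rewrite row_mxEl scale1r /u addrC subrK mxE.
    by rewrite row_mxEr mxE /Y1 (ord1 j).
  move=> ->; rewrite big1 // => i _; rewrite big1 // => j _.
  apply/eqP; rewrite mulf_eq0; apply/orP; right; apply: contrapT => gn.
  apply: hno; exists i; rewrite ltn_ord /=; apply/asboolP; exists j, s1; split => //.
  exact/negP.
(* The lowest power of eps whose coefficient is not identically 0 on the disc. *)
pose i0 := ex_minn nz.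
have [iD [j1 [s3 [j1D Bs3 gs3]]]] : (i0 < D.+1)%N /\ exists j s, [/\ (j < D.+1)%N, B s & g i0 j s != 0].
  by rewrite /i0; case: ex_minnP => i /andP[iD /asboolP h1] _.
have imin i j s : (i < i0)%N -> (j < D.+1)%N -> B s -> g i j s = 0.
  rewrite /i0; case: ex_minnP => i' /andP[i'D _] hmin ii' jD Bs; apply: contrapT => /eqP gn.
  have : (i' <= i)%N.
    apply: hmin; rewrite (ltn_trans ii' i'D) /=; apply/asboolP; by exists j, s.
  by rewrite leqNgt ii'.
have nzj : exists j, (j < D.+1)%N && `[< exists s, B s /\ g i0 j s != 0 >].
  by exists j1; rewrite j1D; apply/asboolP; exists s3.
have jb j : (j < D.+1)%N && `[< exists s, B s /\ g i0 j s != 0 >] -> (j <= D)%N.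
  by case/andP; rewrite ltnS.
(* The degree in Y of that lowest order term; its leading coefficient is nonzero at s2, which
   becomes the new centre. *)
pose j0 := ex_maxn nzj jb.
have [j0D [s2 [Bs2 gs2]]] : (j0 <= D)%N /\ exists s, B s /\ g i0 j0 s != 0.
  by rewrite /j0; case: ex_maxnP => j /andP[jD /asboolP h1] _.
have jmax j s : (j0 < j)%N -> (j < D.+1)%N -> B s -> g i0 j s = 0.
  rewrite /j0; case: ex_maxnP => j' _ hmax jj' jD Bs; apply: contrapT => /eqP gn.
  have : (j <= j')%N by apply: hmax; rewrite jD /=; apply/asboolP; exists s.
  by rewrite leqNgt jj'.
pose y (s : C) := h (row_mx a (q s)).
have rel s : B s -> \sum_(j < D.+1) y s ^+ j * g i0 j s = 0.
  move=> Bs; have [Vs _] := hq s Bs.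
  pose H (e : C) : C := h (x1 s + e *: u).
  (* P along the perturbed point, divided by e ^ i0. It vanishes for small e != 0, hence at 0, where
     only the lowest order term survives. *)
  pose T (e : C) : C := \sum_(i < D.+1) \sum_(j < D.+1) (if (i < i0)%N then 0 else e ^+ (i - i0)) * H e ^+ j * g i j s.
  have Hc : {for 0, continuous H}.
    have ch' : {for x1 s + 0 *: u, continuous h} by rewrite scale0r addr0; exact: ch.
    have caff : {for (0 : C), continuous (fun e : C => x1 s + e *: u)}.
      apply/continuous_nrP => e e0; exists (e / (nr u + 1)).
        by rewrite divr_gt0 // ltr_wpDl // nr_ge0.
      move=> z; rewrite subr0 scale0r addr0 [x1 s + _]addrC addrK nrZ => hz.
      have u1 : 0 < nr u + 1 by rewrite ltr_wpDl // nr_ge0.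
      move: hz; rewrite ltr_pdivlMr //; have := nr_ge0 z; have := nr_ge0 u.
      by move: (nr z) (nr u); clear; intros; nra.
    exact: (@continuous_comp _ _ _ (fun e : C => x1 s + e *: u) h 0 caff ch').
  have Tc : {for 0, continuous T}.
    apply: (@ccont_sum _ _ (fun (i : 'I_D.+1) e => \sum_(j < D.+1)
      (if (i < i0)%N then 0 else e ^+ (i - i0)) * H e ^+ j * g i j s)) => i.
    apply: (@ccont_sum _ _ (fun (j : 'I_D.+1) e =>
      (if (i < i0)%N then 0 else e ^+ (i - i0)) * H e ^+ j * g i j s)) => j.
    apply: (@ccontM _ (fun e => (if (i < i0)%N then 0 else e ^+ (i - i0)) * H e ^+ j)); last exact: ccont_cst.
    apply: (@ccontM _ (fun e => if (i < i0)%N then 0 else e ^+ (i - i0))); last exact: ccontX.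
    case: (i < i0)%N; first exact: ccont_cst.
    by apply: (@ccontX id); apply: derivable_cont; case: (cder_id (0 : C)).
  have [r1 r10 hr1] := iffLR (open_nrP _) oV _ Vs.
  have u1 : 0 < nr u + 1 by rewrite ltr_wpDl // nr_ge0.
  have T0 : T 0 = 0.
    apply: (@zero_limit T (r1 / (nr u + 1))) => //; first exact: divr_gt0.
    move=> e e0 er; have Ve : V (x1 s + e *: u).
      apply: hr1; rewrite addrC addKr nrZ; move: er; rewrite ltr_pdivlMr //.
      have := nr_ge0 e; move: (nr e) (nr u); clear; intros; lra.
    have := Eg e (H e) s.
    have -> : mpoly.meval (fun i => w i (e, H e, s)) P = 0 by exact: hP.
    move=> E; have ei : e ^+ i0 != 0 by rewrite expf_neq0.
    apply: (mulfI ei); rewrite mulr0 E /T mulr_sumr; apply: eq_bigr => i _.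
    rewrite mulr_sumr; apply: eq_bigr => j _.
    case: ltnP => ii; first by rewrite imin ?ltn_ord // !mulr0.
    by rewrite !mulrA -exprD subnKC.
  move: T0; rewrite /T (bigD1 (Ordinal iD)) //= ltnn subnn expr0.
  rewrite [X in _ + X]big1 ?addr0.
    by move=> E; apply: etrans E; apply: eq_bigr => j _; rewrite mul1r /H scale0r addr0.
  move=> i ii; rewrite big1 // => j _; case: ltnP => // i0i.
    by rewrite !mul0r.
  have : (0 < i - i0)%N.
    rewrite subn_gt0 ltn_neqAle i0i andbT; apply: contraNneq ii => E.
    by apply/eqP/val_inj.
  by case: (i - i0)%N => // k _; rewrite exprS !mul0r.
(* Multiplication by y ^ k brings the degree of the relation to D + 1 whatever j0 is, the uniform
   shape used for counting. *)
pose p := g i0 j0; pose k := (D.+1 - j0)%N.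
have kj : (k + j0 = D.+1)%N by rewrite /k subnK // ltnW.
have cp : {for s2, continuous p}.
  by apply: (polyfun_continuous _ (hg i0 j0)) => l; exact: (hq s2 Bs2).2.
have [d d0 hd] := iffLR (continuous_nrP _ _) cp _ (etrans (nr_gt0 _) gs2).
exists s2, (Num.min d (r - nr (s2 - s1))); split.
- by rewrite lt_min d0 subr_gt0.
- by move=> s; rewrite lt_min => /andP[_]; exact: nr_ball_sub.
exists p, (fun e s => if (e < k)%N then 0 else - g i0 (e - k)%N s); split; first exact: hg.
  move=> e; case: (e < k)%N; first exact: polyfun_cst.
  apply: (polyfun_ext (f := fun s => 0 + (-1) * g i0 (e - k)%N s)).
    by move=> s; rewrite add0r mulN1r.
  apply: polyfun_add; first exact: polyfun_cst.
  by rewrite -[D]add0n; exact: polyfun_mul (polyfun_cst 0 _) (hg _ _).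
move=> s; rewrite lt_min => /andP[/hd hs /nr_ball_sub Bs]; split.
  by apply: contraTneq hs => ->; rewrite sub0r nrN ltxx.
rewrite -/(y s) -{1}kj exprD.
have := rel s Bs.
rewrite -(big_mkord xpredT (fun j => y s ^+ j * g i0 j s)) (big_cat_nat (n := j0.+1)) //=.
rewrite [X in _ + X]big_nat_cond [X in _ + X]big1 ?addr0; last first.
  by move=> j /andP[/andP[h1 h2] _]; rewrite jmax ?mulr0.
rewrite big_nat_recr //= => /eqP; rewrite addr_eq0 => /eqP E.
rewrite -(big_mkord xpredT (fun e => (if (e < k)%N then 0 else - g i0 (e - k)%N s) * y s ^+ e)).
rewrite (big_cat_nat (n := k)) //=; last by rewrite -kj leq_addr.
rewrite [X in X + _]big_nat_cond [X in X + _]big1 ?add0r; last first.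
  by move=> j /andP[/andP[_ h2] _]; rewrite h2 mul0r.
rewrite -{2}[k]add0n big_addn.
have -> : (D.+1 - k = j0)%N by rewrite -kj addKn.
have -> : p s * (y s ^+ k * y s ^+ j0) = - y s ^+ k * - (y s ^+ j0 * g i0 j0 s).
  by rewrite /p; move: (y s ^+ k) (y s ^+ j0) (g i0 j0 s); clear => *; ring.
rewrite -E mulr_sumr; apply: eq_bigr => j _.
rewrite ltnNge leq_addl /= addnK exprD.
move: (y s ^+ k) (y s ^+ j) (g i0 j s); clear => *; ring.
Qed.

End NashRelation.

(** * The contradiction along a curve *)

Section Rank.
Context {R : realType}.
Notation C := (Cplx R).

Lemma nr_sum (I : Type) (s : seq I) (F : I -> C) : nr (\sum_(i <- s) F i) <= \sum_(i <- s) nr (F i).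
Proof.
elim: s => [|i s IH]; first by rewrite !big_nil nr0.
by rewrite !big_cons; apply: le_trans (nrD _ _) _; rewrite lerD2l.
Qed.

(** If u M = 0 and G is a right inverse of M0, then u = u (M0 - M) G; for M close to M0 this forces
    the l^1 norm of u to be at most half of itself. *)
Lemma row_free_open r n (M0 : 'M[C]_(r, n)) : row_free M0 -> exists2 eta : R, 0 < eta &
  forall M : 'M[C]_(r, n), (forall i j, nr (M i j - M0 i j) < eta) -> row_free M.
Proof.
move=> /row_freeP [G hG].
pose K := \sum_i \sum_j nr (G i j).
have K0 : 0 <= K by apply: sumr_ge0 => i _; apply: sumr_ge0 => j _; exact: nr_ge0.
have K1 : 0 < 2 * (K + 1) by move: K K0; clear => *; lra.
exists (2 * (K + 1))^-1; first by rewrite invr_gt0.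
move=> M hM; apply: inj_row_free => u uM.
pose T := \sum_i nr (u 0 i).
have T0 : 0 <= T by apply: sumr_ge0 => j _; exact: nr_ge0.
have Eu : u = u *m (M0 - M) *m G by rewrite mulmxBr uM subr0 -mulmxA hG mulmx1.
have TT : T <= T * ((2 * (K + 1))^-1 * K).
  have h i : nr (u 0 i) <= T * ((2 * (K + 1))^-1 * \sum_j nr (G j i)).
    rewrite {1}Eu mxE; apply: le_trans (nr_sum _ _) _.
    rewrite !mulr_sumr; apply: ler_sum => j _; rewrite nrM mulrA ler_wpM2r ?nr_ge0 //.
    rewrite mxE; apply: le_trans (nr_sum _ _) _; rewrite mulr_suml; apply: ler_sum => k _.
    rewrite nrM ler_wpM2l ?nr_ge0 // !mxE -nrN opprB; exact: ltW.
  rewrite {1}/T; apply: le_trans (ler_sum _ (fun i _ => h i)) _.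
  by rewrite -mulr_sumr -mulr_sumr /K exchange_big.
have T00 : T = 0.
  have h : T * ((2 * (K + 1))^-1 * K) <= T / 2.
    rewrite ler_wpM2l // mulrC ler_pdivrMr //; move: K0; move: (K); clear => *; lra.
  apply/eqP; rewrite eq_le T0 andbT; move: (le_trans TT h); move: (T); clear => *; lra.
apply/rowP => i; rewrite mxE; apply: nr_eq0; apply/eqP.
have := T00; rewrite /T => /eqP; rewrite psumr_eq0; last by move=> j _; exact: nr_ge0.
by move=> /allP /(_ i); rewrite mem_index_enum => /(_ isT).
Qed.

(** Independence of the r vectors persists for nearby points. There G s0 must lie in their span,
    since otherwise s0 would be an (r + 1)-st point, against the maximality of r. *)
Lemma maximal_rank n (G : C -> 'rV[C]_n) (s0 : C) (d : R) : 0 < d ->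
  (forall s, nr (s - s0) < d -> forall j, {for s, continuous (fun s => G s 0 j : C)}) ->
  exists r (S0 : 'I_r -> C), (forall i, nr (S0 i - s0) < d) /\
  exists2 del : R, 0 < del & forall S : 'I_r -> C, (forall i, nr (S i - S0 i) < del) ->
    (forall i, nr (S i - s0) < d) /\ (G s0 <= \matrix_i G (S i))%MS.
Proof.
move=> d0 cG.
pose P r := `[< exists S : 'I_r -> C, (forall i, nr (S i - s0) < d) /\ row_free (\matrix_i G (S i)) >].
have P0 : exists r, P r.
  exists 0%N; apply/asboolP; exists (fun=> s0); split; first by move=> [].
  by apply: inj_row_free => v _; apply/rowP => -[].
have Pn r : P r -> (r <= n)%N.
  by move=> /asboolP [S [_ /eqP <-]]; exact: rank_leq_col.
pose r := ex_maxn P0 Pn; exists r.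
have [/asboolP [S0 [BS0 fS0]] rmax] : P r /\ forall k, P k -> (k <= r)%N.
  by rewrite /r; case: ex_maxnP.
exists S0; split=> //.
have [eta eta0 heta] := row_free_open fS0.
have hd (ij : 'I_r * 'I_n) : exists del : R, 0 < del /\ forall s, nr (s - S0 ij.1) < del ->
    nr (s - s0) < d /\ nr (G s 0 ij.2 - G (S0 ij.1) 0 ij.2) < eta.
  have [e e0 he] := iffLR (continuous_nrP _ _) (cG _ (BS0 ij.1) ij.2) _ eta0.
  exists (Num.min e (d - nr (S0 ij.1 - s0))); split.
    by rewrite lt_min e0 subr_gt0 BS0.
  by move=> s; rewrite lt_min => /andP[/he h /nr_ball_sub].
have [del hdel] := choice hd.
have hd' (i : 'I_r) : 0 < d - nr (S0 i - s0) by rewrite subr_gt0.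
exists (Num.min (\big[Num.min/1]_ij del ij) (\big[Num.min/1]_i (d - nr (S0 i - s0)))).
  rewrite lt_min; apply/andP; split.
    by apply: lt_bigmin => [|ij _]; [exact: ltr01|exact: (hdel ij).1].
  by apply: lt_bigmin => [|i _]; [exact: ltr01|exact: hd'].
move=> S hS.
have h1 i : nr (S i - S0 i) < d - nr (S0 i - s0).
  apply: lt_le_trans (hS i) _; rewrite ge_min; apply/orP; right; exact: bigmin_le.
have h2 i j : nr (G (S i) 0 j - G (S0 i) 0 j) < eta.
  apply: ((hdel (i, j)).2 (S i) _).2; apply: lt_le_trans (hS i) _.
  rewrite ge_min; apply/orP; left; exact: bigmin_le.
have BS i : nr (S i - s0) < d by apply: nr_ball_sub (h1 i).
split=> //.
have fS : row_free (\matrix_i G (S i)) by apply: heta => i j; rewrite !mxE; exact: h2.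
apply: contrapT => hno.
have : P r.+1; last by move=> /rmax; rewrite ltnn.
apply/asboolP; pose S' (i : 'I_r.+1) := if unlift ord0 i is Some j then S j else s0.
exists S'; split.
  by move=> i; rewrite /S'; case: (unlift _ _) => [j|]; [exact: BS|rewrite subrr nr0].
apply: inj_row_free => u uM.
pose u' : 'rV[C]_r := \row_j u 0 (lift ord0 j).
have E : u 0 ord0 *: G s0 + u' *m (\matrix_i G (S i)) = 0.
  rewrite -uM !mulmx_sum_row big_ord_recl; congr (_ *: _ + _).
    by rewrite rowK /S' unlift_none.
  by apply: eq_bigr => j _; rewrite !rowK /S' liftK mxE.
have u0 : u 0 ord0 = 0.
  apply: contrapT => /eqP un; apply: hno.
  have -> : G s0 = (- (u 0 ord0)^-1 *: u') *m (\matrix_i G (S i)).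
    move/eqP: E; rewrite addr_eq0 => /eqP E.
    by rewrite -scalemxAl scaleNr -scalerN -E scalerA mulVf // scale1r.
  exact: submxMl.
have u'0 : u' = 0.
  by move: E; rewrite u0 scale0r add0r => E; apply: (row_free_inj fS); rewrite mul0mx.
apply/rowP => i; rewrite mxE; case: (unliftP ord0 i) => [j ->|->] //.
by move/rowP: u'0 => /(_ j); rewrite !mxE.
Qed.

Lemma finite_gap (s : seq C) : exists2 del : R, 0 < del & forall z, z \in s -> z != 0 -> del <= nr z.
Proof.
elim: s => [|z s [del del0 IH]]; first by exists 1.
exists (if z == 0 then del else Num.min del (nr z)).
  by case: eqVneq => // zn; rewrite lt_min del0 nr_gt0.
move=> w; rewrite inE => /orP[/eqP ->|ws] wn; first by rewrite (negbTE wn) ge_min lexx orbT.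
by case: eqVneq => _; [exact: IH|rewrite ge_min IH].
Qed.

(** The numbers are chosen one by one: a new one must avoid finitely many nonzero values, and being
    smaller than all of them suffices. *)
Lemma distinct_sums (A : set C) (d N : nat) :
  (forall del : R, 0 < del -> exists x, [/\ A x, x != 0 & nr x < del]) ->
  exists x : 'I_N -> C, (forall j, A (x j)) /\
    injective (fun a : {ffun 'I_N -> 'I_d.+1} => \sum_j (a j)%:R * x j).
Proof.
move=> hA; elim: N => [|N [x [Ax ix]]].
  by exists (fun=> 0); split => [[] //|a b _]; apply/ffunP => -[].
(* The values of the new number for which two sums collide. Equal digits give a division by zero,
   hence the value 0, which z avoids by being nonzero. *)
pose bad (u : {ffun 'I_N -> 'I_d.+1} * {ffun 'I_N -> 'I_d.+1} * 'I_d.+1 * 'I_d.+1) : C :=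
  (\sum_j (u.1.1.1 j)%:R * x j - \sum_j (u.1.1.2 j)%:R * x j) / (u.1.2%:R - u.2%:R).
have [del del0 hdel] := finite_gap (codom bad).
have [z [Az zn zdel]] := hA del del0.
exists (fun i => if unlift ord0 i is Some j then x j else z); split.
  by move=> i; case: (unlift _ _).
move=> a b /=; rewrite !big_ord_recl unlift_none => E.
pose a' : {ffun 'I_N -> 'I_d.+1} := [ffun j => a (lift ord0 j)].
pose b' : {ffun 'I_N -> 'I_d.+1} := [ffun j => b (lift ord0 j)].
have Ea (c : {ffun 'I_N.+1 -> 'I_d.+1}) :
    \sum_(i < N) (c (lift ord0 i))%:R * (if unlift ord0 (lift ord0 i) is Some j then x j else z) =
    \sum_j ([ffun j => c (lift ord0 j)] j : 'I_d.+1)%:R * x j.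
  by apply: eq_bigr => j _; rewrite liftK ffunE.
rewrite !Ea -/a' -/b' in E.
have E0 : a ord0 = b ord0.
  apply: contrapT => /eqP ab.
  have ab' : (b ord0)%:R - (a ord0)%:R != 0 :> C.
    by rewrite subr_eq0 eqr_nat eq_sym.
  have Ez : z = bad (a', b', b ord0, a ord0).
    rewrite /bad /=; apply: (mulIf ab'); rewrite divfK //.
    move: E; move: (\sum_j _) (\sum_j _) => p q E.
    by apply/eqP; rewrite mulrBr subr_eq addrAC -subr_eq opprK mulrC [z * _]mulrC -E addrC.
  have := hdel z; rewrite {1}Ez codom_f => /(_ isT zn); by rewrite leNgt zdel.
move: E; rewrite E0 => /addrI /ix E'.
apply/ffunP => i; case: (unliftP ord0 i) => [j ->|-> //].
by move/ffunP: E' => /(_ j); rewrite !ffunE.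
Qed.

End Rank.

(** * Relations between solutions of linear differential equations *)

Section LogDerivative.
Context {R : realType}.
Notation C := (Cplx R).

(** The form f' = a f expresses the logarithmic derivative without a division. *)
Lemma logder_mul (f g : C -> C) (z a b : C) : is_derive z 1 f (a * f z) ->
  is_derive z 1 g (b * g z) -> is_derive z 1 (fun w => f w * g w) ((a + b) * (f z * g z)).
Proof. by move=> df dg; apply: (is_derive_eq (cderM df dg)); ring. Qed.

Lemma logder_cst (c z : C) : is_derive z 1 (fun=> c : C) (0 * c).
Proof. by rewrite mul0r; exact: cder_cst. Qed.

Lemma logder_exp (f : C -> C) (z a : C) n : is_derive z 1 f (a * f z) ->
  is_derive z 1 (fun w => f w ^+ n) (n%:R * a * f z ^+ n).
Proof.
move=> df; elim: n => [|n IH].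
  have -> : (fun w => f w ^+ 0) = (fun=> 1 : C) by apply/funext => w; rewrite expr0.
  by rewrite expr0 mul0r; exact: logder_cst.
have -> : (fun w => f w ^+ n.+1) = (fun w => f w * f w ^+ n) by apply/funext => w; rewrite exprS.
apply: (is_derive_eq (logder_mul df IH)); rewrite exprS -natr1.
by move: (f z) (_ ^+ n) (n%:R) => *; ring.
Qed.

Lemma logder_prod (I : Type) (s : seq I) (f : I -> C -> C) (a : I -> C) (z : C) :
  (forall i, is_derive z 1 (f i) (a i * f i z)) ->
  is_derive z 1 (fun w => \prod_(i <- s) f i w) ((\sum_(i <- s) a i) * \prod_(i <- s) f i z).
Proof.
move=> df; elim: s => [|i s IH].
  have -> : (fun w => \prod_(i <- [::]) f i w) = (fun=> 1 : C) by apply/funext => w; rewrite big_nil.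
  by rewrite !big_nil; exact: logder_cst.
have -> : (fun w => \prod_(j <- i :: s) f j w) = (fun w => f i w * \prod_(j <- s) f j w).
  by apply/funext => w; rewrite big_cons.
by rewrite !big_cons; exact: logder_mul (df i) IH.
Qed.

Lemma cder_sum (I : Type) (s : seq I) (f : I -> C -> C) (a : I -> C) (z : C) :
  (forall i, is_derive z 1 (f i) (a i)) ->
  is_derive z 1 (fun w => \sum_(i <- s) f i w) (\sum_(i <- s) a i).
Proof.
move=> df; elim: s => [|i s IH].
  have -> : (fun w => \sum_(i <- [::]) f i w) = (fun=> 0 : C) by apply/funext => w; rewrite big_nil.
  by rewrite big_nil; exact: cder_cst.
have -> : (fun w => \sum_(j <- i :: s) f j w) = (fun w => f i w + \sum_(j <- s) f j w).
  by apply/funext => w; rewrite big_cons.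
by rewrite big_cons; exact: cderD (df i) IH.
Qed.

Lemma derive_zero (f : C -> C) (z L : C) (A : set C) : open A -> A z ->
  (forall w, A w -> f w = 0) -> is_derive z 1 f L -> L = 0.
Proof.
move=> oA Az f0 [df <-]; set L' := 'D_1 f z.
have [rho rho0 hrho] := iffLR (open_nrP _) oA _ Az.
apply: nr_eq0; apply: contrapT => /eqP Ln.
have L0 : 0 < nr L' by rewrite lt_neqAle eq_sym Ln nr_ge0.
have L2 : 0 < nr L' / 2 by rewrite divr_gt0.
have [d d0 hd] := derivable_nr df L2.
pose t := Num.min rho d / 2.
have m0 : 0 < Num.min rho d by rewrite lt_min rho0 d0.
have t0 : 0 < t by rewrite divr_gt0.
have tm : t < Num.min rho d by rewrite /t; move: m0; clear; move: (Num.min _ _) => *; lra.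
have nt : nr (t%:C : C) = t by rewrite nrC ger0_norm // ltW.
move: tm; rewrite lt_min => /andP[tr td].
have Et : nr (z + t%:C - z : C) = t by rewrite addrC addKr.
have := hd (z + t%:C); rewrite Et => /(_ td).
rewrite (f0 _ Az) f0; last by apply: hrho; rewrite Et.
rewrite subrr sub0r nrN nrM Et -/L'; move: (nr L') L0 t0; clear; move: (t) => a b *; nra.
Qed.

(** Only the point of index i0 moves; the monomial of exponent a then has the logarithmic derivative
    \sum_j a_j mu_j (S i0). *)
Lemma relation_derive N d r (E mu : 'I_N -> C -> C) (Om : 'I_r -> set C)
    (k : {ffun 'I_N -> 'I_d.+1} -> C) :
  (forall i, open (Om i)) ->
  (forall i j s, Om i s -> is_derive s 1 (E j) (mu j s * E j s)) ->
  (forall S : 'I_r -> C, (forall i, Om i (S i)) ->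
     \sum_a k a * \prod_j (\prod_i E j (S i)) ^+ a j = 0) ->
  forall i0 (S : 'I_r -> C), (forall i, Om i (S i)) ->
     \sum_a k a * (\sum_j (a j)%:R * mu j (S i0)) * \prod_j (\prod_i E j (S i)) ^+ a j = 0.
Proof.
move=> oO dE rel i0 S OS.
pose T s (i : 'I_r) : C := if i == i0 then s else S i.
pose K (a : {ffun 'I_N -> 'I_d.+1}) := \prod_j (\prod_(i | i != i0) E j (S i)) ^+ a j.
have split (a : {ffun 'I_N -> 'I_d.+1}) (S' : 'I_r -> C) : (forall i, i != i0 -> S' i = S i) ->
    \prod_j (\prod_i E j (S' i)) ^+ a j = K a * \prod_j E j (S' i0) ^+ a j.
  move=> SS; rewrite /K -big_split /=; apply: eq_bigr => j _.
  rewrite (bigD1 i0) //= exprMn mulrC; congr (_ ^+ _ * _).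
  by apply: eq_bigr => i /SS ->.
pose f s := \sum_a k a * K a * \prod_j E j s ^+ a j.
have f0 s : Om i0 s -> f s = 0.
  move=> Os; have OT i : Om i (T s i) by rewrite /T; case: eqP => [->|].
  apply: etrans (rel (T s) OT); apply: eq_bigr => a _.
  rewrite (split a (T s)); last by move=> i /negbTE; rewrite /T => ->.
  by rewrite /T eqxx mulrA.
have df : is_derive (S i0) 1 f
    (\sum_a k a * K a * ((\sum_j (a j)%:R * mu j (S i0)) * \prod_j E j (S i0) ^+ a j)).
  apply: (@cder_sum _ _ (fun a s => k a * K a * \prod_j E j s ^+ a j)) => a.
  apply: cderZ; apply: (@logder_prod _ _ (fun j s => E j s ^+ a j)) => j.
  by apply: logder_exp; exact: dE (OS i0).
apply: etrans (derive_zero (oO i0) (OS i0) f0 df).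
apply: eq_bigr => a _; rewrite (split a S) //.
by move: (K a) (\prod_j _) (\sum_j _) (k a) => *; ring.
Qed.

(* A relation that is stable under k |-> k * X has only trivial solutions when
   X takes distinct values: multiply by the X - X b, b != a0. *)
Lemma relation_trivial N d r (E mu : 'I_N -> C -> C) (Om : 'I_r -> set C) (x : 'I_N -> C)
    (k : {ffun 'I_N -> 'I_d.+1} -> C) :
  (forall i, open (Om i)) -> (forall i, Om i !=set0) ->
  (forall i j s, Om i s -> E j s != 0 /\ is_derive s 1 (E j) (mu j s * E j s)) ->
  (forall S : 'I_r -> C, (forall i, Om i (S i)) ->
     exists b : 'I_r -> C, forall j, x j = \sum_i b i * mu j (S i)) ->
  injective (fun a : {ffun 'I_N -> 'I_d.+1} => \sum_j (a j)%:R * x j) ->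
  (forall S : 'I_r -> C, (forall i, Om i (S i)) ->
     \sum_a k a * \prod_j (\prod_i E j (S i)) ^+ a j = 0) ->
  forall a, k a = 0.
Proof.
move=> oO nO dE hx ix rel a0.
pose X (a : {ffun 'I_N -> 'I_d.+1}) := \sum_j (a j)%:R * x j.
pose Rel (k : {ffun 'I_N -> 'I_d.+1} -> C) := forall S : 'I_r -> C, (forall i, Om i (S i)) ->
     \sum_a k a * \prod_j (\prod_i E j (S i)) ^+ a j = 0.
(* The coefficients b depend on S, which is harmless: the combination is formed pointwise, after
   differentiation, and the weight X a that results does not depend on S. *)
have step k' z : Rel k' -> Rel (fun a => k' a * (X a - z)).
  move=> rel' S OS; have [b hb] := hx S OS.
  have := relation_derive oO (fun i j s h => (dE i j s h).2) rel' => der.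
  have EX a : X a = \sum_i b i * \sum_j (a j)%:R * mu j (S i).
    rewrite /X; under eq_bigr do rewrite hb mulr_sumr.
    rewrite exchange_big; apply: eq_bigr => i _; rewrite mulr_sumr.
    by apply: eq_bigr => j _; rewrite mulrCA.
  transitivity (\sum_i b i * (\sum_a k' a * (\sum_j (a j)%:R * mu j (S i)) *
      \prod_j (\prod_i E j (S i)) ^+ a j) -
     z * \sum_a k' a * \prod_j (\prod_i E j (S i)) ^+ a j).
    under [X in _ = X - _]eq_bigr do rewrite mulr_sumr.
    rewrite exchange_big /= mulr_sumr -sumrB; apply: eq_bigr => a _.
    rewrite EX mulrBr mulrBl; congr (_ - _); last by rewrite mulrAC mulrC.
    rewrite mulr_sumr mulr_suml; apply: eq_bigr => i _.
    by move: (\prod_j _) (\sum_j _) (k' a) (b i) => *; ring.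
  rewrite rel' // mulr0 subr0 big1 // => i _; by rewrite der // mulr0.
have steps (s : seq C) : Rel (fun a => k a * \prod_(z <- s) (X a - z)).
  elim: s => [|z s IH] S OS.
    by rewrite -[RHS](rel S OS); apply: eq_bigr => a _; rewrite big_nil mulr1.
  rewrite -[RHS](step _ z IH S OS); apply: eq_bigr => a _; rewrite big_cons.
  by rewrite [X in _ * X * _]mulrC !mulrA.
have [S OS] := choice nO.
have := steps [seq X b | b <- index_enum _ & b != a0] S OS.
under eq_bigr do rewrite big_map big_filter.
rewrite (bigD1 a0) //= [X in _ + X]big1 ?addr0.
  move/eqP; rewrite !mulf_eq0 => /orP[/orP[/eqP //|]|]; apply: contraTeq => _.
    by apply/prodf_neq0 => b ba0; rewrite subr_eq0; apply: contraNneq ba0 => /ix ->.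
  apply/prodf_neq0 => j _; apply: expf_neq0; apply/prodf_neq0 => i _.
  exact: (dE i j _ (OS i)).1.
by move=> a aa0; rewrite (bigD1 a) //= subrr mul0r mulr0 mul0r.
Qed.

End LogDerivative.

(** * Vanishing of the derivative of F *)

Section Core.
Context {R : realType}.
Notation C := (Cplx R).

(** Each j may move the centre, so discs around one point cannot be intersected; they are nested one
    after the other, and the properties already obtained pass to subdiscs. *)
Lemma common_ball (I : eqType) (js : seq I) (B : C -> Prop) (Q : I -> C -> R -> Prop) :
  (forall j s r s' r', Q j s r -> (forall x, nr (x - s') < r' -> nr (x - s) < r) -> Q j s' r') ->
  (forall j s r, 0 < r -> (forall x, nr (x - s) < r -> B x) ->
     exists s' r', [/\ 0 < r', forall x, nr (x - s') < r' -> nr (x - s) < r & Q j s' r']) ->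
  forall s r, 0 < r -> (forall x, nr (x - s) < r -> B x) ->
     exists s' r', [/\ 0 < r', forall x, nr (x - s') < r' -> nr (x - s) < r &
       forall j, j \in js -> Q j s' r'].
Proof.
move=> mono ex s r r0 hB; elim: js => [|j js [s1 [r1 [r10 sub1 IH]]]]; first by exists s, r.
have [s2 [r2 [r20 sub2 Q2]]] := ex j s1 r1 r10 (fun x h => hB x (sub1 x h)).
exists s2, r2; split=> // [x /sub2 /sub1 //|i]; rewrite inE => /orP[/eqP -> //|/IH h].
exact: mono h sub2.
Qed.

(** Without small nonzero values phi would vanish near t0, by continuity, and so would its
    derivative. *)
Lemma small_values (phi : C -> C) (t0 L : C) (d : R) : 0 < d -> phi t0 = 0 ->
  is_derive t0 1 phi L -> L != 0 -> forall del : R, 0 < del ->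
  exists x, [/\ (exists2 tau, nr (tau - t0) < d & phi tau = x), x != 0 & nr x < del].
Proof.
move=> d0 p0 dphi Ln del del0.
have [e e0 he] := iffLR (continuous_nrP _ _) (derivable_cont (let: DeriveDef h _ := dphi in h)) _ del0.
apply: contrapT => hno.
have oB := open_nball t0 (Num.min d e).
move/eqP: Ln; apply; apply: (derive_zero oB _ _ dphi).
  by rewrite /= subrr nr0 lt_min d0 e0.
move=> w /=; rewrite lt_min => /andP[wd we]; apply: contrapT => /eqP pw.
apply: hno; exists (phi w); split=> //; first by exists w.
by have := he w we; rewrite p0 subr0.
Qed.

Lemma dotp_sum n r (u : 'rV[C]_n) (b : 'rV[C]_r) (M : 'M[C]_(r, n)) :
  dotp u (b *m M) = \sum_i b 0 i * dotp u (row i M).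
Proof.
rewrite /dotp; under eq_bigr do rewrite mxE mulr_sumr.
rewrite exchange_big; apply: eq_bigr => i _; rewrite mulr_sumr.
by apply: eq_bigr => j _; rewrite mxE mulrCA.
Qed.

Lemma dotp_conj_neq0 n (v : 'rV[C]_n) : v != 0 -> dotp v (conj_vec v) != 0.
Proof.
move=> /rV0Pn [i vi]; rewrite /dotp.
have E j : v 0 j * conj_vec v 0 j = `|v 0 j| ^+ 2 by rewrite mxE normCK.
under eq_bigr do rewrite E.
rewrite psumr_neq0; last by move=> j _; rewrite exprn_ge0.
by apply/hasP; exists i; rewrite ?mem_index_enum //= exprn_gt0 // normr_gt0.
Qed.

Lemma flat_curve_constant m n (U : set 'rV[C]_m) (W : set 'rV[C]_(m + m)) (psi : 'rV[C]_m -> R)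
    (h : 'rV[C]_(m + m) -> C) (l : C -> 'rV[C]_m) (F : C -> 'rV[C]_n) (t0 : C) (e : R)
    (V : set 'rV[C]_(m + m)) (P : mpoly.mpoly (m + m + 1) C) :
  open U -> open W -> (forall Q, W Q -> differentiable h Q) ->
  (forall w, U w -> W (diag_pt w) /\ h (diag_pt w) = (expR (psi w))%:C) -> 0 < e ->
  (forall t, nr (t - t0) < e -> [/\ U (l t), curve_at l t, curve_at F t &
     dotp (D1 F t) (conj_vec (D1 F t)) =
     \sum_j \sum_k D1 l t 0 j * ddbar psi (l t) j k * conjc (D1 l t 0 k)]) ->
  open V -> V (diag_pt (l t0)) -> V `<=` W -> P != 0 ->
  (forall x, V x -> mpoly.meval (fun i => row_mx x (const_mx (h x) : 'rV_1) 0 i) P = 0) ->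
  D1 F t0 = 0.
Proof.
move=> oU oW dh hU e0 hl oV Vp VW P0 hP.
have [d1 /andP[d10 d1e] ode] := polarized_ode oU oW dh hU e0 hl.
set s0 : C := conjc t0 in ode.
have t00 : nr (t0 - t0) < e by rewrite subrr nr0.
have [_ cl0 cF0 _] := hl t0 t00.
have [d2 d20 hV] : exists2 d2 : R, 0 < d2 & forall tau s : C, nr (tau - t0) < d2 ->
    nr (s - s0) < d2 -> V (row_mx (l tau) (cbar l s)).
  have cl0' : curve_at l (conjc s0) by rewrite conjcKC.
  have [dG _] := @diff_joint _ _ l (t0, s0) cl0 cl0'.
  have V0 : V (joint l (t0, s0)) by rewrite /joint /cbar /= conjcKC.
  have [r1 r10 hr1] := iffLR (open_nrP _) oV _ V0.
  have [r2 r20 hr2] := iffLR (continuous_nrP _ _) (differentiable_continuous dG) _ r10.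
  by exists r2 => // tau s h1 h2; apply: (hr1 (joint l (tau, s))); apply: hr2; apply/nr_pair_lt.
pose d := Num.min d1 d2.
have d0 : 0 < d by rewrite lt_min d10 d20.
have dd1 : d <= d1 by rewrite ge_min lexx.
have dd2 : d <= d2 by rewrite ge_min lexx orbT.
have cs (s : C) : nr (s - s0) < d -> nr (conjc s - t0 : C) < e.
  rewrite -(nr_conj (s - s0)) (rmorphB (@conjc R)).
  have -> : (conjc s - t0 : C) = (conjc s - conjc s0 : C) by rewrite /s0 conjcKC.
  move=> h1; apply: lt_le_trans h1 _; exact: le_trans dd1 d1e.
have cbF s : nr (s - s0) < d -> curve_at (cbar F) s.
  by move=> /cs h2; have [_ _ c _] := hl _ h2; exact: cbar_curve.
have cbl s : nr (s - s0) < d -> curve_at (cbar l) s.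
  by move=> /cs h2; have [_ c _ _] := hl _ h2; exact: cbar_curve.
pose G := D1 (cbar F).
have cG s : nr (s - s0) < d -> forall j, {for s, continuous (fun s => G s 0 j : C)}.
  by move=> hs j; exact: derivable_cont (@derivable_D1 R n (cbar F) s0 d j cbF s hs).
have [r [S0 [BS0 [del del0 hS0]]]] := maximal_rank d0 cG.
have Gs0 : G s0 = conj_vec (D1 F t0).
  rewrite /G D1_cbar; first by congr (conj_vec (D1 F _)); exact: conjcKC.
  by rewrite /s0 conjcKC.
apply: contrapT => /eqP nz.
(* The multiplier attached to tau. Its derivative at t0 is the square of the norm of F' t0, so it
   takes arbitrarily small nonzero values. *)
pose phi (tau : C) : C := dotp (F tau - F t0) (G s0).
have dphi : is_derive t0 1 phi (dotp (D1 F t0) (G s0)).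
  have E : phi = (fun tau => \sum_i (G s0 0 i * F tau 0 i - G s0 0 i * F t0 0 i)).
    by apply/funext => tau; apply: eq_bigr => i _; rewrite !mxE -mulrBr mulrC.
  rewrite E.
  have dF i : is_derive t0 1 (fun tau => F tau 0 i : C) (D1 F t0 0 i).
    by rewrite [D1 F t0 0 i]mxE; exact: derivableP (cF0 i).
  have dd i := cderB (cderZ (G s0 0 i) (dF i)) (cder_cst (G s0 0 i * F t0 0 i) t0).
  apply: (is_derive_eq (cder_sum (index_enum _) dd)).
  have aux (a b : C) : a * b - 0 = b * a by rewrite subr0 mulrC.
  by apply: eq_bigr => i _; exact: aux.
have phi0 : phi t0 = 0.
  by rewrite /phi subrr /dotp big1 // => i _; rewrite mxE mul0r.
have Ln : dotp (D1 F t0) (G s0) != 0 by rewrite Gs0; exact: dotp_conj_neq0.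
have [D hD] := nash_relation oV P0 (fun x Vx => differentiable_continuous (dh x (VW x Vx))) hP.
have [dd hdep] := @algebraic_dependence C C m r D.
set N := (r * m).+1 in hdep.
have [x [Ax ix]] := distinct_sums dd N (small_values d0 phi0 dphi Ln).
have {}Ax j : exists tau, nr (tau - t0) < d /\ phi tau = x j.
  by have [w w1 w2] := Ax j; exists w.
have [tau htau] := choice Ax.
(* Index 0 carries t0, the parameter of the common denominator y_0. *)
pose tt (j : 'I_N.+1) := if unlift ord0 j is Some j' then tau j' else t0.
have tB j : nr (tt j - t0) < d.
  by rewrite /tt; case: (unlift _ _) => [j'|]; [exact: (htau j').1|rewrite subrr nr0].
pose y (j : 'I_N.+1) (s : C) := h (row_mx (l (tt j)) (cbar l s)).
pose lam (k : 'I_m) (s : C) := cbar l s 0 k.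
pose Q (j : 'I_N.+1) (s1 : C) (r1 : R) := exists (p : C -> C) (c : nat -> C -> C),
  [/\ polyfun lam D p, forall e, polyfun lam D (c e) & forall s, nr (s - s1) < r1 -> p s != 0 /\
     p s * y j s ^+ D.+1 = \sum_(e < D.+1) c e s * y j s ^+ e].
have hball (i : 'I_r) : exists sr : C * R, [/\ 0 < sr.2,
    forall x, nr (x - sr.1) < sr.2 -> nr (x - S0 i) < del & forall j, Q j sr.1 sr.2].
  have [||w hw|s' [r' [h1 h2 h3]]] :=
    @common_ball 'I_N.+1 (enum 'I_N.+1) (fun s => nr (s - s0) < d) Q _ _ (S0 i) del del0.
  - move=> j s1 r1 s' r' [p [c [h1 h2 h3]]] sub; exists p, c; split=> // s /sub; exact: h3.
  - move=> j s1 r1 r10 hB.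
    have [|s' [r' [h1 h2 [p [c hpc]]]]] := hD (l (tt j)) (cbar l) s1 r1 r10.
      move=> s /hB hs; split; last by move=> k; exact: derivable_cont (cbl s hs k).
      by apply: hV; [exact: lt_le_trans (tB j) dd2|exact: lt_le_trans hs dd2].
    by exists s', r'; split=> //; exists p, c.
  (* [hS0] speaks of all r points at once, so the others are kept at [S0]. *)
  - have [|] := hS0 (fun i' => if i' == i then w else S0 i').
      by move=> i'; case: eqP => [->|_] //; rewrite subrr nr0.
    by move=> /(_ i); rewrite eqxx.
  by exists (s', r'); split=> // j; apply: h3; rewrite mem_enum.
have [sr hsr] := choice hball.
pose Om (i : 'I_r) : set C := [set s | nr (s - (sr i).1) < (sr i).2].
have OmB (S : 'I_r -> C) : (forall i, Om i (S i)) ->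
    (forall i, nr (S i - s0) < d) /\ (G s0 <= \matrix_i G (S i))%MS.
  by move=> OS; apply: hS0 => i; have [_ h2 _] := hsr i; exact: h2 (OS i).
have OmB1 i s : Om i s -> nr (s - s0) < d.
  move=> Os; pose S i' := if i' == i then s else (sr i').1.
  have [|h1 _] := OmB S.
    move=> i'; rewrite /S; case: eqP => [->|_] //; rewrite /Om /= subrr nr0.
    by have [] := hsr i'.
  by have := h1 i; rewrite /S eqxx.
have odeB j s : nr (s - s0) < d -> y j s != 0 /\ is_derive s 1 (fun s => y j s / y ord0 s)
    (dotp (F (tt j) - F t0) (G s) * (y j s / y ord0 s)).
  move=> hs; have y0E : y ord0 = fun s => h (row_mx (l t0) (cbar l s)).
    by apply/funext => w; rewrite /y /tt unlift_none.
  have [_ h1 h2] := ode (tt j) s (lt_le_trans (tB j) dd1) (lt_le_trans hs dd1).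
  by rewrite y0E.
have [||k [[a ka] hk]] := hdep lam y Om.
- move=> i j; have [_ _ h3] := hsr i; have [p [c [c1 c2 c3]]] := h3 j.
  by exists p, c; split=> // s Os; exact: c3.
- by move=> i s /OmB1 hs; exact: (odeB ord0 s hs).1.
have ttl j : tt (lift ord0 j) = tau j by rewrite /tt liftK.
have := @relation_trivial R N dd r (fun j s => y (lift ord0 j) s / y ord0 s)
  (fun j s => dotp (F (tau j) - F t0) (G s)) Om x k.
move=> /(_ _ _ _ _ ix hk a) k0; move/eqP: ka; apply; apply: k0.
- by move=> i; exact: open_nball.
- by move=> i; exists (sr i).1; rewrite /Om /= subrr nr0; have [] := hsr i.
- move=> i j s /OmB1 hs; have [n1 d1'] := odeB (lift ord0 j) s hs; have [n0 _] := odeB ord0 s hs.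
  rewrite ttl in d1'; split; last exact: d1'.
  by rewrite mulf_neq0 // invr_neq0.
(* The coefficients of G s0 in the span of the G (S i) express x_j, by linearity of [dotp], through
   the logarithmic derivatives at the points S i. *)
move=> S /OmB [_ /submxP [b Eb]]; exists (b 0) => j.
rewrite -(htau j).2 /phi Eb dotp_sum; apply: eq_bigr => i _.
by rewrite rowK.
Qed.

End Core.

(** * Charts *)

Section Assembly.
Context {R : realType}.
Notation C := (Cplx R).

Lemma pull_row m (a : 'rV[C]_m) (G : 'M[C]_m) :
  pull a G 0 0 = \sum_j \sum_k a 0 j * G j k * conjc (a 0 k).
Proof.
rewrite /pull mxE exchange_big; apply: eq_bigr => k _ /=.
rewrite !mxE mulr_suml; apply: eq_bigr => j _; by [].
Qed.

Lemma pull_row1 m (a : 'rV[C]_m) : pull a 1%:M 0 0 = dotp a (conj_vec a).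
Proof. by rewrite /pull mulmx1 mxE; apply: eq_bigr => k _; rewrite !mxE. Qed.

Lemma pull_mul s k m (A : 'M[C]_(s, k)) (B : 'M[C]_(k, m)) (G : 'M[C]_m) :
  pull A (pull B G) = pull (A *m B) G.
Proof. by rewrite /pull map_mxM trmx_mul !mulmxA. Qed.

Lemma jacobianE k m (f : 'rV[C]_k -> 'rV[C]_m) (p v : 'rV[C]_k) : differentiable f p ->
  v *m 'J f p = 'd f p v.
Proof. by move=> df; rewrite /jacobian mul_rV_lin1. Qed.

Lemma diff_near_rV k m (f g : 'rV[C]_k -> 'rV[C]_m) (x : 'rV[C]_k) :
  (\forall y \near x, f y = g y) -> differentiable f x ->
  differentiable g x /\ forall v, 'd g x v = 'd f x v.
Proof.
move=> fg df.
have cf i : differentiable (fun y => f y 0 i : C) x /\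
    forall v, 'd (fun y => f y 0 i : C) x v = 'd f x v 0 i.
  have [dc Ec] := diff_coord (f x) i; have [h1 h2] := diff_comp_app df dc.
  by split; [exact: h1|move=> v; apply: etrans (h2 v) _; exact: Ec].
have cg i : differentiable (fun y => g y 0 i : C) x /\
    forall v, 'd (fun y => g y 0 i : C) x v = 'd (fun y => f y 0 i : C) x v.
  by apply: (diffc_near _ (cf i).1); apply: filterS fg => y ->.
have [dg Eg] := diff_rV (fun i => (cg i).1).
split; first exact: dg.
move=> v; apply/rowP => i; apply: etrans (Eg v i) _; apply: etrans ((cg i).2 v) _; exact: (cf i).2.
Qed.

Lemma curve_line k m (f : 'rV[C]_k -> 'rV[C]_m) (y u : 'rV[C]_k) (t : C) :
  differentiable f (y + t *: u) ->
  curve_at (fun t => f (y + t *: u)) t /\ D1 (fun t => f (y + t *: u)) t = u *m 'J f (y + t *: u).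
Proof.
move=> df.
have key j : is_derive t 1 (fun t => f (y + t *: u) 0 j : C) ((u *m 'J f (y + t *: u)) 0 j).
  have [dc Ec] := diff_coord (f (y + t *: u)) j; have [h1 h2] := diff_comp_app df dc.
  have h := @cder_line R _ (fun z => f z 0 j : C) y u t h1.
  rewrite jacobianE //; apply: (is_derive_eq h).
  by apply: etrans (h2 u) _; exact: Ec.
split; first by move=> j; case: (key j).
by apply/rowP => j; rewrite mxE; case: (key j).
Qed.

Definition flat_chart n : chart R (complex_space R n) n := Chart setT id id.

Lemma crange_cinv s (X : manifold R s) (c : chart R X s) z : is_chart c -> crange c z ->
  cdom c (cinv c z) /\ cfun c (cinv c z) = z.
Proof. by move=> [_ _ h _ _] [y cy <-]; rewrite h. Qed.

(** The coordinates d that carry the potential need not belong to the atlas, so f is read first in a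
    chart c1 of the atlas and then transported by the chain rule. *)
Lemma local_rep_coordinates s m (X : manifold R s) (M : manifold R m) (D : set X) (f : X -> M)
    (c : chart R X s) (d : chart R M m) (x : X) :
  complex_manifold M -> is_chart c -> atlas X c -> holomorphic_map D f ->
  holomorphic_coordinates d -> D x -> cdom c x -> cdom d (f x) ->
  forall c1, atlas M c1 -> cdom c1 (f x) ->
  differentiable (local_rep c d f) (cfun c x) /\
  'J (local_rep c d f) (cfun c x) =
    'J (local_rep c c1 f) (cfun c x) *m 'J (transition c1 d) (cfun c1 (f x)).
Proof.
move=> [_ _ Mc _ _] [c_1 c_2 c_3 c_4 c_5] ac [oD hf] [dch dcomp] Dx cx dfx c1 ac1 c1fx.
have [cf df] := hf x Dx.
have df1 := df c c1 ac ac1 cx c1fx.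
have [dt _] := dcomp c1 ac1 (f x) c1fx dfx.
have Ex : cinv c (cfun c x) = x by exact: c_3.
have dt' : differentiable (transition c1 d) (local_rep c c1 f (cfun c x)).
  by rewrite /local_rep /= Ex.
have [h1 h2] := diff_comp_app df1 dt'.
have [oc1 _ ic1 _ _] := Mc c1 ac1.
have near : \forall z \near cfun c x, transition c1 d (local_rep c c1 f z) = local_rep c d f z.
  have N : nbhs (cfun c x) (fun z => cdom c1 (f (cinv c z))).
    have cc : cinv c @ cfun c x --> cinv c (cfun c x) by apply: c_5; exists x.
    rewrite Ex in cc; apply: (cc (fun y => cdom c1 (f y))).
    by apply: cf; exact: open_nbhs_nbhs.
  by apply: filterS N => z hz; rewrite /transition /local_rep /= ic1.
have [g1 g2] := diff_near_rV near h1.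
split; first exact: g1.
have Efx : cfun c1 (f x) = local_rep c c1 f (cfun c x) by rewrite /local_rep /= Ex.
rewrite Efx; apply/row_matrixP => i; rewrite !rowE mulmxA; move: (delta_mx 0 i) => v.
apply: etrans (jacobianE v g1) _; apply: etrans (g2 v) _; apply: etrans (h2 v) _.
rewrite -(jacobianE v df1); exact: esym (jacobianE _ dt').
Qed.

(** The maps are restricted to the complex line directed by u in the chart c, which gives a pair of
    curves. Sources of any dimension are thus covered: the domain in C as well as a common
    submanifold. *)
Lemma flat_map_critical m (M : manifold R m) (gM : metric M) (hM : complex_manifold M)
    (hpot : forall x : M, exists (d : chart R M m) (psi : M -> R),
       [/\ holomorphic_coordinates d, cdom d x,
           real_analytic (crange d) (psi \o cinv d),
           kahler_potential gM d psi &
           exists (W : set 'rV[Cplx R]_(m + m)) (h : 'rV[Cplx R]_(m + m) -> Cplx R),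
             polarization (crange d) (fun z => expR (psi (cinv d z))) W h /\
             nash W h])
    (n s : nat) (X : manifold R s) (D : set X) (f : X -> M) (g : X -> complex_space R n)
    (x : X) (c : chart R X s) (u : 'rV[C]_s) :
  holomorphic_map D f -> holomorphic_map D g ->
  same_pullback gM (@flat_metric R n) D f g ->
  D x -> atlas X c -> is_chart c -> cdom c x ->
  u *m 'J (local_rep c (flat_chart n) g) (cfun c x) = 0.
Proof.
move=> hf hg same Dx ac cch cx.
have [d [psi [dhol dfx _ kpot [W [h [[[oW dh] _ pol] [_ nashh]]]]]]] := hpot (f x).
have [dch _] := dhol.
set z0 := cfun c x.
pose l (t : C) : 'rV[C]_m := local_rep c d f (z0 + t *: u).
pose F (t : C) : 'rV[C]_n := local_rep c (flat_chart n) g (z0 + t *: u).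
have [oc ocr ic cc ccr] := cch.
have [oD hf'] := hf; have [_ hg'] := hg.
have [cf _] := hf' x Dx.
have [r r0 hr] : exists2 r : R, 0 < r & forall z, nr (z - z0) < r ->
    [/\ crange c z, D (cinv c z) & cdom d (f (cinv c z))].
  apply/(nbhs_nrP z0 (fun z => [/\ crange c z, D (cinv c z) & cdom d (f (cinv c z))])).
  have N1 : nbhs z0 (crange c) by apply: open_nbhs_nbhs; split => //; exists x.
  have cz : cinv c @ z0 --> x.
    have h1 : cinv c @ z0 --> cinv c z0 by apply: ccr; exists x.
    by rewrite /z0 ic in h1.
  have N2 : nbhs z0 (fun z => D (cinv c z)).
    by apply: (cz D); exact: open_nbhs_nbhs.
  have N3 : nbhs z0 (fun z => cdom d (f (cinv c z))).
    apply: (cz (fun y => cdom d (f y))); apply: cf; apply: open_nbhs_nbhs; split=> //.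
    by have [] := dch.
  by apply: filterS3 N1 N2 N3.
pose e := r / (nr u + 1).
have u1 : 0 < nr u + 1 by rewrite ltr_wpDl // nr_ge0.
have e0 : 0 < e by exact: divr_gt0.
have line (t : C) : nr (t - 0) < e -> nr (z0 + t *: u - z0) < r.
  rewrite subr0 addrC addKr nrZ /e ltr_pdivlMr //.
  by have := nr_ge0 t; move: (nr t) (nr u); clear; intros; lra.
have l0 : l 0 = cfun d (f x) by rewrite /l /local_rep scale0r addr0 /= ic.
have Wl0 : W (diag_pt (l 0)) by rewrite l0; apply: (pol _ _).1; exists (f x).
have [V [P [oV Vl VW P0 hP]]] := nashh _ Wl0.
have key (t : C) : nr (t - 0) < e -> [/\ crange d (l t), curve_at l t, curve_at F t &
     dotp (D1 F t) (conj_vec (D1 F t)) =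
     \sum_j \sum_k D1 l t 0 j * ddbar (psi \o cinv d) (l t) j k * conjc (D1 l t 0 k)].
  move=> /line /hr []; set z := z0 + t *: u; set y := cinv c z => cz Dy dfy.
  have [cy Ez] := crange_cinv cch cz; rewrite -/y in cy Ez.
  have [_ _ _ _ ex] := hM; have [c1 ac1 c1y] := ex (f y).
  have [df Jf] := local_rep_coordinates hM cch ac hf dhol Dy cy dfy ac1 c1y.
  have flata : atlas (complex_space R n) (flat_chart n) by [].
  have dg := (hg' y Dy).2 c (flat_chart n) ac flata cy I.
  rewrite Ez in df Jf dg.
  have [cl Dl] := curve_line df; have [cF DF] := curve_line dg.
  split; first by exists (f y).
  - exact: cl.
  - exact: cF.
  have := same y c c1 (flat_chart n) Dy ac ac1 flata cy c1y I.
  rewrite /pullback (kpot c1 (f y) ac1 c1y dfy) pull_mul Ez -Jf /flat_metric flat_ddbar.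
  move=> /(congr1 (fun A => pull u A 0 0)).
  rewrite !pull_mul -[u *m 'J (local_rep c d f) z]Dl -[u *m 'J (local_rep c _ g) z]DF.
  by rewrite pull_row1 => <-; rewrite pull_row.
have oU : open (crange d) by have [] := dch.
have := flat_curve_constant oU oW dh pol e0 key oV Vl VW P0 hP.
have z00 : nr ((0 : C) - 0) < e by rewrite subrr nr0.
have [_ _ _ _] := key 0 z00.
have dg0 : differentiable (local_rep c (flat_chart n) g) (z0 + 0 *: u).
  by rewrite scale0r addr0; exact: (hg' x Dx).2.
by have [_ ->] := curve_line dg0; rewrite scale0r addr0.
Qed.

End Assembly.

Section ComplexLine.
Context {R : realType}.
Notation C := (Cplx R).

Definition line_chart : chart R (complex_line R) 1 :=
  Chart setT (fun z : C => const_mx z) (fun v => v 0 0).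

Lemma is_chart_line : is_chart line_chart.
Proof.
have cr : crange line_chart = setT.
  by apply/seteqP; split=> // v _; exists (v 0 0) => //; apply/rowP => j; rewrite mxE ord1.
split.
- exact: openT.
- by rewrite cr; exact: openT.
- by move=> x _ /=; rewrite mxE.
- move=> x _.
  have E : cfun line_chart = (fun z : C => z *: (const_mx 1 : 'rV[C]_1)).
    by apply/funext => z; apply/rowP => j; rewrite !mxE mulr1.
  by rewrite E; exact: scalel_continuous.
- by move=> v _; exact: (@coord_continuous _ _ _ 0 0 v).
Qed.

Lemma connected_locally_constant (T : Type) (D : set C) (F : C -> T) : open D -> connected D ->
  (forall z, D z -> exists2 r : R, 0 < r & forall w, nr (w - z) < r -> F w = F z) ->
  forall z0 z, D z0 -> D z -> F z = F z0.
Proof.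
move=> oD cD hF z0 z Dz0 Dz.
have oE (P : T -> Prop) : open [set w | D w /\ P (F w)].
  apply/open_nrP => w [Dw Pw].
  have [r1 r10 hr1] := iffLR (open_nrP _) oD w Dw; have [r2 r20 hr2] := hF w Dw.
  exists (Num.min r1 r2); first by rewrite lt_min r10 r20.
  by move=> y; rewrite lt_min => /andP[/hr1 ? /hr2 E]; split; rewrite ?E.
have E : D `&` [set w | F w = F z0] = D.
  apply: cD; first by exists z0.
    exists [set w | D w /\ F w = F z0]; first exact: (oE (fun y => y = F z0)).
    by apply/seteqP; split=> w /= [? h]; split=> //; case: h.
  exists (~` [set w | D w /\ F w <> F z0]).
    by apply: open_closedC; exact: (oE (fun y => y <> F z0)).
  apply/seteqP; split=> w /= [Dw h]; split=> //; first by case.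
  by apply: contrapT => h'; apply: h.
by have : (D `&` [set w | F w = F z0]) z by [rewrite E]; case.
Qed.

End ComplexLine.

Theorem theorem2p7 (R : realType) (m : nat) (M : manifold R m) (gM : metric M)
    (hM : complex_manifold M) (hg : real_analytic_kahler gM)
    (hpot : forall x : M, exists (d : chart R M m) (psi : M -> R),
       [/\ holomorphic_coordinates d, cdom d x,
           real_analytic (crange d) (psi \o cinv d),
           kahler_potential gM d psi &
           exists (W : set 'rV[Cplx R]_(m + m)) (h : 'rV[Cplx R]_(m + m) -> Cplx R),
             polarization (crange d) (fun z => expR (psi (cinv d z))) W h /\
             nash W h])
    (n : nat) (hn : (1 <= n)%N) :
  (forall (D : set (complex_line R))
      (F : complex_line R -> complex_space R n) (L : complex_line R -> M),
     open D -> connected D ->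
     holomorphic_map D F -> holomorphic_map D L ->
     same_pullback (@flat_metric R n) gM D F L ->
     exists a : complex_space R n, forall z, D z -> F z = a) /\
  ~ relatives gM (@flat_metric R n).
Proof.
split.
  move=> D F L oD cD hF hL same.
  have same' : same_pullback gM (@flat_metric R n) D L F.
    by move=> x c d e Dx ac ad ae cx dx ex; apply: esym; exact: same.
  have dF (z : Cplx R) : D z -> curve_at (F : Cplx R -> 'rV_n) z /\ D1 (F : Cplx R -> 'rV_n) z = 0.
    move=> Dz.
    have az : atlas (complex_line R) line_chart by [].
    have := flat_map_critical hM hpot (const_mx 1) hL hF same' Dz az is_chart_line I.
    have dg := (hF.2 z Dz).2 line_chart (flat_chart n) az (erefl _) I I.
    (* Read in the chart of the complex line, F is its own restriction to the line through 0
       directed by 1, and [curve_line] turns the Jacobian into F'. *)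
    have Ez : cfun line_chart z = 0 + z *: const_mx 1 :> 'rV[Cplx R]_1.
      by apply/rowP => j; rewrite !mxE add0r mulr1.
    rewrite Ez in dg *; have := curve_line dg.
    have -> : (fun t : Cplx R => local_rep line_chart (flat_chart n) F (0 + t *: const_mx 1)) = F.
      by apply/funext => t; rewrite /local_rep /= !mxE add0r mulr1.
    by move=> [c1 ->].
  case: (pselect (exists z, D z)) => [[z0 Dz0]|nD]; last first.
    by exists (0 : 'rV_n) => z Dz; case: nD; exists z.
  exists (F z0) => z Dz.
  apply: (connected_locally_constant oD cD _ Dz0 Dz) => w Dw.
  have [r r0 hr] := iffLR (open_nrP _) oD w Dw; exists r => // y yw.
  apply/rowP => j; apply: (const_ball (f := fun t => F t 0 j) _ yw) => t /hr Dt.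
  have [ct D0] := dF t Dt; have := derivableP (ct j).
  by have := congr1 (fun v : 'rV_n => v 0 j) D0; rewrite !mxE => ->.
move=> [s [S [f [h [s0 hS [x _] [[hf _] [hh ih]] same]]]]].
have [_ _ Sc _ ex] := hS; have [c ac cx] := ex x.
(* The Jacobian of the map into the flat space kills every vector, whereas for an immersion it is
   injective; as s > 0, a basis vector is contradictory. *)
have J0 u := flat_map_critical hM hpot u hf hh same I ac (Sc c ac) cx.
have rf : row_free ('J (local_rep c (flat_chart n) h) (cfun c x)) by apply: ih.
pose i : 'I_s := Ordinal s0.
have : delta_mx 0 i = 0 :> 'rV[Cplx R]_s by apply: (row_free_inj rf); rewrite mul0mx J0.
by move=> /rowP /(_ i); rewrite !mxE !eqxx => /eqP; rewrite oner_eq0.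
Qed.
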